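(* Let $M,N$ be positive integers with $e^{64(M^2+M+1)}\le N$, and suppose that for each $i=1,\dots,N$, $G_i$ is a group with $\mathrm{rank}(G_i)\le M$. For each $i=1,\dots,N$, let $S_i\subset G_i$ be a generating set with $|S_i|=\mathrm{rank}(G_i)$, and assume that for each $i=1,\dots,N$, either the ball $B_2^{G_i}$ (with respect to $S_i$) contains no element of order two, or $\mathrm{girth}(G_i,S_i)\ge 5$. Let $G=G_1*G_2*\cdots*G_N$ be the free product and $S=\bigcup_{i=1}^N S_i\subset G$. Then $$\overline{\mathbf H}_{\min}(\Phi_{l,S}\circ\Phi_{r,S})\;<\;\overline{\mathbf H}_{\min}(\Phi_{l,S})+\overline{\mathbf H}_{\min}(\Phi_{r,S}).$$
   Context: Groups. The rank of a finitely generated group is the smallest cardinality of a generating set. Generating sets do not contain the neutral element $e$. For a generating set $S$ of a group $G$, the word length is $|e|=0$ and, for $g\ne e$, $|g|=\min\{n\ge 1: \exists\, s_1,\dots,s_n\in S \text{ such that } g=s_1s_2\cdots s_n\}$; the ball of radius $m$ is $B_m^G=\{g\in G:|g|\le m\}$. $\mathrm{girth}(G,S)$ is the girth of the Cayley graph of $G$ with respect to $S$, where the girth of a graph is the smallest length of a cycle (and infinite if the graph has no cycles). Regular representations. For a countable discrete group $G$, $\lambda_G(g)$ and $\rho_G(g)$ are the unitaries on $\ell^2(G)$ given by $(\lambda_G(g)\omega)(h)=\omega(g^{-1}h)$ and $(\rho_G(g)\omega)(h)=\omega(hg)$. Channels. For a Hilbert space $\mathcal H$, $\mathcal T(\mathcal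 H)$ is the space of trace class operators; a state is a positive $\xi\in\mathcal T(\mathcal H)$ with $\mathrm{tr}(\xi)=1$. A quantum channel is a completely positive trace-preserving map $\Phi:\mathcal T(\mathcal H)\to\mathcal T(\mathcal H)$. For a unitary $T$, $\mathrm{Ad}(T)(\xi)=T\xi T^*$. For a finite generating set $S=\{g_1,\dots,g_n\}$ (with $|S|=n$) of $G$, define channels on $\mathcal T(\ell^2(G))$ by $$\Phi_{l,S}=\frac1n\sum_{i=1}^n\mathrm{Ad}(\lambda_G(g_i)),\qquad \Phi_{r,S}=\frac1n\sum_{i=1}^n\mathrm{Ad}(\rho_G(g_i)).$$ Entropy. The von Neumann entropy of a state $\xi$ with eigenvalues $\alpha_1\ge\alpha_2\ge\dots$ (with multiplicity) is $\mathbf H(\xi)=-\sum_i\alpha_i\log\alpha_i$. The minimum output entropy of a channel $\Phi$ is $\mathbf H_{\min}(\Phi)=\inf\{\mathbf H(\Phi(\xi)):\xi\in\mathcal T(\mathcal H)\text{ a state}\}$, and the regularized one is $\overline{\mathbf H}_{\min}(\Phi)=\lim_{k\to\infty}\frac1k\mathbf H_{\min}(\Phi^{\otimes k})$, where $\Phi^{\otimes k}$ acts on $\mathcal T(\mathcal H^{\otimes k})$.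
   Formalization: Each group G_i is assumed nontrivial: otherwise G_1 = Z with all other G_i trivial meets every hypothesis, but then |S| = 1, all three entropies are 0 and the strict inequality fails (and if all G_i are trivial, the channels are undefined). *)

(* Defs.v *)
From HB Require Import structures.
From mathcomp Require Import all_boot all_order all_algebra finmap complex.
From mathcomp Require Import all_classical all_reals all_analysis ring lra.
From mathcomp.analysis.showcase Require summability.
Set Implicit Arguments.
Unset Strict Implicit.
Unset Printing Implicit Defensive.
Import Order.TTheory GRing.Theory Num.Theory.
Import numFieldNormedType.Exports.
Local Open Scope classical_set_scope.
Local Open Scope ring_scope.

Section Groups.
Variable R : realType.

Definition generates (G : groupType) (S : {fset G}) : Prop :=
  (1%g \notin S) /\
  forall H : set G, H 1%g -> (forall x y, H x -> H y -> H (x * y^-1)%g) ->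
    [set` S] `<=` H -> H = setT.

(* In particular [G] is finitely generated. *)
Definition has_rank (G : groupType) (r : nat) : Prop :=
  (exists S : {fset G}, generates S /\ #|` S| = r) /\
  (forall S : {fset G}, generates S -> (r <= #|` S|)%N).

(* Only words in the letters of [S] itself (no inverses) are allowed; an
   element that is not such a word has infinite length. *)
Definition word_length (G : groupType) (S : {fset G}) (g : G) : \bar R :=
  if g == 1%g then 0%E
  else ereal_inf [set (size w)%:R%:E | w in
    [set w : seq G | [/\ (1 <= size w)%N, {subset w <= S} &
                         g = (\prod_(s <- w) s)%g]]].

Definition word_ball (G : groupType) (S : {fset G}) (m : nat) : set G :=
  [set g | (word_length S g <= m%:R%:E)%E].

Definition order_two (G : groupType) (g : G) : Prop :=
  g <> 1%g /\ (g * g)%g = 1%g.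

Definition cayley_graph (G : groupType) (S : {fset G}) : rel G :=
  fun g h => ((g^-1 * h)%g \in S) || ((h^-1 * g)%g \in S).

(* [+oo] for a forest, as the infimum of the empty set. *)
Definition graph_girth (V : eqType) (e : rel V) : \bar R :=
  ereal_inf [set (size c)%:R%:E | c in
    [set c : seq V | (3 <= size c)%N /\ ucycle e c]].

Definition girth (G : groupType) (S : {fset G}) : \bar R :=
  graph_girth (cayley_graph S).

(* The free product as the coproduct in the category of groups. *)
Definition is_free_product (I : Type) (G : I -> groupType) (P : groupType)
    (iota : forall i, {multiplicative G i -> P}) : Prop :=
  forall (H : groupType) (f : forall i, {multiplicative G i -> H}),
    exists h : {multiplicative P -> H},
      (forall i x, h (iota i x) = f i x) /\
      (forall h' : {multiplicative P -> H},
         (forall i x, h' (iota i x) = f i x) -> h' =1 h).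

End Groups.

Section Ell2.
Variables (R : realType) (X : choiceType).
Local Notation C := (R[i]).
Local Notation normc := Normc.normc.

Definition ell2_pred : {pred (X -> C^o)} :=
  fun f : X -> C^o =>
    `[< (\esum_(x in [set: X]) (normc (f x) ^+ 2)%:E < +oo)%E >].

Lemma ell2P (f : X -> C^o) :
  reflect (exists K : R, forall F : {fset X}, \sum_(x <- F) normc (f x) ^+ 2 <= K)
          (f \in ell2_pred).
Proof.
apply: (iffP (asboolP _)) => [h|[K hK]].
- exists (fine (\esum_(x in [set: X]) (normc (f x) ^+ 2)%:E)%E) => F.
  rewrite -lee_fin fineK; last first.
    by rewrite ge0_fin_numE// esum_ge0// => x _; rewrite lee_fin sqr_ge0.
  apply: ereal_sup_ubound; exists [set` F].
    by split; [exact: finite_fset | exact: subsetT].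
  by rewrite fsbig_finite ?finite_fset//= set_fsetK sumEFin.
- apply: (@le_lt_trans _ _ K%:E); last exact: ltry.
  apply: ge_ereal_sup => _ [A [Af _] <-].
  by rewrite fsbig_finite//= sumEFin lee_fin; exact: hK.
Qed.

Lemma ell2_submod_closed : submod_closed ell2_pred.
Proof.
split.
- apply/ell2P; exists 0 => F; rewrite big1// => x _.
  by rewrite Normc.normc0 expr0n.
- move=> a u v /ell2P[K hK] /ell2P[L hL]; apply/ell2P.
  exists (2 * normc a ^+ 2 * K + 2 * L) => F.
  apply: (@le_trans _ _ (2 * normc a ^+ 2 * (\sum_(x <- F) normc (u x) ^+ 2) +
                         2 * (\sum_(x <- F) normc (v x) ^+ 2))); last first.
    by apply: lerD; apply: ler_wpM2l; rewrite ?hK ?hL// mulr_ge0// sqr_ge0.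
  rewrite !mulr_sumr -big_split/=; apply: ler_sum => x _.
  rewrite -mulrA -exprMn -Normc.normcM.
  have n0 (z : C) : 0 <= normc z by case: z => p q; exact: sqrtr_ge0.
  have aux (p q s : R) : 0 <= p -> 0 <= q -> 0 <= s -> s <= p + q ->
      s ^+ 2 <= 2 * p ^+ 2 + 2 * q ^+ 2.
    move=> p0 q0 s0 h.
    have hs : 0 <= (p + q - s) * (p + q + s).
      by rewrite mulr_ge0 ?subr_ge0 ?addr_ge0.
    by have := sqr_ge0 (p - q); nra.
  exact: (aux _ _ _ (n0 _) (n0 _) (n0 _) (le_normcD (a * u x) (v x))).
Qed.

HB.instance Definition _ :=
  GRing.isSubmodClosed.Build C (X -> C^o) ell2_pred ell2_submod_closed.

Record ell2 := Ell2 { ell2_fun :> X -> C^o ; ell2_funP : ell2_fun \in ell2_pred }.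

HB.instance Definition _ := [isSub for ell2_fun].
HB.instance Definition _ := [Choice of ell2 by <:].
HB.instance Definition _ := [SubChoice_isSubLmodule of ell2 by <:].

Lemma ell2_comp_subproof (s : X -> X) (u : ell2) :
  injective s -> (fun x => u (s x)) \in ell2_pred.
Proof.
move=> sI; have /ell2P[K hK] := ell2_funP u; apply/ell2P; exists K => F.
have -> : \sum_(x <- F) normc (u (s x)) ^+ 2 =
          \sum_(y <- [fset s x | x in F]%fset) normc (u y) ^+ 2.
  by rewrite big_imfset//= => x y _ _; exact: sI.
exact: hK.
Qed.

Lemma ell2_delta_subproof (a : X) :
  (fun x => (x == a)%:R : C^o) \in ell2_pred.
Proof.
apply/ell2P; exists 1 => F.
have n0 x : x != a -> normc ((x == a)%:R : C) ^+ 2 = 0.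
  by move=> /negbTE ->; rewrite Normc.normc0 expr0n.
have [aF|aF] := boolP (a \in F).
- rewrite (big_fsetD1 a)//= eqxx Normc.normc1 expr1n big_seq big1 ?addr0// => x.
  by rewrite !inE => /andP[/n0].
- rewrite big_seq big1 ?ler01// => x xF; apply: n0.
  by apply: contra aF => /eqP <-.
Qed.

(* The canonical orthonormal basis. *)
Definition delta (a : X) : ell2 := Ell2 (ell2_delta_subproof a).

(* Linear in the second variable; the sum is over the finite subsets of [X]
   ordered by inclusion. *)
Definition inner (u v : ell2) : C :=
  summability.sum (fun x => ((u x)^* * v x : C^o)).

Definition ell2_norm (u : ell2) : R := Num.sqrt (complex.Re (inner u u)).

Definition orthonormal_sys (m : nat) (e : 'I_m -> ell2) : Prop :=
  forall i j, inner (e i) (e j) = (i == j)%:R.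

End Ell2.

(* l^2(X)^{(x) k} is identified with l^2(X^k). *)
Section TensorVector.
Variables (R : realType) (X : choiceType) (k : nat).
Local Notation C := (R[i]).
Local Notation normc := Normc.normc.

Lemma ell2_tensor_subproof (v : 'I_k -> ell2 R X) :
  (fun x : {ffun 'I_k -> X} => \prod_i v i (x i) : C^o) \in
    @ell2_pred R {ffun 'I_k -> X}.
Proof.
have /choice[K hK] : forall i, exists K : R, forall F : {fset X},
    \sum_(x <- F) normc (v i x) ^+ 2 <= K.
  by move=> i; apply/ell2P; exact: ell2_funP.
apply/ell2P; exists (\prod_i K i) => F.
have q0 i x : 0 <= normc (v i x) ^+ 2 by exact: sqr_ge0.
pose Y : {fset X} := [fset y in
  [seq (x : {ffun 'I_k -> X}) i | x <- F, i <- enum 'I_k]]%fset.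
have YP (x : {ffun 'I_k -> X}) i : x \in F -> x i \in Y.
  move=> xF; rewrite inE; apply/allpairsP; exists (x, i).
  by rewrite mem_enum.
pose h (g : {ffun 'I_k -> Y}) : {ffun 'I_k -> X} := [ffun i => val (g i)].
have hI : injective h.
  move=> g g' /ffunP gg'; apply/ffunP => i; apply: val_inj.
  by have := gg' i; rewrite !ffunE.
have e : perm_eq F (map h [seq g <- enum {ffun 'I_k -> Y} | h g \in F]).
  apply: uniq_perm; first exact: fset_uniq.
    by rewrite map_inj_uniq// filter_uniq// enum_uniq.
  move=> x; apply/idP/mapP => [xF|[g]]; last by rewrite mem_filter => /andP[? _] ->.
  exists [ffun i => [` YP x i xF]%fset]; last by apply/ffunP => i; rewrite !ffunE.
  rewrite mem_filter mem_enum andbT (_ : h _ = x)//.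
  by apply/ffunP => i; rewrite !ffunE.
have normc_prod (x : {ffun 'I_k -> X}) :
    normc (\prod_i v i (x i)) ^+ 2 = \prod_i normc (v i (x i)) ^+ 2.
  apply: (big_morph (fun z : C => normc z ^+ 2)) => [a b|].
    by rewrite Normc.normcM exprMn.
  by rewrite Normc.normc1 expr1n.
rewrite (perm_big _ e)/= big_map big_filter big_enum_cond/=.
apply: (@le_trans _ _ (\sum_(g : {ffun 'I_k -> Y})
    \prod_i normc (v i (val (g i))) ^+ 2)).
  rewrite big_mkcond/=; apply: ler_sum => g _; case: ifP => _.
    rewrite normc_prod; under eq_bigr do rewrite ffunE.
    exact: lexx.
  by apply: prodr_ge0 => i _.
rewrite -(bigA_distr_bigA (fun i (y : Y) => normc (v i (val y)) ^+ 2)).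
apply: ler_prod => i _; rewrite sumr_ge0//=.
by rewrite -(big_seq_fsetE _ _ predT (fun y => normc (v i y) ^+ 2))/=.
Qed.

Definition tensor_vec (v : 'I_k -> ell2 R X) : ell2 R {ffun 'I_k -> X} :=
  Ell2 (ell2_tensor_subproof v).

End TensorVector.

Section Operators.
Variables (R : realType) (X : choiceType).
Local Notation C := (R[i]).
Local Notation H := (ell2 R X).

Definition bounded_op (T : H -> H) : Prop :=
  linear T /\ exists K : R, forall v, ell2_norm (T v) <= K * ell2_norm v.

Definition is_adjoint (T T' : H -> H) : Prop :=
  forall u v, inner (T u) v = inner u (T' v).

(* Meaningful for bounded [T], which have exactly one adjoint. *)
Definition adjoint (T : H -> H) : H -> H := xget (fun=> 0) (is_adjoint T).

Definition Ad (T : H -> H) (xi : H -> H) : H -> H := T \o xi \o adjoint T.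

(* [sup sum_i |<f_i, T e_i>|] over pairs of finite orthonormal families. *)
Definition trace_norm (T : H -> H) : \bar R :=
  ereal_sup [set t | exists m (e f : 'I_m -> H),
    [/\ orthonormal_sys e, orthonormal_sys f &
        t = (\sum_(i < m) Normc.normc (inner (f i) (T (e i))))%:E]].

Definition trace_class (T : H -> H) : Prop :=
  bounded_op T /\ (trace_norm T < +oo)%E.

Definition trace (T : H -> H) : C :=
  summability.sum (fun x => (inner (delta R x) (T (delta R x)) : C^o)).

(* The order of [R[i]] makes [0 <= z] entail that [z] is real. *)
Definition positive_op (T : H -> H) : Prop := forall v, 0 <= inner v (T v).

Definition is_state (xi : H -> H) : Prop :=
  [/\ trace_class xi, positive_op xi & trace xi = 1].

(* Dimension of the eigenspace for [a]; it is [0] when [a] is not an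
   eigenvalue. *)
Definition eigen_mult (T : H -> H) (a : R) : \bar R :=
  ereal_sup [set m%:R%:E | m in
    [set m : nat | exists e : 'I_m -> H,
       orthonormal_sys e /\ forall i, T (e i) = (a%:C)%C *: e i]].

(* The eigenvalue [0] is left out, since [0 log 0 = 0]. *)
Definition entropy (xi : H -> H) : \bar R :=
  (\esum_(a in [set a : R | (0 < a)%R]) (eigen_mult xi a * (- (a * ln a))%:E))%E.

Definition Hmin (Phi : (H -> H) -> (H -> H)) : \bar R :=
  ereal_inf [set entropy (Phi xi) | xi in is_state].

End Operators.

Section TensorPower.
Variables (R : realType) (X : choiceType).
Local Notation C := (R[i]).
Local Notation H := (ell2 R X).
Local Notation Hk k := (ell2 R {ffun 'I_k -> X}).

(* [Xi] is the operator [xi_1 (x) ... (x) xi_k]. *)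
Definition is_tensor_op (k : nat) (xi : 'I_k -> (H -> H)) (Xi : Hk k -> Hk k) :
    Prop :=
  bounded_op Xi /\
  forall v : 'I_k -> H, Xi (tensor_vec v) = tensor_vec (fun i => xi i (v i)).

(* On the trace class operators, [Psi] is the trace-norm continuous linear map
   such that [Psi (xi_1 (x) ... (x) xi_k) = Phi xi_1 (x) ... (x) Phi xi_k]. *)
Definition is_tensor_power (k : nat) (Phi : (H -> H) -> (H -> H))
    (Psi : (Hk k -> Hk k) -> (Hk k -> Hk k)) : Prop :=
  [/\ forall xi, trace_class xi -> trace_class (Psi xi),
      forall (c : C) xi eta, trace_class xi -> trace_class eta ->
        Psi (c *: xi + eta) = c *: Psi xi + Psi eta,
      exists K : R, forall xi, trace_class xi ->
        (trace_norm (Psi xi) <= K%:E * trace_norm xi)%E &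
      forall (xi : 'I_k -> (H -> H)) Xi, (forall i, trace_class (xi i)) ->
        is_tensor_op xi Xi -> is_tensor_op (fun i => Phi (xi i)) (Psi Xi)].

(* Its values are determined on trace class operators only. *)
Definition tensor_power (k : nat) (Phi : (H -> H) -> (H -> H)) :
    (Hk k -> Hk k) -> (Hk k -> Hk k) :=
  xget (fun=> 0) (is_tensor_power Phi).

(* The value at [k = 0] is irrelevant to the limit. *)
Definition Hmin_reg (Phi : (H -> H) -> (H -> H)) : \bar R :=
  limn (fun k => ((k%:R^-1)%:E * Hmin (tensor_power (k := k) Phi))%E).

End TensorPower.

Section RegularChannels.
Variables (R : realType) (G : groupType).
Local Notation H := (ell2 R G).

Definition lambda (g : G) (u : H) : H :=
  Ell2 (ell2_comp_subproof u (mulgI g^-1%g)).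

Definition rho (g : G) (u : H) : H := Ell2 (ell2_comp_subproof u (mulIg g)).

Definition Phi_l (S : {fset G}) (xi : H -> H) : H -> H :=
  (#|` S|%:R : R[i])^-1 *: \sum_(g <- S) Ad (lambda g) xi.

Definition Phi_r (S : {fset G}) (xi : H -> H) : H -> H :=
  (#|` S|%:R : R[i])^-1 *: \sum_(g <- S) Ad (rho g) xi.

End RegularChannels.

(* Main.v *)
(** Left and right translations permute the basis of l^2(G), so Phi_l, Phi_r, their composition
    and all tensor powers of these are uniform mixtures of permutation unitaries u |-> u o s_i.
    By Fekete's lemma the regularized entropy is the infimum of H_min(Phi^(x)k) / k.

    Let n = |S|. On the input delta_e, the n pairs (g, g) of Phi_l o Phi_r all return delta_e, which
    leaves an output entropy of at most 2 ln n - (ln n) / n. For a single factor, the output on a unit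
    vector u has collision entropy 2 ln n - ln (sum_ij |<U_i u, U_j u>|^2), a lower bound for its
    entropy. In a free product, ping-pong on the first letter of reduced words gives
    sum_ij |<U_i u, U_j u>|^2 <= n + kappa^2 with kappa = 1 + 2 sqrt M + 2 M. This is proved for
    nonnegative functions, hence passes to the k-th power of both sides for tensor powers, and to
    Phi_r by the inversion of the group. Thus both factors have regularized entropy at least
    ln n - kappa^2 / n, and 2 kappa^2 < ln n by the hypothesis on N, since n >= N. *)

Require Import Defs.
From HB Require Import structures.
From mathcomp Require Import all_boot all_order all_algebra finmap complex.
From mathcomp Require Import all_classical all_reals all_analysis ring lra.
From mathcomp.analysis.showcase Require summability.
Set Implicit Arguments.
Unset Strict Implicit.
Unset Printing Implicit Defensive.
Import Order.TTheory GRing.Theory Num.Theory.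
Import numFieldNormedType.Exports.
Import complex.
Local Open Scope classical_set_scope.
Local Open Scope ring_scope.

(** The two sides of the inequality need bounds of different nature. An upper bound may be read off
    a single copy, because product inputs make the minimal entropies subadditive. A lower bound has
    to survive entangled inputs on every power, so it must come from an inequality that tensorizes;
    this is what dictates the shape of [form_bound]. Entropy is defined by eigenvalue multiplicities
    of operators on an infinite-dimensional space. States are therefore diagonalized first, by
    maximizing the quadratic form over the weakly compact unit ball and deflating. After that one
    Schur-type inequality, [entropy_schur], does most of the work: the diagonal of a state along an
    orthonormal system that carries its whole trace has at least the entropy of the state. It yields
    the reduction to pure inputs, the subadditivity and the explicit bound at a basis vector. Tensor
    powers are given only by a characterization; they are identified on states with explicit
    mixtures over [X^k], since finite combinations of matrix units approximate every state in trace
    norm. *)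

Local Notation Re := complex.Re.
Local Notation Im := complex.Im.

(** * Sums of families of reals over arbitrary index types *)

Section EsumUtils.
Variable R : realType.

Lemma esum_le_fset (T : choiceType) (f : T -> R) (K : \bar R) :
  (forall F : {fset T}, ((\sum_(x <- F) f x)%:E <= K)%E) ->
  (\esum_(x in [set: T]) (f x)%:E <= K)%E.
Proof.
move=> h; apply: ge_ereal_sup => _ [A [Af _] <-].
by rewrite fsbig_finite//= sumEFin; exact: h.
Qed.

Lemma sum_le_esum (T : choiceType) (f : T -> R) (r : seq T) : uniq r ->
  ((\sum_(x <- r) f x)%:E <= \esum_(x in [set: T]) (f x)%:E)%E.
Proof.
move=> ur; apply: ereal_sup_ubound; exists [set` [fset x in r]%fset].
  by split; [exact: finite_fset | exact: subsetT].
rewrite fsbig_finite ?finite_fset//= set_fsetK sumEFin; congr (_%:E).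
by apply: perm_big; apply: uniq_perm => // x; rewrite inE.
Qed.

Lemma term_le_esum (T : choiceType) (f : T -> R) (x : T) :
  ((f x)%:E <= \esum_(x in [set: T]) (f x)%:E)%E.
Proof. by have := sum_le_esum f (isT : uniq [:: x]); rewrite big_seq1. Qed.

Lemma sum_fset_le (X : choiceType) (f : X -> R) (F G : {fset X}) : (forall x, 0 <= f x) ->
  (F `<=` G)%fset -> \sum_(x <- F) f x <= \sum_(x <- G) f x.
Proof.
move=> f0 FG.
rewrite (eq_big_seq (fun x => if x \in F then f x else 0)); last by move=> x /= ->.
rewrite (big_fset_incl _ FG) => [|x _ /negbTE -> //].
by apply: ler_sum => x _; case: ifP.
Qed.

Lemma esum_nat_le (f : nat -> R) (K : R) : (forall i, 0 <= f i) ->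
  (forall k, \sum_(j < k) f j <= K) -> (\esum_(x in [set: nat]) (f x)%:E <= K%:E)%E.
Proof.
move=> f0 h; apply: esum_le_fset => F; rewrite lee_fin.
have [k hk] : exists k, forall i, i \in F -> (i < k)%N.
  exists (\max_(i <- F) i).+1 => i iF; rewrite ltnS.
  by rewrite (big_fsetD1 i)//= leq_maxl.
apply: le_trans (h k); rewrite -(big_mkord xpredT f) /index_iota subn0.
apply: (@le_trans _ _ (\sum_(i <- [fset i in iota 0 k]%fset) f i)).
  apply: sum_fset_le => //; apply/fsubsetP => i iF; rewrite inE mem_iota add0n.
  exact: hk.
rewrite le_eqVlt; apply/orP; left; apply/eqP.
by apply: perm_big; apply: uniq_perm => //= [|x]; [exact: iota_uniq|rewrite inE].
Qed.

Lemma esumZl (T : choiceType) (D : set T) (c : R) (f : T -> \bar R) : 0 <= c ->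
  (forall x, (0 <= f x)%E) ->
  (\esum_(x in D) (c%:E * f x) = c%:E * \esum_(x in D) f x)%E.
Proof.
move=> c0 f0; rewrite /esum -ereal_supZl//; last first.
  by apply/set0P; exists (\sum_(x \in set0) f x)%E, set0; first exact: fsets_set0.
congr ereal_sup; apply/seteqP; split => [_ [A [Af AD] <-]|_ [_ [A [Af AD] <-] <-]]/=.
  by exists (\sum_(x \in A) f x)%E; [exists A|rewrite ge0_mule_fsumr].
by exists A => //; rewrite ge0_mule_fsumr.
Qed.

Lemma esum_swap (T U : choiceType) (f : T -> U -> \bar R) : (forall x y, (0 <= f x y)%E) ->
  (\esum_(x in [set: T]) \esum_(y in [set: U]) f x y =
   \esum_(y in [set: U]) \esum_(x in [set: T]) f x y)%E.
Proof.
move=> f0; rewrite !esum_esum//.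
rewrite (@reindex_esum _ _ _ [set: U * T] _ (fun p => (p.2, p.1)) (fun p => f p.1 p.2)).
  by rewrite (_ : _ `*`` _ = setT)//; apply/seteqP; split.
split=> // [[a b] [c d] _ _ [-> ->]//|[a b] _].
by exists (b, a).
Qed.

End EsumUtils.

(** * Hilbert space geometry of [ell2] *)

Section ComplexModulus.
Variable R : realType.
Local Notation C := (R[i]).

Definition sqn (z : C) : R := Normc.normc z ^+ 2.

Lemma sqnE z : sqn z = Re z ^+ 2 + Im z ^+ 2.
Proof. by case: z => a b; rewrite /sqn/= sqr_sqrtr// addr_ge0// sqr_ge0. Qed.

Lemma sqn_ge0 z : 0 <= sqn z. Proof. exact: sqr_ge0. Qed.

Lemma sqnM a b : sqn (a * b) = sqn a * sqn b.
Proof. by rewrite /sqn Normc.normcM exprMn. Qed.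

Lemma sqn0 : sqn 0 = 0. Proof. by rewrite /sqn Normc.normc0 expr0n. Qed.

Lemma sqn1 : sqn 1 = 1. Proof. by rewrite /sqn Normc.normc1 expr1n. Qed.

Lemma sqnN z : sqn (- z) = sqn z. Proof. by rewrite /sqn normcN. Qed.

Lemma sqn_real (a : R) : sqn a%:C%C = a ^+ 2.
Proof. by rewrite sqnE/= expr0n addr0. Qed.

Lemma sqn_conj z : sqn (z^*) = sqn z.
Proof. by case: z => a b; rewrite !sqnE/= sqrrN. Qed.

Lemma conjM_sqn z : z^* * z = (sqn z)%:C%C.
Proof.
case: z => a b; rewrite sqnE; apply/eqP; rewrite eq_complex/=.
by apply/andP; split; apply/eqP; ring.
Qed.

Lemma sqn_eq0 z : (sqn z == 0) = (z == 0).
Proof.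
apply/eqP/eqP => [|->]; last exact: sqn0.
by rewrite /sqn => /eqP; rewrite sqrf_eq0 => /eqP/Normc.eq0_normc.
Qed.

Lemma normc_ge0 (z : C) : 0 <= Normc.normc z.
Proof. by case: z => a b; exact: sqrtr_ge0. Qed.

Lemma sqrt_sqn z : Num.sqrt (sqn z) = Normc.normc z.
Proof. by rewrite /sqn sqrtr_sqr ger0_norm// normc_ge0. Qed.

Lemma Re_le_normc (z : C) : Re z <= Normc.normc z.
Proof.
by case: z => a b /=; rewrite (le_trans (ler_norm a))// -sqrtr_sqr ler_wsqrtr// lerDl sqr_ge0.
Qed.

Lemma conjcE (z : C) : z^* = Complex (Re z) (- Im z).
Proof. by case: z. Qed.

Lemma conjc_realE (a : R) : (a%:C%C : C)^* = a%:C%C.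
Proof. by rewrite conjcE/= oppr0. Qed.

Lemma conjcM (a b : C) : (a * b)^* = a^* * b^*. Proof. exact: rmorphM. Qed.
Lemma conjcB (a b : C) : (a - b)^* = a^* - b^*. Proof. exact: rmorphB. Qed.

Lemma ReCJ (z : C) : Re z^* = Re z. Proof. by case: z. Qed.

Lemma ReD (a b : C) : Re (a + b) = Re a + Re b. Proof. by case: a b => ? ? []. Qed.
Lemma ImD (a b : C) : Im (a + b) = Im a + Im b. Proof. by case: a b => ? ? []. Qed.
Lemma ReN (a : C) : Re (- a) = - Re a. Proof. by case: a. Qed.
Lemma ReB (a b : C) : Re (a - b) = Re a - Re b. Proof. by rewrite ReD ReN. Qed.

Lemma ReMr (a : R) (b : C) : Re (a%:C%C * b) = a * Re b.
Proof. by case: b => p q /=; rewrite mul0r subr0. Qed.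

Lemma Re_sum I (r : seq I) (P : pred I) (F : I -> C) :
  Re (\sum_(i <- r | P i) F i) = \sum_(i <- r | P i) Re (F i).
Proof. by elim/big_rec2: _ => // i x y _ <-; rewrite ReD. Qed.

Lemma Im_sum I (r : seq I) (P : pred I) (F : I -> C) :
  Im (\sum_(i <- r | P i) F i) = \sum_(i <- r | P i) Im (F i).
Proof. by elim/big_rec2: _ => // i x y _ <-; rewrite ImD. Qed.

Lemma real_complex_sum I (r : seq I) (P : pred I) (F : I -> R) :
  (\sum_(i <- r | P i) F i)%:C%C = \sum_(i <- r | P i) ((F i)%:C%C : C).
Proof. exact: rmorph_sum. Qed.

Lemma ge0_Re (z : C) : 0 <= z -> z = (Re z)%:C%C.
Proof. by case: z => a b; rewrite lecE/= => /andP[/eqP -> _]. Qed.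

Lemma Re_ge0 (z : C) : 0 <= z -> 0 <= Re z.
Proof. by case: z => a b; rewrite lecE/= => /andP[_ ->]. Qed.

Lemma cvg_complex (T : Type) (F : set_system T) {FF : Filter F} (f : T -> C) (l : C) :
  ((fun t => Re (f t)) @ F --> Re l) -> ((fun t => Im (f t)) @ F --> Im l) -> (f : T -> C^o) @ F
    --> (l : C^o).
Proof.
move=> hr hi; apply/cvgrPdist_lt => /= e e0.
have [er er0 ee] : exists2 er : R, 0 < er & e = (er)%:C%C.
  exists (Re e); last by rewrite [LHS]ge0_Re// ltW.
  by move: e0; rewrite ltcE/= => /andP[].
move: hr hi => /cvgrPdist_lt/(_ (er / 2)) hr /cvgrPdist_lt/(_ (er / 2)) hi.
have key (z w : C) : `|Re z - Re w| < er / 2 -> `|Im z - Im w| < er / 2 ->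
    Normc.normc (z - w) < er.
  case: z w => a b [c d] /= h1 h2.
  rewrite -[ltRHS]ger0_norm ?(ltW er0)// -sqrtr_sqr ltr_sqrt ?exprn_gt0//.
  move: h1 h2; rewrite !ltr_norml => /andP[h1 h2] /andP[h3 h4]; nra.
near=> t; rewrite ee ltcR; apply: key; near: t.
- by apply: hr; rewrite divr_gt0.
- by apply: hi; rewrite divr_gt0.
Unshelve. all: by end_near.
Qed.

Lemma cvg_conj (T : Type) (F : set_system T) {FF : Filter F} (f : T -> C) (l : C) :
  (f : T -> C^o) @ F --> (l : C^o) ->
  ((fun t => (f t)^*) : T -> C^o) @ F --> (l^* : C^o).
Proof.
move=> /cvgrPdist_lt h; apply/cvgrPdist_lt => e e0; near=> t.
have : `|l - f t| < e by near: t; exact: h.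
suff -> : `|(l^* : C^o) - (f t)^*| = `|(l : C^o) - f t| by [].
by rewrite -rmorphB; congr (_%:C)%C; case: (l - f t) => a b; rewrite /= sqrrN.
Unshelve. all: by end_near.
Qed.

End ComplexModulus.

#[local] Existing Instance summability.totally_filter.

Section InnerProduct.
Variables (R : realType) (X : choiceType).
Local Notation C := (R[i]).
Local Notation H := (ell2 R X).
Local Notation tot := (@summability.totally X).

Lemma totallyP (P : {fset X} -> Prop) :
  (\forall F \near tot, P F) <-> exists F0 : {fset X}, forall F, (F0 `<=` F)%fset -> P F.
Proof.
split=> [[F0 _ h]|[F0 h]]; first by exists F0 => F hF; exact: h.
by exists F0 => // F hF; exact: h.
Qed.

Definition nrm2 (u : H) : R := fine (\esum_(x in [set: X]) (sqn (u x))%:E).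

Lemma nrm2E (u : H) : (nrm2 u)%:E = \esum_(x in [set: X]) (sqn (u x))%:E.
Proof.
rewrite /nrm2 fineK// ge0_fin_numE ?esum_ge0// => [|x _]; last by rewrite lee_fin sqn_ge0.
by have := ell2_funP u; move/asboolP.
Qed.

Lemma fset_le_nrm2 (u : H) (F : {fset X}) : \sum_(x <- F) sqn (u x) <= nrm2 u.
Proof.
rewrite -lee_fin nrm2E; apply: ereal_sup_ubound; exists [set` F].
  by split; [exact: finite_fset | exact: subsetT].
by rewrite fsbig_finite ?finite_fset//= set_fsetK sumEFin.
Qed.

Lemma nrm2_ge0 (u : H) : 0 <= nrm2 u.
Proof. by rewrite fine_ge0// esum_ge0// => x _; rewrite lee_fin sqn_ge0. Qed.

Lemma nrm2_approx (u : H) e : 0 < e ->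
  exists F : {fset X}, nrm2 u - e < \sum_(x <- F) sqn (u x).
Proof.
move=> e0.
have : ((nrm2 u - e)%:E < \esum_(x in [set: X]) (sqn (u x))%:E)%E.
  by rewrite -nrm2E lte_fin ltrBlDr ltrDl.
move=> /ereal_sup_gt[_ [A [fA _] <-]].
rewrite fsbig_finite//= sumEFin lte_fin => h.
by exists (fset_set A).
Qed.

Lemma nrm2_cvg (u : H) : (fun F : {fset X} => \sum_(x <- F) sqn (u x)) @ tot --> nrm2 u.
Proof.
apply/cvgrPdist_lt => e e0; apply/totallyP.
have [F0 hF0] := nrm2_approx u e0; exists F0 => F F0F.
rewrite ger0_norm ?subr_ge0 ?fset_le_nrm2// ltrBlDr -ltrBlDl (lt_le_trans hF0)//.
by apply: sum_fset_le => // x; exact: sqn_ge0.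
Qed.

Lemma ell2DE (u v : H) x : (u + v) x = u x + v x. Proof. by []. Qed.
Lemma ell2ZE (a : C) (u : H) x : (a *: u) x = a * u x. Proof. by []. Qed.
Lemma ell2NE (u : H) x : (- u) x = - u x. Proof. by []. Qed.
Lemma ell2_sumE I (r : seq I) (P : pred I) (F : I -> H) x :
  (\sum_(i <- r | P i) F i) x = \sum_(i <- r | P i) F i x.
Proof. by apply: (big_morph (fun u : H => u x)). Qed.

Lemma ell2_eq (u v : H) : (forall x, u x = v x) -> u = v.
Proof. by move=> h; apply/val_inj/funext. Qed.

(** A limit defined by choice is only usable once convergence is known. Polarization writes both
    parts of the partial sums as combinations of squared norms, whose partial sums increase to
    [nrm2]. *)
Lemma inner_cvg (u v : H) :
  ((fun F : {fset X} => \sum_(x <- F) (u x)^* * v x) : _ -> C^o) @ tot --> (inner u v : C^o).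
Proof.
have psE : summability.partial_sum (fun x => (u x)^* * v x : C^o) =
    (fun F : {fset X} => \sum_(x <- F) (u x)^* * v x).
  by apply/funext => F; rewrite /summability.partial_sum (big_seq_fsetE _ _ predT).
suff [l hl] : exists l : C,
   ((fun F : {fset X} => \sum_(x <- F) (u x)^* * v x) : _ -> C^o) @ tot --> (l : C^o).
  rewrite [inner u v](_ : _ = l)//.
  rewrite /inner /summability.sum psE.
  by apply: (@cvg_lim (C^o)) hl; exact: norm_hausdorff.
(* Multiplying [u] by [i] turns the imaginary part of [(u x)^* * v x] into a real part. *)
pose w : H := ('i%C : C) *: u.
exists (Complex ((nrm2 (u + v) - nrm2 u - nrm2 v) / 2) ((nrm2 (w + v) - nrm2 w - nrm2 v) / 2)).
have tofun (u' v' : H) (g : X -> R) :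
   (forall x, g x = (sqn (u' x + v' x) - sqn (u' x) - sqn (v' x)) / 2) ->
   (fun F : {fset X} => \sum_(x <- F) g x) @ tot --> (nrm2 (u' + v') - nrm2 u' - nrm2 v') / 2.
  move=> gE; under eq_fun => F do under eq_bigr => x _ do rewrite gE.
  under eq_fun => F do rewrite -mulr_suml !sumrB.
  apply: cvgMl; apply: cvgB; last exact: nrm2_cvg.
  apply: cvgB; last exact: nrm2_cvg.
  exact: (@nrm2_cvg (u' + v')).
apply: cvg_complex => /=.
- under eq_fun => F do rewrite /= Re_sum; apply: tofun => x.
  by rewrite !sqnE; case: (u x) (v x) => a b [c d] /=; field.
- under eq_fun => F do rewrite /= Im_sum; apply: tofun => x.
  by rewrite !sqnE ell2ZE; case: (u x) (v x) => a b [c d] /=; field.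
Qed.

Lemma inner_unique (u v : H) (l : C) :
  ((fun F : {fset X} => \sum_(x <- F) (u x)^* * v x) : _ -> C^o) @ tot --> (l : C^o) ->
  inner u v = l.
Proof.
move=> h.
by apply: (cvg_unique _ (@inner_cvg u v) h); exact: (@norm_hausdorff _ (C^o)).
Qed.

Lemma inner_linear u a (v w : H) : inner u (a *: v + w) = a * inner u v + inner u w.
Proof.
apply: inner_unique.
under eq_fun => F.
  under eq_bigr => x _ do rewrite ell2DE ell2ZE mulrDr mulrCA.
  rewrite big_split/= -mulr_sumr; over.
apply: (@cvgD _ (C^o)); last exact: inner_cvg.
by apply: (@cvgZr _ (C^o)); exact: inner_cvg.
Qed.

Lemma inner_conj (u v : H) : inner v u = (inner u v)^*.
Proof.
apply: inner_unique; have h := cvg_conj (@inner_cvg u v).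
have E : (fun F : {fset X} => (\sum_(x <- F) (u x)^* * v x)^*) =
  (fun F : {fset X} => \sum_(x <- F) (v x)^* * u x).
  apply: boolp.funext => F; rewrite rmorph_sum/=; apply: eq_bigr => x _.
  by rewrite rmorphM/= conjCK mulrC.
by rewrite E in h; apply: h.
Qed.

Lemma innerE_nrm2 (u : H) : inner u u = (nrm2 u)%:C%C.
Proof.
apply: inner_unique; under eq_fun => F do under eq_bigr => x _ do rewrite conjM_sqn.
apply: cvg_complex.
- under eq_fun => F do rewrite /= Re_sum; exact: nrm2_cvg.
- under eq_fun => F do rewrite /= Im_sum/= big1//; exact: cvg_cst.
Qed.

Lemma inner_ge0 (u : H) : 0 <= inner u u.
Proof. by rewrite innerE_nrm2 ler0c nrm2_ge0. Qed.

Lemma Re_inner (u : H) : Re (inner u u) = nrm2 u.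
Proof. by rewrite innerE_nrm2. Qed.

Lemma ell2_normE (u : H) : ell2_norm u = Num.sqrt (nrm2 u).
Proof. by rewrite /ell2_norm innerE_nrm2. Qed.

Lemma nrm2_eq0 (u : H) : nrm2 u = 0 -> u = 0.
Proof.
move=> h; apply: ell2_eq => x; apply/eqP; rewrite -sqn_eq0 eq_le sqn_ge0 andbT -h.
by have := fset_le_nrm2 u [fset x]%fset; rewrite big_seq_fset1.
Qed.

Lemma inner_finsupp (u v : H) (F : {fset X}) :
  (forall x, x \notin F -> (u x)^* * v x = 0) -> inner u v = \sum_(x <- F) (u x)^* * v x.
Proof.
move=> h; apply: inner_unique; apply: (@cvg_near_cst _ (C^o)); apply/totallyP; exists F => G FG.
by rewrite (big_fset_incl _ FG) => [//|x _ xF]; exact: h.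
Qed.

Lemma inner_delta x (u : H) : inner (delta R x) u = u x.
Proof.
rewrite (@inner_finsupp _ _ [fset x]%fset) => [|y]; last first.
  by rewrite !inE => /negbTE yx; rewrite /= yx conjC0 mul0r.
by rewrite big_seq_fset1/= eqxx conjC1 mul1r.
Qed.

End InnerProduct.

Section LinearFunctions.
Variables (K : pzRingType) (U V : lmodType K) (f : U -> V).
Hypothesis fl : linear f.

Lemma linear_fun0 : f 0 = 0.
Proof.
have := fl 1 0 0; rewrite !scale1r addr0 => /eqP.
by rewrite -subr_eq0 opprD addrA subrr sub0r oppr_eq0 => /eqP.
Qed.

Lemma linear_funZ a u : f (a *: u) = a *: f u.
Proof. by have := fl a u 0; rewrite addr0 linear_fun0 addr0. Qed.

Lemma linear_funD u v : f (u + v) = f u + f v.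
Proof. by have := fl 1 u v; rewrite !scale1r. Qed.

End LinearFunctions.

Section PsdForm.
Variables (R : realType) (V : lmodType R[i]) (s : V -> V -> R[i]).
Local Notation C := (R[i]).

(** Possibly degenerate forms, so that Cauchy-Schwarz and Minkowski serve at once for [inner], for
    the form of a positive operator and for the defect form [m <u,w> - <u,T w>] at a maximizer. *)
Record psd_form : Prop := PsdForm {
  psd_lin : forall u a v w, s u (a *: v + w) = a * s u v + s u w ;
  psd_herm : forall u v, s v u = (s u v)^* ;
  psd_ge0 : forall u, 0 <= s u u }.

Definition qf (u : V) : R := Re (s u u).

Hypothesis hs : psd_form.

Lemma psdDr u v w : s u (v + w) = s u v + s u w.
Proof. by have := psd_lin hs u 1 v w; rewrite scale1r mul1r. Qed.

Lemma psd0r u : s u 0 = 0.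
Proof. by apply: (addrI (s u 0)); rewrite -psdDr !addr0. Qed.

Lemma psdZr u a v : s u (a *: v) = a * s u v.
Proof. by have := psd_lin hs u a v 0; rewrite addr0 psd0r addr0. Qed.

Lemma psdNr u v : s u (- v) = - s u v.
Proof. by rewrite -scaleN1r psdZr mulN1r. Qed.

Lemma psdBr u v w : s u (v - w) = s u v - s u w.
Proof. by rewrite psdDr psdNr. Qed.

Lemma psd_sumr u I (r : seq I) (P : pred I) (F : I -> V) :
  s u (\sum_(i <- r | P i) F i) = \sum_(i <- r | P i) s u (F i).
Proof. exact: (big_morph (s u) (psdDr u) (psd0r u)). Qed.

Lemma psdDl u v w : s (v + w) u = s v u + s w u.
Proof. by rewrite (psd_herm hs) psdDr rmorphD/= -!(psd_herm hs). Qed.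

Lemma psd0l u : s 0 u = 0.
Proof. by rewrite (psd_herm hs) psd0r rmorph0. Qed.

Lemma psdZl u a v : s (a *: v) u = a^* * s v u.
Proof. by rewrite (psd_herm hs) psdZr rmorphM/= -(psd_herm hs). Qed.

Lemma psdNl u v : s (- v) u = - s v u.
Proof. by rewrite (psd_herm hs) psdNr rmorphN/= -(psd_herm hs). Qed.

Lemma psdBl u v w : s (v - w) u = s v u - s w u.
Proof. by rewrite psdDl psdNl. Qed.

Lemma qfE u : s u u = (qf u)%:C%C.
Proof. by rewrite /qf -ge0_Re// psd_ge0. Qed.

Lemma qf_ge0 u : 0 <= qf u.
Proof. by rewrite Re_ge0// psd_ge0. Qed.

Lemma qf0 : qf 0 = 0. Proof. by rewrite /qf psd0r. Qed.

Lemma qfD u v : qf (u + v) = qf u + qf v + 2 * Re (s u v).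
Proof.
rewrite /qf psdDr !psdDl !ReD (psd_herm hs u v) ReCJ.
by ring.
Qed.

Lemma qfZ a u : qf (a *: u) = sqn a * qf u.
Proof.
by rewrite /qf psdZr psdZl mulrA [a * _]mulrC conjM_sqn ReMr.
Qed.

Lemma qfN u : qf (- u) = qf u.
Proof. by rewrite -scaleN1r qfZ sqnN sqn1 mul1r. Qed.

Lemma qfB u v : qf (u - v) = qf u + qf v - 2 * Re (s u v).
Proof. by rewrite qfD qfN psdNr ReN mulrN. Qed.

Lemma psd_CS u v : sqn (s u v) <= qf u * qf v.
Proof.
pose z := s v u.
have zE : sqn (s u v) = sqn z by rewrite /z (psd_herm hs u v) sqn_conj.
(* Positivity at [t u - z v]. The value [t = qf v] gives the claim when [qf v] is nonzero; for a
   null vector [v], the values [1] and [sqn z / qf u] force [z = 0]. *)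
have key (t : R) : 0 <= t ^+ 2 * qf u + sqn z * qf v - 2 * t * sqn z.
  have := qf_ge0 (t%:C%C *: u - z *: v).
  rewrite qfB !qfZ sqn_real psdZl psdZr (psd_herm hs v u).
  rewrite (_ : _ * _ = (t * sqn z)%:C%C) /=; first by rewrite mulrA.
  rewrite -/z [z * _]mulrC conjM_sqn.
  by apply/eqP; rewrite eq_complex/=; apply/andP; split; apply/eqP; ring.
rewrite zE; have z0 := sqn_ge0 z; have qv := qf_ge0 v; have qu := qf_ge0 u.
have [v0|v0] := eqVneq (qf v) 0.
  rewrite v0 mulr0; apply/negP => /negP; rewrite -ltNge => zpos.
  have [u0|u0] := eqVneq (qf u) 0.
    by have := key 1; rewrite v0 u0; nra.
  have up : 0 < qf u by rewrite lt_def u0.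
  have := key (sqn z / qf u); rewrite v0 mulr0 addr0.
  have -> : (sqn z / qf u) ^+ 2 * qf u - 2 * (sqn z / qf u) * sqn z = - (sqn z ^+ 2 / qf u).
    by field.
  rewrite oppr_ge0 => h.
  have : 0 < sqn z ^+ 2 / qf u by rewrite divr_gt0// exprn_gt0.
  by rewrite ltNge h.
have vp : 0 < qf v by rewrite lt_def v0.
have := key (qf v).
have -> : qf v ^+ 2 * qf u + sqn z * qf v - 2 * qf v * sqn z = qf v * (qf u * qf v - sqn z) by ring.
by rewrite pmulr_rge0// subr_ge0.
Qed.

Lemma normc_psd_le u v : Normc.normc (s u v) <= Num.sqrt (qf u) * Num.sqrt (qf v).
Proof. by rewrite -sqrt_sqn -sqrtrM ?qf_ge0// ler_wsqrtr// psd_CS. Qed.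

Lemma psd_mink u v : Num.sqrt (qf (u + v)) <= Num.sqrt (qf u) + Num.sqrt (qf v).
Proof.
have a0 := sqrtr_ge0 (qf u); have b0 := sqrtr_ge0 (qf v).
rewrite -[leRHS]ger0_norm ?addr_ge0// -sqrtr_sqr ler_wsqrtr// qfD sqrrD !sqr_sqrtr ?qf_ge0//.
have := le_trans (Re_le_normc _) (normc_psd_le u v).
by move=> h; rewrite mulr2n; lra.
Qed.

(** Null vectors of a positive form lie in its kernel; this is what turns a maximizer of the form
    into an eigenvector. *)
Lemma psd_eq0 u v : qf u = 0 -> s u v = 0.
Proof.
move=> u0; apply/eqP; rewrite -sqn_eq0 eq_le sqn_ge0 andbT.
by have := psd_CS u v; rewrite u0 mul0r.
Qed.

End PsdForm.

Section Ell2Geometry.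
Variables (R : realType) (X : choiceType).
Local Notation C := (R[i]).
Local Notation H := (ell2 R X).

Lemma inner_psd : psd_form (@inner R X).
Proof. by split; [exact: inner_linear|exact: inner_conj|exact: inner_ge0]. Qed.

Lemma qf_inner (u : H) : qf (@inner R X) u = nrm2 u.
Proof. exact: Re_inner. Qed.

Lemma nrm2D (u v : H) : nrm2 (u + v) = nrm2 u + nrm2 v + 2 * Re (inner u v).
Proof. by rewrite -!qf_inner (qfD inner_psd). Qed.

Lemma nrm2B (u v : H) : nrm2 (u - v) = nrm2 u + nrm2 v - 2 * Re (inner u v).
Proof. by rewrite -!qf_inner (qfB inner_psd). Qed.

Lemma nrm2Z a (u : H) : nrm2 (a *: u) = sqn a * nrm2 u.
Proof. by rewrite -!qf_inner (qfZ inner_psd). Qed.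

Lemma nrm20 : nrm2 (0 : H) = 0.
Proof. by rewrite -!qf_inner (qf0 inner_psd). Qed.

Lemma inner_CS (u v : H) : sqn (inner u v) <= nrm2 u * nrm2 v.
Proof. by rewrite -!qf_inner (psd_CS inner_psd). Qed.

Lemma inner_deltar x (u : H) : inner u (delta R x) = (u x)^*.
Proof. by rewrite inner_conj inner_delta. Qed.

Lemma nrm2_delta x : nrm2 (delta R x : H) = 1.
Proof. by rewrite -Re_inner inner_delta /= eqxx. Qed.

Lemma inner_nondeg (u v : H) : (forall w, inner w u = inner w v) -> u = v.
Proof. by move=> h; apply: ell2_eq => x; rewrite -!inner_delta. Qed.

Definition trunc (F : {fset X}) (u : H) : H := \sum_(x <- F) u x *: delta R x.

Lemma truncE F (u : H) x : trunc F u x = if x \in F then u x else 0.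
Proof.
rewrite /trunc ell2_sumE (eq_bigr (fun y => u y * (x == y)%:R)) => [|y _]; last by rewrite ell2ZE.
case: ifPn => xF.
  rewrite (big_fsetD1 x)//= eqxx mulr1 big_seq big1 ?addr0// => y.
  by rewrite !inE => /andP[/negbTE yx _]; rewrite eq_sym yx mulr0.
rewrite big_seq big1// => y yF; rewrite (_ : x == y = false) ?mulr0//.
by apply/negbTE; apply: contraNneq xF => ->.
Qed.

Lemma inner_trunc F (u v : H) : inner (trunc F u) v = \sum_(x <- F) (u x)^* * v x.
Proof.
rewrite (@inner_finsupp _ _ _ _ F) => [|x xF]; last by rewrite truncE (negbTE xF) conjC0 mul0r.
by apply: eq_big_seq => x xF; rewrite truncE xF.
Qed.

Lemma nrm2_trunc F (u : H) : nrm2 (trunc F u) = \sum_(x <- F) sqn (u x).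
Proof.
rewrite -Re_inner inner_trunc Re_sum; apply: eq_big_seq => x xF.
by rewrite truncE xF conjM_sqn.
Qed.

Lemma nrm2_trunc_le F (u : H) : nrm2 (trunc F u) <= nrm2 u.
Proof. by rewrite nrm2_trunc fset_le_nrm2. Qed.

Lemma nrm2_cotrunc F (u : H) : nrm2 (u - trunc F u) = nrm2 u - \sum_(x <- F) sqn (u x).
Proof.
rewrite nrm2B nrm2_trunc inner_conj ReCJ inner_trunc Re_sum.
under [in X in _ - 2 * X]eq_bigr => x _ do rewrite conjM_sqn.
by rewrite /=; ring.
Qed.

Lemma trunc_approx (u : H) e : 0 < e ->
  exists F : {fset X}, forall G, (F `<=` G)%fset -> nrm2 (u - trunc G u) < e.
Proof.
move=> e0; have [F hF] := nrm2_approx u e0; exists F => G FG.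
rewrite nrm2_cotrunc ltrBlDr -ltrBlDl (lt_le_trans hF)//.
by apply: sum_fset_le => // x; exact: sqn_ge0.
Qed.

Lemma trunc_is_linear F : linear (trunc F).
Proof.
move=> a u v; apply: ell2_eq => x; rewrite ell2DE ell2ZE !truncE ell2DE ell2ZE.
by case: ifP => //; rewrite mulr0 addr0.
Qed.

Definition porth (J : eqType) (e : J -> H) : Prop :=
  (forall i j, i != j -> inner (e i) (e j) = 0) /\ forall i, nrm2 (e i) = 1 \/ e i = 0.

Lemma orthonormal_porth m (e : 'I_m -> H) : orthonormal_sys e -> porth e.
Proof.
move=> h; split=> [i j /negbTE ij|i]; first by rewrite h ij.
by left; rewrite -Re_inner h eqxx.
Qed.

Lemma delta_porth : porth (@delta R X).
Proof.
split=> [i j /negbTE ij|i]; last by left; exact: nrm2_delta.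
by rewrite inner_delta/= ij.
Qed.

Lemma bessel_seq (J : eqType) (e : J -> H) (r : seq J) v : porth e -> uniq r ->
  \sum_(i <- r) sqn (inner (e i) v) <= nrm2 v.
Proof.
case=> eo en; elim: r v => [|i r IH] v; first by rewrite big_nil nrm2_ge0.
rewrite /= big_cons => /andP[ir ur].
have [n1|e0] := en i; last first.
  by rewrite e0 (psd0l inner_psd) sqn0 add0r IH.
pose v' := v - inner (e i) v *: e i.
have -> : \sum_(j <- r) sqn (inner (e j) v) = \sum_(j <- r) sqn (inner (e j) v').
  apply: eq_big_seq => j jr; rewrite /v' (psdBr inner_psd) (psdZr inner_psd) eo ?mulr0 ?subr0//.
  by apply: contraNneq ir => <-.
rewrite -lerBrDl (le_trans (IH v' ur))// /v' nrm2B nrm2Z n1 (psdZr inner_psd).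
by rewrite [inner v _]inner_conj [_ * _^*]mulrC conjM_sqn/= mulr1; lra.
Qed.

Lemma bessel (J : choiceType) (e : J -> H) v : porth e ->
  (\esum_(i in [set: J]) (sqn (inner (e i) v))%:E <= (nrm2 v)%:E)%E.
Proof.
move=> eo; apply: ge_ereal_sup => _ [A [Af _] <-].
by rewrite fsbig_finite//= sumEFin lee_fin; exact: bessel_seq.
Qed.

End Ell2Geometry.

(** * Spectral theorem for density operators *)

Lemma sum_CS (R : realType) (I : Type) (r : seq I) (P : pred I) (a b : I -> R) :
  (\sum_(i <- r | P i) a i * b i) ^+ 2 <=
  (\sum_(i <- r | P i) a i ^+ 2) * (\sum_(i <- r | P i) b i ^+ 2).
Proof.
elim: r => [|i r IH]; first by rewrite !big_nil expr0n mul0r.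
rewrite !big_cons; case: ifP => // _.
have A0 : 0 <= \sum_(j <- r | P j) a j ^+ 2 by apply: sumr_ge0 => j _; exact: sqr_ge0.
have B0 : 0 <= \sum_(j <- r | P j) b j ^+ 2 by apply: sumr_ge0 => j _; exact: sqr_ge0.
move: IH A0 B0; move: (\sum_(j <- r | P j) a j * b j) => S.
move: (\sum_(j <- r | P j) a j ^+ 2) (\sum_(j <- r | P j) b j ^+ 2) => A B IH A0 B0.
move: (a i) (b i) => x y.
suff : 2 * (x * y * S) <= A * y ^+ 2 + x ^+ 2 * B by nra.
have N0 : 0 <= A * y ^+ 2 + x ^+ 2 * B by rewrite addr_ge0// mulr_ge0// sqr_ge0.
apply: (le_trans (ler_norm _)).
rewrite -[leRHS]ger0_norm// -ler_sqr ?nnegrE// -!normrX !ger0_norm ?sqr_ge0//.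
have h1 := sqr_ge0 (A * y ^+ 2 - x ^+ 2 * B).
have h2 : (x * y) ^+ 2 * S ^+ 2 <= (x * y) ^+ 2 * (A * B) by rewrite ler_wpM2l// sqr_ge0.
nra.
Qed.

Section PosOp.
Variables (R : realType) (X : choiceType).
Local Notation C := (R[i]).
Local Notation H := (ell2 R X).

(** Positive trace class operators, with the trace norm replaced by bounded diagonal sums: this form
    is checked directly for deflations, compressions and channel outputs. *)
Record pos_op (T : H -> H) : Prop := PosOp {
  pos_op_lin : linear T ;
  pos_op_bnd : exists K : R, forall v, nrm2 (T v) <= K * nrm2 v ;
  pos_op_ge0 : positive_op T ;
  pos_op_tr : exists K : R, forall F : {fset X}, 
     \sum_(x <- F) Re (inner (delta R x) (T (delta R x))) <= K }.

Definition opform (T : H -> H) (u v : H) : C := inner u (T v).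

(** Hermitian symmetry comes from the diagonal being real, tested at [u + v] and at [u + i v]. *)
Lemma opform_psd T : linear T -> positive_op T -> psd_form (opform T).
Proof.
move=> Tl Tp; have lin u a v w : opform T u (a *: v + w) = a * opform T u v + opform T u w.
  by rewrite /opform Tl inner_linear.
have ZT a v : T (a *: v) = a *: T v by exact: linear_funZ.
have DT v w : T (v + w) = T v + T w by exact: linear_funD.
split => // u v.
have e1 w : Im (opform T w w) = 0 by rewrite ger0_Im// Tp.
have := e1 (u + v); rewrite {1}/opform DT (psdDr (inner_psd _ _)) !(psdDl (inner_psd _ _)) !ImD.
rewrite -/(opform T u u) -/(opform T v v) -/(opform T u v) -/(opform T v u) !e1 add0r addr0 => h1.
have := e1 (u + 'i%C *: v); rewrite {1}/opform DT ZT (psdDr (inner_psd _ _)) !(psdDl (inner_psd _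
  _)) !ImD.
rewrite !(psdZr (inner_psd _ _)) !(psdZl (inner_psd _ _)).
rewrite -/(opform T u u) -/(opform T v v) -/(opform T u v) -/(opform T v u) !e1.
move: h1 (e1 v); case: (opform T u v) (opform T v u) (opform T v v) => a b [c d] [p q] /= h1 h2 h3.
apply/eqP; rewrite eq_complex/=; apply/andP; split; apply/eqP; lra.
Qed.

Variable T : H -> H.
Hypothesis hT : pos_op T.
Local Notation s := (opform T).
Local Notation q := (qf (opform T)).
Local Notation t := (fun x => q (delta R x)).

Lemma pos_op_psd : psd_form s.
Proof. by apply: opform_psd; [exact: pos_op_lin|exact: pos_op_ge0]. Qed.
Let hs := pos_op_psd.

Lemma pos_op_qf_bnd : exists2 K : R, 0 <= K & forall v, q v <= K * nrm2 v.
Proof.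
have [K hK] := pos_op_bnd hT; exists (Num.sqrt `|K|); first exact: sqrtr_ge0.
move=> v; apply: (le_trans (Re_le_normc _)); apply: (le_trans (normc_psd_le (inner_psd _ _) _ _)).
rewrite !qf_inner -[X in _ <= _ * X]sqr_sqrtr ?nrm2_ge0// expr2 mulrCA ler_wpM2l ?sqrtr_ge0//.
rewrite -sqrtrM// ler_wsqrtr// (le_trans (hK v))// ler_wpM2r ?nrm2_ge0// ler_norm//.
Qed.

Lemma sqrt_qf_sum (F : {fset X}) (c : X -> C) :
  Num.sqrt (q (\sum_(x <- F) c x *: delta R x)) <=
  \sum_(x <- F) Normc.normc (c x) * Num.sqrt (t x).
Proof.
elim/big_rec2: _ => [|x y v _ h]; first by rewrite (qf0 hs) sqrtr0.
apply: (le_trans (psd_mink hs _ _)); apply: lerD => //.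
by rewrite (qfZ hs) sqrtrM ?sqn_ge0// sqrt_sqn.
Qed.

(** Minkowski along the basis followed by Cauchy-Schwarz: the form is dominated by the trace over
    [F]. *)
Lemma qf_trunc_le (F : {fset X}) (v : H) :
  q (trunc F v) <= (\sum_(x <- F) t x) * nrm2 v.
Proof.
have t0 x : 0 <= t x by exact: qf_ge0.
have := sqrt_qf_sum F v; rewrite -/(trunc F v) => h.
rewrite -[leLHS]sqr_sqrtr ?(qf_ge0 hs)//.
apply: (@le_trans _ _ ((\sum_(x <- F) Normc.normc (v x) * Num.sqrt (t x)) ^+ 2)).
  rewrite ler_sqr ?nnegrE ?sqrtr_ge0//.
  by apply: sumr_ge0 => x _; rewrite mulr_ge0 ?normc_ge0 ?sqrtr_ge0.
apply: (le_trans (sum_CS _ _ _ _)).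
rewrite mulrC; apply: ler_pM.
- by apply: sumr_ge0 => x _; exact: sqr_ge0.
- by apply: sumr_ge0 => x _; exact: sqr_ge0.
- by apply: ler_sum => x _; rewrite sqr_sqrtr.
- exact: fset_le_nrm2.
Qed.

Lemma ler_sqrt_addgt0 (a b : R) : 0 <= a -> (forall e, 0 < e -> Num.sqrt a <= b + e) -> a <= b ^+ 2.
Proof.
move=> a0 h; have hb : Num.sqrt a <= b by apply/ler_addgt0Pr.
rewrite -[leLHS]sqr_sqrtr// ler_sqr ?nnegrE ?sqrtr_ge0//.
by rewrite (le_trans _ hb) ?sqrtr_ge0.
Qed.

(** Replaces compactness of the operator: a small trace outside [F] makes the form uniformly small
    on vectors supported there. Finitely supported [v] are handled by [qf_trunc_le], and boundedness
    absorbs the remainder of a truncation. *)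
Lemma qf_tail_le (F : {fset X}) (tau : R) (v : H) : 0 <= tau ->
  (forall G : {fset X}, [disjoint F & G]%fset -> \sum_(x <- G) t x <= tau) ->
  (forall x, x \in F -> v x = 0) -> q v <= tau * nrm2 v.
Proof.
move=> tau0 htau vF.
have n0 := nrm2_ge0 v.
rewrite -[leRHS]sqr_sqrtr ?mulr_ge0//; apply: ler_sqrt_addgt0; first exact: qf_ge0.
move=> e e0; have [K K0 hK] := pos_op_qf_bnd.
have d0 : 0 < e ^+ 2 / (K + 1) by rewrite divr_gt0 ?exprn_gt0//; lra.
have [G hG] := trunc_approx v d0; have {hG} := hG _ (fsubset_refl G).
move=> hG.
have vE : v = trunc G v + (v - trunc G v) by rewrite addrC subrK.
rewrite [in leLHS]vE.
apply: (le_trans (psd_mink hs _ _)); apply: lerD.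
  rewrite ler_wsqrtr//.
  have -> : trunc G v = trunc (G `\` F)%fset v.
    apply: ell2_eq => x; rewrite !truncE inE.
    by case: (boolP (x \in F)) => //= xF; rewrite vF//; case: ifP.
  apply: (le_trans (qf_trunc_le _ _)); rewrite ler_wpM2r//; apply: htau.
  by apply/fdisjointP => x xF; rewrite inE xF.
rewrite -[leRHS]ger0_norm ?(ltW e0)// -sqrtr_sqr ler_wsqrtr//.
apply: (le_trans (hK _)); move: hG.
rewrite ltr_pdivlMr; last lra.
by have := nrm2_ge0 (v - trunc G v); nra.
Qed.

Lemma diag_tail e : 0 < e -> exists F : {fset X}, forall G : {fset X},
  [disjoint F & G]%fset -> \sum_(x <- G) t x <= e.
Proof.
move=> e0; have [K hK] := pos_op_tr hT.
pose S := [set \sum_(x <- F) t x | F in [set: {fset X}]].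
have hS : has_sup S by split; [by exists (\sum_(x <- fset0) t x), fset0|exists K => _ [F _ <-];
  exact: hK].
have [_ [F _ <-] hF] := sup_adherent e0 hS.
exists F => G FG.
have h : \sum_(x <- (F `|` G)%fset) t x <= sup S.
  by apply: sup_upper_bound => //; exists (F `|` G)%fset.
have hU : \sum_(x <- (F `|` G)%fset) t x = \sum_(x <- F) t x + \sum_(x <- G) t x.
  rewrite -big_cat; apply: perm_big; apply: uniq_perm => [||x]; first exact: fset_uniq.
    rewrite cat_uniq !fset_uniq andbT /=; apply/hasPn => x xG.
    by apply: contraTN xG; move: FG => /fdisjointP/(_ x).
  by rewrite mem_cat in_fsetU.
by move: h hF; rewrite hU; lra.
Qed.

End PosOp.

Lemma psd_mink_dist (R : realType) (V : lmodType R[i]) (s : V -> V -> R[i]) (u v : V) :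
  psd_form s -> `|Num.sqrt (qf s u) - Num.sqrt (qf s v)| <= Num.sqrt (qf s (u - v)).
Proof.
move=> hs; rewrite ler_norml lerBrDr lerBlDr addrC lerBlDr; apply/andP; split.
  have := psd_mink hs u (v - u).
  by rewrite addrC subrK -(qfN hs (v - u)) opprB.
by have := psd_mink hs (u - v) v; rewrite subrK.
Qed.

Lemma cvg_sum_seq (R : realType) (T I : Type) (F : set_system T) (FF : Filter F) (r : seq I)
  (f : I -> T -> R) (l : I -> R) : (forall i, f i @ F --> l i) ->
  (fun t => \sum_(i <- r) f i t) @ F --> \sum_(i <- r) l i.
Proof.
move=> h; elim: r => [|i r IH].
  rewrite big_nil (_ : (fun t => _) = (fun=> 0 : R)); first exact: cvg_cst.
  by apply: boolp.funext => t; rewrite big_nil.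
rewrite big_cons (_ : (fun t => _) = (fun t => f i t + \sum_(j <- r) f j t)); first exact: cvgD.
by apply: boolp.funext => t; rewrite big_cons.
Qed.

Section MaxEigen.
Variables (R : realType) (X : choiceType).
Local Notation C := (R[i]).
Local Notation H := (ell2 R X).
(* The weakly compact unit ball of [ell2], as a compact set in a product of copies of the
   real line (real and imaginary part of each coordinate). *)
Let PT := prod_topology (fun _ : X * bool => R : topologicalType).

Let crd (f : PT) : X -> C^o := fun x => Complex (f (x, true)) (f (x, false)).

Let ball : set PT := [set f | (forall i, `[(-1), 1]%classic (f i)) /\
   forall F : {fset X}, \sum_(x <- F) sqn (crd f x) <= 1].

Let vec (f : PT) : H := insubd (0 : H) (crd f).

Let vecE f : ball f -> forall x, vec f x = crd f x.
Proof.
move=> [_ h] x.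
have hmem : crd f \in @ell2_pred R X by apply/ell2P; exists 1.
by have /(congr1 (fun g : X -> C^o => g x)) := insubdK (0 : H) hmem.
Qed.

Let vec_le1 f : ball f -> nrm2 (vec f) <= 1.
Proof.
move=> bf; rewrite -lee_fin nrm2E; apply: ge_ereal_sup => _ [A [Af _] <-].
rewrite fsbig_finite//= sumEFin lee_fin; under eq_bigr => x _ do rewrite vecE//.
exact: bf.2.
Qed.

Let pc (i : X * bool) : continuous (fun f : PT => f i).
Proof. exact: (@proj_continuous _ (fun _ : X * bool => R : topologicalType) i). Qed.

Let sqn_continuous (F : {fset X}) :
  continuous (fun f : PT => \sum_(x <- F) sqn (crd f x)).
Proof.
move=> f; apply: (@cvg_sum_seq R PT X (nbhs f) _ (enum_fset F)
  (fun x g => sqn (crd g x)) (fun x => sqn (crd f x))) => x.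
have E (g : PT) : g (x, true) * g (x, true) + g (x, false) * g (x, false) = sqn (crd g x).
  by rewrite sqnE !expr2.
have -> : (fun g : PT => sqn (crd g x)) =
    (fun g : PT => g (x, true) * g (x, true)) \+ (fun g : PT => g (x, false) * g (x, false)).
  by apply: boolp.funext => g; rewrite /= E.
rewrite -E; apply: (@cvgD _ _ _ (nbhs f) _ (fun g : PT => g (x, true) * g (x, true))
  (fun g : PT => g (x, false) * g (x, false))).
- exact: (@cvgM _ _ (nbhs f) _ _ _ _ _ (@pc (x, true) f) (@pc (x, true) f)).
- exact: (@cvgM _ _ (nbhs f) _ _ _ _ _ (@pc (x, false) f) (@pc (x, false) f)).
Qed.

(** Tychonoff on the cube of coordinates in [[-1,1]]; each condition on a finite partial sum is
    closed. *)
Let ball_compact : compact ball.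
Proof.
apply: (@subclosed_compact _ _ [set f : PT | forall i, `[(-1), 1]%classic (f i)]).
- rewrite (_ : ball = [set f : PT | forall i, `[(-1), 1]%classic (f i)] `&`
    \bigcap_(F in [set: {fset X}]) [set f : PT | \sum_(x <- F) sqn (crd f x) <= 1]); last first.
    by apply/seteqP; split=> f /= [h1 h2]; split => // F; [move=> _; exact: h2|exact: h2].
  apply: closedI.
    rewrite (_ : [set f | _] = \bigcap_(i in setT) [set f : PT | `[(-1), 1]%classic (f i)]); last
      first.
      by apply/seteqP; split=> f /= h i; [move=> _|]; exact: h.
    apply: closed_bigI => i _.
    apply: (@preimage_closed _ _ (fun f : PT => f i)); last exact: itv_closed.
    by move=> f _; exact: pc.
  apply: closed_bigI => F _.
  apply: (@preimage_closed _ _ (fun f : PT => \sum_(x <- F) sqn (crd f x)) [set r | r <= 1]);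
    last exact: closed_le.
  by move=> f _; exact: sqn_continuous.
- exact: (@tychonoff _ (fun _ : X * bool => R : topologicalType) (fun=> `[(-1), 1]%classic))
  (fun=> @segment_compact R (-1) 1).
- by move=> f [].
Qed.

Variable T : H -> H.
Hypothesis hT : pos_op T.
Local Notation s := (opform T).
Local Notation q := (qf (opform T)).
Local Notation t := (fun x => q (delta R x)).
Let hs := pos_op_psd hT.

(** Weak continuity holds because, up to [e / 4] uniformly on the ball, the value depends on the
    finitely many coordinates in [F] only. *)
Let cont : {within ball, continuous (fun f => Num.sqrt (q (vec f)))}.
Proof.
apply/subspace_continuousP => f bf; apply/cvgrPdist_lt => e e0.
have tau0 : 0 < (e / 4) ^+ 2 by rewrite exprn_gt0// divr_gt0.
have [F hF] := diag_tail hT tau0.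
pose S := \sum_(x <- F) Num.sqrt (t x).
have S0 : 0 <= S by apply: sumr_ge0 => x _; exact: sqrtr_ge0.
(* Real and imaginary parts within [d] move a coordinate by at most [2 d], hence the truncated value
   by at most [2 d S <= e / 4]. *)
pose d := e / 4 / (2 * (S + 1)).
have d0 : 0 < d by rewrite divr_gt0// ?divr_gt0//; lra.
have hn : \forall g \near f, forall x b, x \in F -> `|g (x, b) - f (x, b)| < d.
  have : forall i : X * bool, \forall g \near f, `|(g : PT) i - f i| < d.
    by move=> i; have /cvgr_distC_lt/(_ _ d0) := @pc i f.
  move=> h.
  have hb b (r : seq X) : \forall g \near f, forall x, x \in r -> `|(g : PT) (x, b) - f (x, b)| < d.
    elim: r => [|y r IH]; first exact: (@filterE _ (nbhs f)).
    apply: (@filterS2 _ (nbhs f) _ _ _ _ _ (h (y, b)) IH) => g h1 h2 x.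
    by rewrite inE => /orP[/eqP ->|]; [exact: h1|exact: h2].
  apply: (@filterS2 _ (nbhs f) _ _ _ _ _ (hb true (enum_fset F)) (hb false (enum_fset F))).
  by move=> g h1 h2 x [] xF; [exact: h1|exact: h2].
have tl g : ball g -> `|Num.sqrt (q (vec g)) - Num.sqrt (q (trunc F (vec g)))| <= e / 4.
  move=> bg; apply: (le_trans (psd_mink_dist _ _ hs)).
  rewrite -[leRHS]ger0_norm ?divr_ge0 ?(ltW e0)// -sqrtr_sqr ler_wsqrtr//.
  apply: (@le_trans _ _ ((e / 4) ^+ 2 * nrm2 (vec g - trunc F (vec g)))).
    apply: (qf_tail_le hT (F := F)) => //; first exact: ltW.
    by move=> x xF; rewrite ell2DE ell2NE truncE xF subrr.
  rewrite ler_piMr ?(ltW tau0)// nrm2_cotrunc lerBlDr (le_trans (vec_le1 bg))// lerDl.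
  by apply: sumr_ge0 => x _; exact: sqn_ge0.
apply: (@filterS _ (nbhs f) _ _ _ _ hn) => g hg bg.
have mid : `|Num.sqrt (q (trunc F (vec f))) - Num.sqrt (q (trunc F (vec g)))| <= e / 4.
  apply: (le_trans (psd_mink_dist _ _ hs)).
  have -> : trunc F (vec f) - trunc F (vec g) = \sum_(x <- F) (crd f x - crd g x) *: delta R x.
    rewrite /trunc -sumrB; apply: eq_bigr => x _.
    by rewrite !vecE// scalerBl.
  apply: (le_trans (sqrt_qf_sum hT _ _)).
  apply: (@le_trans _ _ (\sum_(x <- F) (2 * d) * Num.sqrt (t x))).
    rewrite big_seq [leRHS]big_seq; apply: ler_sum => x xF; rewrite ler_wpM2r ?sqrtr_ge0//.
    have := hg x true xF; have := hg x false xF.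
    rewrite /crd /= !ltr_norml => /andP[h1 h2] /andP[h3 h4].
    rewrite -[leRHS]ger0_norm; last by rewrite mulr_ge0// ltW.
    by rewrite -sqrtr_sqr ler_wsqrtr//; nra.
  rewrite -mulr_sumr -/S.
  have -> : 2 * d * S = e / 4 * (S / (S + 1)) by rewrite /d; field; lra.
  rewrite ler_piMr//; first by rewrite divr_ge0 ?(ltW e0).
  by rewrite ler_pdivrMr; lra.
have tri (x y z w : R) : `|x - y| <= e / 4 -> `|z - w| <= e / 4 -> `|y - w| <= e / 4 ->
    `|x - z| < e.
  rewrite !ler_norml ltr_norml => /andP[? ?] /andP[? ?] /andP[? ?].
  by apply/andP; split; lra.
exact: (tri _ _ _ _ (tl f bf) (tl g bg) mid).
Qed.

Lemma pos_op_max : exists2 v : H, nrm2 v <= 1 & forall w, nrm2 w <= 1 -> q w <= q v.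
Proof.
have ball0 : ball (fun=> 0).
  split=> [i|F]; first by rewrite /= in_itv/=; lra.
  by rewrite big1// => x _; rewrite /crd sqnE/= expr0n addr0.
have ballN0 : ball !=set0 by exists (fun=> 0).
have [f fb hf] := compact_EVT_max ballN0 ball_compact cont.
exists (vec f); first by apply: vec_le1; move: fb; rewrite inE.
move=> w w1.
pose g : PT := fun i => if i.2 then Re (w i.1) else Im (w i.1).
have cg x : crd g x = w x by rewrite /crd /g /=; case: (ell2_fun w x).
have bg : ball g.
  split; last by move=> F; under eq_bigr => x _ do rewrite cg; rewrite (le_trans (fset_le_nrm2 _
    _)).
  move=> [x b] /=; rewrite in_itv/= -ler_norml.
  have := fset_le_nrm2 w [fset x]%fset; rewrite big_seq_fset1 => /le_trans/(_ w1).
  rewrite sqnE => h.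
  rewrite -sqrtr_sqr -[leRHS]sqrtr1 ler_wsqrtr// /g/=.
  by have := sqr_ge0 (Re (w x)); have := sqr_ge0 (Im (w x)); case: b; lra.
have -> : w = vec g by apply: ell2_eq => x; rewrite vecE// cg.
have := hf g; rewrite inE => /(_ bg); rewrite ler_sqrt// qf_ge0//.
Qed.

End MaxEigen.

Section Spectral.
Variables (R : realType) (X : choiceType).
Local Notation C := (R[i]).
Local Notation H := (ell2 R X).
Let ips := @inner_psd R X.

Lemma nrm2_add_le (u v : H) : nrm2 (u + v) <= 2 * nrm2 u + 2 * nrm2 v.
Proof. by have := nrm2_ge0 (u - v); rewrite nrm2B nrm2D; lra. Qed.

(** Variational principle: a maximizer of the form on the unit ball is an eigenvector for the
    maximum. The pair [(0, 0)] is returned when the form vanishes, so that deflation can go on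
    forever. *)
Lemma top_eigen (T : H -> H) : pos_op T -> exists m (v : H),
  [/\ 0 <= m, T v = m%:C%C *: v, (0 < m /\ nrm2 v = 1) \/ (m = 0 /\ v = 0) &
      forall w, qf (opform T) w <= m * nrm2 w].
Proof.
move=> hT; have hs := pos_op_psd hT.
have [v v1 hv] := pos_op_max hT.
pose m := qf (opform T) v.
have m0 : 0 <= m by exact: qf_ge0.
have bnd w : qf (opform T) w <= m * nrm2 w.
  have [w0|w0] := eqVneq (nrm2 w) 0.
    by rewrite (nrm2_eq0 w0) (qf0 hs) nrm20 mulr0.
  have wp : 0 < nrm2 w by rewrite lt_def w0 nrm2_ge0.
  pose c : C := ((Num.sqrt (nrm2 w))^-1)%:C%C.
  have cE : sqn c = (nrm2 w)^-1.
    by rewrite sqn_real exprVn sqr_sqrtr// nrm2_ge0.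
  have := hv (c *: w); rewrite nrm2Z cE mulVf// lexx => /(_ isT).
  by rewrite (qfZ hs) cE -/m mulrC ler_pdivrMr.
have [mz|mz] := eqVneq m 0.
  exists 0, 0; split=> //; first by rewrite (linear_fun0 (pos_op_lin hT)) scaler0.
    by right.
  by move=> w; rewrite -mz.
have mp : 0 < m by rewrite lt_def mz.
have n1 : nrm2 v = 1.
  apply/eqP; rewrite eq_le v1/=; have := bnd v; rewrite -/m.
  by rewrite ler_pMr.
exists m, v; split=> //; last by left.
(* This form is positive by maximality of [m] and null at [v], so [v] is in its kernel, which says
   [T v = m v]. *)
pose d (u w : H) : C := m%:C%C * inner u w - opform T u w.
have hd : psd_form d.
  split.
  - by move=> u a w w'; rewrite /d inner_linear (psd_lin hs); ring.
  - by move=> u w; rewrite /d inner_conj (psd_herm hs) conjcB conjcM conjc_realE.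
  - move=> u; rewrite /d innerE_nrm2 (qfE hs) -rmorphM -rmorphB ler0c subr_ge0.
    exact: bnd.
have dv : qf d v = 0.
  by rewrite /qf /d innerE_nrm2 (qfE hs) -rmorphM -rmorphB /= n1 mulr1 subrr.
apply: inner_nondeg => w.
have : d w v = 0 by rewrite (psd_herm hd) (psd_eq0 hd) ?conjC0.
by rewrite /d => /eqP; rewrite subr_eq0 => /eqP; rewrite (psdZr ips).
Qed.

Definition deflate (T : H -> H) (m : R) (v : H) : H -> H :=
  fun w => T w - (m%:C%C * inner v w) *: v.

Lemma opform_deflate T m v (w : H) : linear T ->
  Re (opform (deflate T m v) w w) = Re (opform T w w) - m * sqn (inner v w).
Proof.
move=> Tl; rewrite /opform /deflate (psdBr ips) (psdZr ips) ReB; congr (_ - _).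
by rewrite [inner w v]inner_conj -mulrA [_ * _^*]mulrC conjM_sqn -rmorphM.
Qed.

Lemma pos_op_deflate T m v : pos_op T -> 0 <= m -> T v = m%:C%C *: v ->
  (0 < m /\ nrm2 v = 1) \/ (m = 0 /\ v = 0) -> pos_op (deflate T m v).
Proof.
move=> hT m0 Tv vm; have hs := pos_op_psd hT; have Tl := pos_op_lin hT.
have v1 : nrm2 v <= 1 by case: vm => [[_ ->]//|[_ ->]]; rewrite nrm20.
split.
- move=> a u w; rewrite /deflate Tl (psdDr ips) (psdZr ips) mulrDr scalerDl.
  by rewrite mulrCA scalerBr scalerA opprD addrACA.
- have [K hK] := pos_op_bnd hT; exists (2 * K + 2 * m ^+ 2) => w.
  apply: (le_trans (nrm2_add_le _ _)).
  rewrite -[nrm2 (- _)]qf_inner (qfN ips) qf_inner nrm2Z sqnM sqn_real.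
  have := hK w; have := inner_CS v w; have := nrm2_ge0 w; have := nrm2_ge0 v.
  have := sqn_ge0 (inner v w); have := sqr_ge0 m.
  move: (nrm2 w) (nrm2 v) (nrm2 (T w)) (sqn _) (m ^+ 2) v1 => a b c d e b1 e0 d0 b0 a0 h1 h2.
  have h3 : d <= a by nra.
  have h4 : d * b <= a by nra.
  by have : e * (d * b) <= e * a; [rewrite ler_wpM2l|nra].
- move=> w; rewrite -/(opform (deflate T m v) w w) lecE; apply/andP; split.
    rewrite /opform /deflate (psdBr ips) (psdZr ips).
    rewrite [inner w v]inner_conj -mulrA [_ * _^*]mulrC conjM_sqn -rmorphM.
    rewrite -/(opform T w w) (qfE hs) -rmorphB //=.
  rewrite opform_deflate// subr_ge0 -/(qf (opform T) w).
  case: vm => [[mp n1]|[-> _]]; last by rewrite mul0r; exact: qf_ge0.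
  (* Since [T v = m v], Cauchy-Schwarz for the form of [T] reads [m^2 |<v,w>|^2 <= m <w, T w>];
     dividing by [m] leaves the deflated form nonnegative. *)
  have := psd_CS hs w v.
  rewrite {1}/opform Tv (psdZr ips) sqnM sqn_real -[sqn (inner w v)]sqn_conj -inner_conj.
  rewrite {2}/qf /opform Tv (psdZr ips) innerE_nrm2 n1 mulr1 /= expr2 -mulrA mulrCA.
  by rewrite [_ * m]mulrC ler_pM2l.
- have [K hK] := pos_op_tr hT; exists K => F; apply: (le_trans _ (hK F)).
  apply: ler_sum => x _; rewrite -/(opform (deflate T m v) (delta R x) (delta R x)).
  by rewrite opform_deflate// gerBl mulr_ge0// sqn_ge0.
Qed.

(** Completeness of the eigenvectors is expressed weakly, by [sd_qf]: the form is the sum of its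
    rank-one parts. The kernel of [T] gets no eigenvectors. *)
Record spectral_data (T : H -> H) (al : nat -> R) (e : nat -> H) : Prop := SpectralData {
  sd_ge0 : forall k, 0 <= al k ;
  sd_nrm : forall k, (0 < al k /\ nrm2 (e k) = 1) \/ (al k = 0 /\ e k = 0) ;
  sd_eig : forall k, T (e k) = (al k)%:C%C *: e k ;
  sd_orth : forall i j, i != j -> inner (e i) (e j) = 0 ;
  sd_qf : forall w,
    (qf (opform T) w)%:E = \esum_(k in [set: nat]) (al k * sqn (inner (e k) w))%:E }.

Lemma sd_porth T al e : spectral_data T al e -> porth e.
Proof.
move=> h; split=> [i j ij|i]; first exact: sd_orth h _ _ ij.
by case: (sd_nrm h i) => -[_ ->]; [left|right].
Qed.

(** Greedy deflation. The form left after [k] steps is at most [m k] times the squared norm, and the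
    [m k] have bounded sum, so some remainders are arbitrarily small. *)
Theorem spectral_theorem (T : H -> H) : pos_op T -> exists al e, spectral_data T al e.
Proof.
move=> hT.
pose A := {S : H -> H | pos_op S}.
have /boolp.choice[f hf] : forall S : A, exists mv : R * H,
    [/\ 0 <= mv.1, sval S mv.2 = mv.1%:C%C *: mv.2, (0 < mv.1 /\ nrm2 mv.2 = 1) \/ (mv.1 = 0 /\
      mv.2 = 0) &
      forall w, qf (opform (sval S)) w <= mv.1 * nrm2 w].
  by move=> [S hS]; have [m [v h]] := top_eigen hS; exists (m, v).
pose nxt (S : A) : A := exist _ (deflate (sval S) (f S).1 (f S).2)
  (let: And4 h1 h2 h3 _ := hf S in pos_op_deflate (svalP S) h1 h2 h3).
pose St k : A := iter k nxt (exist _ T hT).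
pose m k := (f (St k)).1; pose v k := (f (St k)).2.
have m0 k : 0 <= m k by case: (hf (St k)).
have mv k : (0 < m k /\ nrm2 (v k) = 1) \/ (m k = 0 /\ v k = 0) by case: (hf (St k)).
have ev k : sval (St k) (v k) = (m k)%:C%C *: v k by case: (hf (St k)).
have bd k w : qf (opform (sval (St k))) w <= m k * nrm2 w by case: (hf (St k)).
have StS k w : sval (St k.+1) w = sval (St k) w - ((m k)%:C%C * inner (v k) w) *: v k by [].
have lin k : linear (sval (St k)) by exact: pos_op_lin (svalP (St k)).
have psd k : psd_form (opform (sval (St k))) by exact: pos_op_psd (svalP (St k)).
have St0 k w : sval (St k) w = T w - \sum_(j < k) ((m j)%:C%C * inner (v j) w) *: v j.
  elim: k => [|k IH]; first by rewrite big_ord0 subr0.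
  by rewrite StS IH big_ord_recr/= opprD addrA.
(* A remainder kills every eigenvector already removed, and an eigenvector of it with a nonzero
   eigenvalue is orthogonal to its kernel. *)
have kill k : forall j, (j < k)%N -> sval (St k) (v j) = 0 /\ inner (v k) (v j) = 0.
  have aux j : sval (St k) (v j) = 0 -> inner (v k) (v j) = 0.
    move=> h; case: (mv k) => [[mp _]|[_ ->]]; last by rewrite (psd0l ips).
    have : opform (sval (St k)) (v j) (v k) = 0.
      by rewrite (psd_herm (psd k)) /opform h (psd0r ips) conjC0.
    rewrite /opform ev (psdZr ips) => /eqP; rewrite mulf_eq0 => /orP[|/eqP].
      by rewrite eq_complex/= (gt_eqF mp).
    by rewrite inner_conj => h'; rewrite -[LHS]conjCK h' conjC0.
  suff h j : (j < k)%N -> sval (St k) (v j) = 0 by move=> j jk; split; [|apply: aux]; exact: h.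
  move: aux => _; elim: k j => // k IH j; rewrite ltnS leq_eqVlt => /orP[/eqP ->|jk].
    rewrite StS ev innerE_nrm2; case: (mv k) => -[_ ->]; last by rewrite !scaler0 subr0.
    by rewrite mulr1 subrr.
  rewrite StS IH// sub0r; apply/eqP; rewrite oppr_eq0; apply/eqP.
  case: (mv k) => [[mp _]|[_ ->]]; last by rewrite scaler0.
  have : opform (sval (St k)) (v k) (v j) = 0 by rewrite /opform IH// (psd0r ips).
  rewrite (psd_herm (psd k)) /opform ev (psdZr ips) conjcM conjc_realE -inner_conj => ->.
  by rewrite scale0r.
have orth i j : i != j -> inner (v i) (v j) = 0.
  rewrite neq_ltn => /orP[ij|ij]; last by have [] := kill _ _ ij.
  by rewrite inner_conj; have [_ ->] := kill _ _ ij; rewrite conjC0.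
have qk k w : qf (opform (sval (St k))) w = qf (opform T) w - \sum_(j < k) m j * sqn (inner (v j)
  w).
  elim: k => [|k IH]; first by rewrite big_ord0 subr0.
  rewrite big_ord_recr/= opprD addrA -IH /qf.
  exact: (opform_deflate (m k) (v k) w (lin k)).
exists m, v; split=> //.
  move=> k; rewrite -ev St0 big1 ?subr0// => j _.
  by rewrite orth ?mulr0 ?scale0r// neq_ltn ltn_ord.
have [K hK] := pos_op_tr hT.
(* Positivity of the remainder at each basis vector bounds the removed rank-one parts by the
   diagonal of [T]; summing over the basis turns them into [m j]. *)
have summ k : \sum_(j < k) m j <= K.
  have : (\esum_(x in [set: X]) (\sum_(j < k) (m j * sqn (v j x))%:E) <= K%:E)%E.
    apply: ge_ereal_sup => _ [F [fF _] <-]; rewrite fsbig_finite//=.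
    under eq_bigr => x _ do rewrite sumEFin.
    rewrite sumEFin lee_fin (le_trans _ (hK (fset_set F)))//; apply: ler_sum => x _.
    have := qf_ge0 (psd k) (delta R x); rewrite qk subr_ge0; apply: le_trans.
    by apply: ler_sum => j _; rewrite inner_deltar sqn_conj.
  rewrite esum_sum; last by move=> x j _ _; rewrite lee_fin mulr_ge0// sqn_ge0.
  suff -> : (\sum_(j < k) \esum_(x in [set: X]) (m j * sqn (v j x))%:E = (\sum_(j < k) m j)%:E)%E.
    by rewrite lee_fin.
  rewrite -sumEFin; apply: eq_bigr => j _.
  case: (mv j) => -[h1 h2]; last first.
    by rewrite h1 esum1// => x _; rewrite mul0r.
  under eq_esum => x _ do rewrite EFinM.
  rewrite esumZl// => [|x]; last by rewrite lee_fin sqn_ge0.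
  by rewrite -nrm2E h2 mule1.
(* Otherwise the first [n] values, each at least [e], would sum to more than [K]. One small value is
   enough; monotonicity of [m] is never invoked. *)
have small e : 0 < e -> exists k, m k < e.
  move=> e0; apply: contrapT => /forallNP h.
  have K0 : 0 <= K by have := summ 0%N; rewrite big_ord0.
  pose n := (Num.trunc (K / e)).+1.
  have : K < n%:R * e by rewrite -ltr_pdivrMr// truncnS_gt.
  rewrite ltNge => /negP; apply; apply: le_trans (summ n).
  rewrite mulr_natl -[n in X in X <= _]card_ord -sumr_const; apply: ler_sum => j _.
  by rewrite leNgt; apply/negP; exact: h.
move=> w; apply/eqP; rewrite eq_le; apply/andP; split.
  apply/lee_addgt0Pr => e e0.
  have d0 : 0 < e / (nrm2 w + 1) by rewrite divr_gt0//; have := nrm2_ge0 w; lra.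
  have [k hk] := small _ d0.
  apply: (@le_trans _ _ ((\sum_(j < k) m j * sqn (inner (v j) w))%:E + e%:E)%E).
    rewrite -EFinD lee_fin -lerBlDl -qk (le_trans (bd k w))//.
    apply: (@le_trans _ _ (e / (nrm2 w + 1) * nrm2 w)); first by rewrite ler_wpM2r ?nrm2_ge0// ltW.
    rewrite -mulrA ler_piMr ?(ltW e0)//.
    rewrite mulrC ler_pdivrMr; have := nrm2_ge0 w; lra.
  apply: leeD => //.
  rewrite -(big_mkord xpredT (fun j => m j * sqn (inner (v j) w))).
  exact: sum_le_esum (iota_uniq _ _).
apply: esum_nat_le => k; first by rewrite mulr_ge0// sqn_ge0.
by rewrite -subr_ge0 -qk; exact: qf_ge0.
Qed.

End Spectral.

(** * States and entropy *)

Section States.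
Variables (R : realType) (X : choiceType).
Local Notation C := (R[i]).
Local Notation H := (ell2 R X).

Definition dens (T : H -> H) : Prop := pos_op T /\
  \esum_(x in [set: X]) (qf (opform T) (delta R x))%:E = 1%:E.

Lemma bounded_opP (T : H -> H) : bounded_op T <->
  linear T /\ exists K : R, forall v, nrm2 (T v) <= K * nrm2 v.
Proof.
split=> -[Tl [K hK]]; split=> //.
  exists (K ^+ 2) => v; have := hK v; rewrite !ell2_normE => h.
  rewrite -[nrm2 (T v)]sqr_sqrtr ?nrm2_ge0// -[X in _ * X]sqr_sqrtr ?nrm2_ge0// -exprMn.
  rewrite -[leRHS]ger0_norm ?sqr_ge0// normrX ler_sqr ?nnegrE ?sqrtr_ge0 ?normr_ge0//.
  exact: (le_trans h (ler_norm _)).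
exists (Num.sqrt `|K|) => v; rewrite !ell2_normE -sqrtrM// ler_wsqrtr//.
by rewrite (le_trans (hK v))// ler_wpM2r ?nrm2_ge0// ler_norm.
Qed.

Lemma porth_nrm2_le1 (J : eqType) (e : J -> H) i : porth e -> nrm2 (e i) <= 1.
Proof. by move=> [_ h]; case: (h i) => ->//; rewrite nrm20. Qed.

Lemma spectral_trace (T : H -> H) al e : spectral_data T al e ->
  \esum_(x in [set: X]) (qf (opform T) (delta R x))%:E = \esum_(k in [set: nat]) (al k)%:E.
Proof.
move=> sd; under eq_esum => x _ do rewrite (sd_qf sd).
rewrite esum_swap; last by move=> x k; rewrite lee_fin mulr_ge0 ?sqn_ge0 ?(sd_ge0 sd).
apply: eq_esum => k _; under eq_esum => x _ do rewrite EFinM.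
rewrite esumZl ?(sd_ge0 sd)// => [|x]; last by rewrite lee_fin sqn_ge0.
under eq_esum => x _ do rewrite inner_deltar sqn_conj.
rewrite -nrm2E; case: (sd_nrm sd k) => -[h1 h2]; first by rewrite h2 mule1.
by rewrite h1 mul0e.
Qed.

(** Tonelli on the spectral expansion, then Bessel for each eigenvector against the system [e]. *)
Lemma pos_op_bessel (T : H -> H) (J : choiceType) (e : J -> H) : pos_op T -> porth e ->
  (\esum_(i in [set: J]) (qf (opform T) (e i))%:E <=
   \esum_(x in [set: X]) (qf (opform T) (delta R x))%:E)%E.
Proof.
move=> hT he; have [al [v sd]] := spectral_theorem hT.
rewrite (spectral_trace sd); under eq_esum => i _ do rewrite (sd_qf sd).
rewrite esum_swap; last by move=> x k; rewrite lee_fin mulr_ge0 ?sqn_ge0 ?(sd_ge0 sd).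
apply: le_esum => k _; under eq_esum => x _ do rewrite EFinM.
rewrite esumZl ?(sd_ge0 sd)// => [|x]; last by rewrite lee_fin sqn_ge0.
rewrite -[leRHS]mule1; apply: lee_wpmul2l; first by rewrite lee_fin (sd_ge0 sd).
under eq_esum => i _ do rewrite inner_conj sqn_conj.
apply: (le_trans (bessel _ he)); rewrite lee_fin.
exact: porth_nrm2_le1 (sd_porth sd).
Qed.

Lemma pos_op_trE (T : H -> H) : pos_op T ->
  (\esum_(x in [set: X]) (qf (opform T) (delta R x))%:E < +oo)%E.
Proof.
move=> hT; have [K hK] := pos_op_tr hT; apply: (@le_lt_trans _ _ K%:E); last exact: ltry.
by apply: esum_le_fset => F; rewrite lee_fin; exact: hK.
Qed.

Lemma trace_pos_op (T : H -> H) : pos_op T ->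
  trace T = (fine (\esum_(x in [set: X]) (qf (opform T) (delta R x))%:E))%:C%C.
Proof.
move=> hT; have hs := pos_op_psd hT.
(* The diagonal is written as [|u x|^2] for a vector [u] of [ell2], so that the limit defining
   [trace] is the known one of [inner u u]. *)
pose u0 : X -> C^o := fun x => (Num.sqrt (qf (opform T) (delta R x)))%:C%C.
have sE x : sqn (u0 x) = qf (opform T) (delta R x) by rewrite sqn_real sqr_sqrtr// qf_ge0.
have hu : u0 \in @ell2_pred R X.
  have [K hK] := pos_op_tr hT; apply/ell2P; exists K => F; apply: le_trans (hK F).
  by apply: ler_sum => x _; rewrite -/(sqn (u0 x)) sE.
pose u : H := Ell2 hu.
have -> : \esum_(x in [set: X]) (qf (opform T) (delta R x))%:E = (nrm2 u)%:E.
  by rewrite nrm2E; apply: eq_esum => x _; rewrite -sE.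
have E : (fun x => inner (delta R x) (T (delta R x))) = (fun x => (u x)^* * u x).
  by apply: boolp.funext => x; rewrite conjM_sqn sE; exact: (qfE hs).
by rewrite /= -innerE_nrm2 /trace E.
Qed.

(** Cauchy-Schwarz for the form of [T], then for the finite sum; each of the two resulting diagonal
    sums is at most the trace by [pos_op_bessel]. *)
Lemma trace_norm_pos_op (T : H -> H) : pos_op T ->
  (trace_norm T <= \esum_(x in [set: X]) (qf (opform T) (delta R x))%:E)%E.
Proof.
move=> hT; have hs := pos_op_psd hT; have trf := pos_op_trE hT.
apply: ge_ereal_sup => _ [m [e [f [he hf ->]]]].
have tr0 : (0 <= \esum_(x in [set: X]) (qf (opform T) (delta R x))%:E)%E.
  by apply: esum_ge0 => x _; rewrite lee_fin qf_ge0.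
set tr := esum _ _ in trf tr0 *.
have trE : tr = (fine tr)%:E by rewrite fineK// ge0_fin_numE.
have key (g : 'I_m -> H) : orthonormal_sys g -> \sum_i qf (opform T) (g i) <= fine tr.
  move=> hg; rewrite -lee_fin -trE; apply: le_trans (pos_op_bessel hT (orthonormal_porth hg)).
  exact: sum_le_esum (index_enum_uniq _).
rewrite trE lee_fin.
apply: (@le_trans _ _ (\sum_(i < m) Num.sqrt (qf (opform T) (f i)) * Num.sqrt (qf (opform T) (e
  i)))).
  by apply: ler_sum => i _; exact: (normc_psd_le hs).
have t0 : 0 <= fine tr by rewrite fine_ge0.
rewrite -ler_sqr ?nnegrE//; last by apply: sumr_ge0 => i _; rewrite mulr_ge0 ?sqrtr_ge0.
apply: (le_trans (sum_CS _ _ _ _)); rewrite expr2.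
under eq_bigr => i _ do rewrite sqr_sqrtr ?(qf_ge0 hs)//.
under [X in _ * X <= _]eq_bigr => i _ do rewrite sqr_sqrtr ?(qf_ge0 hs)//.
by apply: ler_pM; rewrite ?key//; apply: sumr_ge0 => i _; exact: qf_ge0.
Qed.

Lemma trace_class_pos_op (T : H -> H) : trace_class T -> positive_op T -> pos_op T.
Proof.
move=> [/bounded_opP[Tl Tb] tn] Tp; split => //.
have tn0 : (0 <= trace_norm T)%E.
  have z (g : 'I_0 -> H) : orthonormal_sys g by move=> [].
  apply: ereal_sup_ubound; exists 0%N, (fun=> 0), (fun=> 0).
  by rewrite big_ord0; split; [exact: z|exact: z|].
exists (fine (trace_norm T)) => F; rewrite -lee_fin fineK ?ge0_fin_numE//.
pose e (i : 'I_(size F)) : H := delta R (tnth (in_tuple F) i).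
have he : orthonormal_sys e.
  move=> i j; rewrite /e inner_delta /=; congr (nat_of_bool _)%:R.
  by apply: inj_eq; apply/tuple_uniqP; exact: fset_uniq.
apply: (@le_trans _ _ (\sum_(i < size F) Normc.normc (inner (e i) (T (e i))))%:E); last first.
  by apply: ereal_sup_ubound; exists (size F), e, e.
rewrite lee_fin big_tnth; apply: ler_sum => i _; exact: Re_le_normc.
Qed.

Lemma is_stateP (T : H -> H) : is_state T <-> dens T.
Proof.
split=> [[tc tp t1]|[hT t1]].
  have hT := trace_class_pos_op tc tp; split=> //.
  have := trace_pos_op hT; rewrite t1 => /(congr1 (@complex.Re R))/= h.
  by rewrite [in RHS]h fineK// ge0_fin_numE ?pos_op_trE// esum_ge0// => x _; rewrite lee_fin
    (qf_ge0 (pos_op_psd hT)).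
split; last by rewrite trace_pos_op// t1.
  split; first by apply/bounded_opP; split; [exact: pos_op_lin|exact: pos_op_bnd].
  exact: le_lt_trans (trace_norm_pos_op hT) (pos_op_trE hT).
exact: pos_op_ge0.
Qed.

End States.

Section Entropy.
Variable R : realType.
Local Notation C := (R[i]).

Definition eta (a : R) : R := - (a * ln a).

Lemma eta0 : eta 0 = 0. Proof. by rewrite /eta mul0r oppr0. Qed.

Lemma eta_ge0 a : 0 <= a -> a <= 1 -> 0 <= eta a.
Proof. by move=> a0 a1; rewrite oppr_ge0 mulr_ge0_le0// ln_le0. Qed.

(* Tangent line of the concave function [eta] at [t]. *)
Lemma eta_tangent a t : 0 <= a -> 0 < t -> eta a + a <= a * (- ln t) + t.
Proof.
rewrite le_eqVlt => /orP[/eqP <-|a0] t0; first by rewrite eta0 mul0r !add0r ltW.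
have h : ln (t / a) <= t / a - 1.
  have := @le_ln1Dx R (t / a - 1); rewrite (_ : 1 + (t / a - 1) = t / a); last by ring.
  by apply; rewrite ltrBrDl subrr divr_gt0.
have : a * ln (t / a) <= a * (t / a - 1) by rewrite ler_wpM2l// ltW.
rewrite ln_div ?posrE// mulrBr mulrBr mulr1 mulrCA mulfV ?gt_eqF// mulr1 /eta.
by lra.
Qed.

(** The tangent inequality at the mean [s], averaged. Total weight below 1 is allowed because this
    tangent has nonnegative intercept [s]; the case [s = 0] has no tangent and is separate. *)
Lemma eta_jensen (K : choiceType) (p a : K -> R) (s : R) :
  (forall k, 0 <= p k) -> (forall k, 0 <= a k <= 1) ->
  (\esum_(k in [set: K]) (p k)%:E <= 1)%E ->
  \esum_(k in [set: K]) (p k * a k)%:E = s%:E -> s <= 1 ->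
  (\esum_(k in [set: K]) (p k * eta (a k))%:E <= (eta s)%:E)%E.
Proof.
move=> p0 a01 p1 sE s1.
have pa0 k : 0 <= p k * a k by rewrite mulr_ge0//; case/andP: (a01 k).
have pe0 k : 0 <= p k * eta (a k) by case/andP: (a01 k) => ? ?; rewrite mulr_ge0// eta_ge0.
have s0 : 0 <= s by rewrite -lee_fin -sE esum_ge0// => k _; rewrite lee_fin.
have [z|sn0] := eqVneq s 0.
  rewrite z eta0 esum1// => k _; congr EFin.
  have : ((p k * a k)%:E <= s%:E)%E.
    by rewrite -sE; exact: (term_le_esum (fun k => p k * a k)).
  rewrite z lee_fin => h; have /eqP : p k * a k == 0 by rewrite eq_le h pa0.
  by move/eqP; rewrite mulf_eq0 => /orP[/eqP ->|/eqP ->]; rewrite ?mul0r// eta0 mulr0.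
have sp : 0 < s by rewrite lt_def sn0.
have ls : 0 <= - ln s by rewrite oppr_ge0 ln_le0.
rewrite -(@leeD2rE _ s%:E)// -{1}sE -esumD; [|by move=> k _; rewrite lee_fin|by move=> k _;
  rewrite lee_fin].
apply: (@le_trans _ _ (\esum_(k in [set: K]) ((- ln s)%:E * (p k * a k)%:E + s%:E * (p k)%:E))%E).
  apply: le_esum => k _; rewrite -!EFinM -!EFinD lee_fin.
  case/andP: (a01 k) => ak0 _.
  by have := ler_wpM2l (p0 k) (eta_tangent ak0 sp); lra.
rewrite esumD; last 2 first.
- by move=> k _; rewrite mule_ge0// lee_fin.
- by move=> k _; rewrite mule_ge0// lee_fin.
rewrite !esumZl//.
rewrite sE -EFinM leeD//; first by rewrite lee_fin /eta mulNr mulrC.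
by rewrite -[leRHS]mule1 lee_wpmul2l// lee_fin.
Qed.

End Entropy.

Section EntropyFormulas.
Variables (R : realType) (X : choiceType).
Local Notation C := (R[i]).
Local Notation H := (ell2 R X).
Let ips := @inner_psd R X.
Variables (T : H -> H) (al : nat -> R) (e : nat -> H).
Hypothesis hT : dens T.
Hypothesis sd : spectral_data T al e.
Let Tp := hT.1.
Let hs := pos_op_psd Tp.

Lemma opform_herm u v : inner (T u) v = inner u (T v).
Proof. by rewrite inner_conj -/(opform T v u) (psd_herm hs) conjCK. Qed.

Lemma sd_sum : \esum_(k in [set: nat]) (al k)%:E = 1%:E.
Proof. by rewrite -(spectral_trace sd) hT.2. Qed.

Lemma sd_le1 k : al k <= 1.
Proof.
by rewrite -lee_fin -sd_sum; exact: term_le_esum.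
Qed.

Lemma sd_eta_ge0 k : 0 <= eta (al k).
Proof. by rewrite eta_ge0 ?(sd_ge0 sd) ?sd_le1. Qed.

Lemma sd_qf_eigvec k : qf (opform T) (e k) = al k.
Proof.
rewrite /qf /opform (sd_eig sd) (psdZr ips) innerE_nrm2.
by case: (sd_nrm sd k) => -[h1 h2]; rewrite h2/= ?h1; lra.
Qed.

(** An eigenvector for [a] is orthogonal to each [e k] with another eigenvalue, so [sd_qf] makes its
    squared coefficients over [al k = a] sum to 1. Summing over an orthonormal family of
    eigenvectors and applying Bessel to each [e k] bounds its size; the [e k] themselves attain the
    bound. *)
Lemma eigen_multE a : 0 < a ->
  eigen_mult T a = \esum_(k in [set k | al k = a]) 1%E.
Proof.
move=> a0; apply/eqP; rewrite eq_le; apply/andP; split.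
  apply: ge_ereal_sup => _ [m [g [og eg]] <-].
  have par l : \esum_(k in [set k | al k = a]) (sqn (inner (e k) (g l)))%:E = 1%E.
    have [no] := orthonormal_porth og.
    have gl1 : nrm2 (g l) = 1 by rewrite -Re_inner og eqxx.
    have q1 : qf (opform T) (g l) = a.
      by rewrite /qf /opform eg (psdZr ips) innerE_nrm2 gl1 /=; lra.
    have z k : al k <> a -> inner (e k) (g l) = 0.
      move=> ka; have := opform_herm (e k) (g l).
      rewrite eg (sd_eig sd) (psdZr ips) (psdZl ips) conjc_realE => /eqP.
      rewrite -subr_eq0 -mulrBl mulf_eq0 => /orP[|/eqP//].
      by rewrite eq_complex/= subr_eq0 => /andP[/eqP].
    transitivity (a^-1%:E * \esum_(k in [set: nat]) (al k * sqn (inner (e k) (g l)))%:E)%E; last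
      first.
      by rewrite -(sd_qf sd) q1 -EFinM mulVf ?gt_eqF.
    rewrite -esumZl ?invr_ge0 ?(ltW a0)//; last first.
      by move=> k; rewrite lee_fin mulr_ge0 ?sqn_ge0 ?(sd_ge0 sd).
    rewrite esum_mkcond; apply: eq_esum => k _; case: ifPn.
      by rewrite inE /= => ->; rewrite -EFinM mulrA mulVf ?gt_eqF// mul1r.
    by rewrite notin_setE /= => /z ->; rewrite sqn0 mulr0 mule0.
  rewrite -(_ : (\sum_(l < m) \esum_(k in [set k | al k = a]) (sqn (inner (e k) (g l)))%:E)%E =
    m%:R%:E); last first.
    by under eq_bigr do rewrite par; rewrite sumEFin sumr_const card_ord.
  rewrite -esum_sum; last by move=> k l _ _; rewrite lee_fin sqn_ge0.
  apply: le_esum => k _; rewrite sumEFin lee_fin.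
  apply: (le_trans _ (porth_nrm2_le1 k (sd_porth sd))).
  under eq_bigr => l _ do rewrite inner_conj sqn_conj.
  exact: (bessel_seq _ (orthonormal_porth og) (index_enum_uniq _)).
apply: ge_ereal_sup => _ [A [fA AE] <-].
rewrite fsbig_finite//= sumEFin; apply: ereal_sup_ubound.
set F := fset_set A; exists (size F); last by rewrite big_tnth sumr_const card_ord.
have AF i : al (tnth (in_tuple F) i) = a.
  by apply: AE; have := mem_tnth i (in_tuple F); rewrite in_fset_set// inE.
exists (fun i => e (tnth (in_tuple F) i)); split; last by move=> i; rewrite (sd_eig sd) AF.
move=> i j; have [->|ij] := eqVneq i j.
  rewrite innerE_nrm2; case: (sd_nrm sd (tnth (in_tuple F) j)) => -[h1 h2]; first by rewrite h2.
  by move: h1; rewrite AF => h1; rewrite h1 ltxx in a0.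
rewrite (sd_orth sd)//; apply: contra ij => /eqP h; apply/eqP.
by move: h; apply: (tuple_uniqP (in_tuple F) _); exact: fset_uniq.
Qed.

(** The sum over eigenvalues with multiplicity is regrouped along the fibres of [al]; the padding
    [al k = 0] contributes [eta 0 = 0]. *)
Lemma entropyE : entropy T = \esum_(k in [set: nat]) (eta (al k))%:E.
Proof.
transitivity (\esum_(a in [set a : R | 0 < a]) \esum_(k in [set k | al k = a]) (eta (al k))%:E).
  apply: eq_esum => a a0; rewrite eigen_multE//.
  have [[k ka]|] := pselect (exists k, al k = a); last first.
    move=> /forallNP h; rewrite (_ : [set k | _] = set0); last by apply/seteqP; split=> k // /h.
    by rewrite !esum_set0 mul0e.
  have ea : 0 <= eta a by rewrite -ka sd_eta_ge0.
  rewrite muleC -/(eta a) -esumZl//; apply: eq_esum => l /= ->.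
  by rewrite mule1.
rewrite esum_esum; last by move=> a k _ _; rewrite lee_fin sd_eta_ge0.
rewrite (@reindex_esum _ _ _ [set k | 0 < al k] _ (fun k => (al k, k)) (fun z => (eta (al
  z.2))%:E))/=.
  rewrite esum_mkcond; apply: eq_esum => k _; case: ifPn => //; rewrite notin_setE/= => h.
  congr EFin; have : al k = 0 by apply/eqP; rewrite eq_le (sd_ge0 sd) andbT leNgt; apply/negP.
  by move=> ->; rewrite eta0.
split=> [k /= k0|k l _ _ [_ ->]//|[a k] /= [a0 ak]].
- by split.
- by exists k; rewrite ?ak.
Qed.

End EntropyFormulas.

(** Turns conservation of total trace into the termwise statement that no weight is lost. *)
Lemma esum_le_eq (R : realType) (T : choiceType) (f g : T -> R) (K : R) :
  (forall x, 0 <= f x) -> (forall x, f x <= g x) ->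
  \esum_(x in [set: T]) (f x)%:E = K%:E -> \esum_(x in [set: T]) (g x)%:E = K%:E ->
  forall x, f x = g x.
Proof.
move=> f0 fg fK gK x; apply/eqP; rewrite eq_le fg/= -subr_le0.
have d0 y : 0 <= g y - f y by rewrite subr_ge0.
have : (\esum_(x in [set: T]) (g x - f x)%:E + K%:E = K%:E)%E.
  rewrite -[in LHS]fK -esumD; [|by move=> y _; rewrite lee_fin|by move=> y _; rewrite lee_fin].
  by rewrite -[RHS]gK; apply: eq_esum => y _; rewrite -EFinD subrK.
move=> h; rewrite -lee_fin; apply: (le_trans (term_le_esum (fun x => g x - f x) x)).
by rewrite -(@leeD2rE _ K%:E)// h add0e.
Qed.

Section Schur.
Variables (R : realType) (X : choiceType).
Local Notation C := (R[i]).
Local Notation H := (ell2 R X).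

Lemma dens_qf_le1 (T : H -> H) (J : choiceType) (e : J -> H) j : dens T -> porth e ->
  qf (opform T) (e j) <= 1.
Proof.
move=> [Tp t1] he; rewrite -lee_fin -t1; apply: le_trans (pos_op_bessel Tp he).
exact: (term_le_esum (fun j => qf (opform T) (e j))).
Qed.

(** The diagonal along [ep] is the image of the spectrum under the doubly substochastic matrix [p],
    and [eta] is concave. The trace hypothesis prevents [p] from losing mass on the support of the
    spectrum. *)
Lemma entropy_schur (T : H -> H) (J : choiceType) (ep : J -> H) : dens T -> porth ep ->
  \esum_(b in [set: J]) (qf (opform T) (ep b))%:E = 1%:E ->
  (entropy T <= \esum_(b in [set: J]) (eta (qf (opform T) (ep b)))%:E)%E.
Proof.
move=> hT hep s1; have [al [e sd]] := spectral_theorem hT.1.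
rewrite (entropyE hT sd).
pose p k b := sqn (inner (e k) (ep b)).
have p0 k b : 0 <= p k b by exact: sqn_ge0.
pose P k := fine (\esum_(b in [set: J]) (p k b)%:E).
have p1 k : (\esum_(b in [set: J]) (p k b)%:E <= 1)%E.
  under eq_esum => b _ do rewrite /p inner_conj sqn_conj.
  by apply: (le_trans (bessel _ hep)); rewrite lee_fin (porth_nrm2_le1 _ (sd_porth sd)).
have PE k : \esum_(b in [set: J]) (p k b)%:E = (P k)%:E.
  rewrite fineK// ge0_fin_numE; first by apply: le_lt_trans (p1 k) _; exact: ltry.
  by apply: esum_ge0 => b _; rewrite lee_fin.
have P0 k : 0 <= P k by rewrite -lee_fin -PE esum_ge0// => b _; rewrite lee_fin.
have al0 := sd_ge0 sd.
(* Row sums are at most 1 and both weighted totals equal 1, so [P k = 1] wherever [al k] is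
   nonzero. *)
have alP : forall k, al k * P k = al k.
  apply: (esum_le_eq (K := 1)) => [k|k||]; first by rewrite mulr_ge0.
  - by rewrite ler_piMr// -lee_fin -PE.
  - rewrite -s1; under [in RHS]eq_esum => b _ do rewrite (sd_qf sd).
    rewrite esum_swap; last by move=> b k; rewrite lee_fin mulr_ge0// p0.
    apply: eq_esum => k _; under eq_esum => b _ do rewrite EFinM.
    by rewrite esumZl// => [|b]; [rewrite PE -EFinM|rewrite lee_fin p0].
  - exact: sd_sum hT sd.
have eP k : eta (al k) * P k = eta (al k) by rewrite /eta mulNr mulrAC alP.
have eta0 := sd_eta_ge0 hT sd.
apply: (@le_trans _ _ (\esum_(k in [set: nat]) \esum_(b in [set: J]) (p k b * eta (al k))%:E)).
  apply: le_esum => k _; under eq_esum => b _ do rewrite mulrC EFinM.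
  by rewrite esumZl// => [|b]; [rewrite PE -EFinM eP|rewrite lee_fin].
rewrite esum_swap; last by move=> k b; rewrite lee_fin mulr_ge0.
apply: le_esum => b _; apply: eta_jensen => //.
- by move=> k; rewrite al0 (sd_le1 hT sd).
- apply: (le_trans (bessel _ (sd_porth sd))).
  by rewrite lee_fin porth_nrm2_le1.
- by rewrite (sd_qf sd); apply: eq_esum => k _; rewrite mulrC.
- exact: dens_qf_le1.
Qed.

Lemma entropy_ge0 (T : H -> H) : dens T -> (0 <= entropy T)%E.
Proof.
move=> hT; have [al [e sd]] := spectral_theorem hT.1.
by rewrite (entropyE hT sd) esum_ge0// => k _; rewrite lee_fin (sd_eta_ge0 hT sd).
Qed.

End Schur.

Section Mixture.
Variables (R : realType) (X : choiceType) (I : finType).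
Local Notation C := (R[i]).
Local Notation H := (ell2 R X).
Let ips := @inner_psd R X.

Definition mixop (u : I -> H) (w : H) : H :=
  (#|I|%:R^-1 : R)%:C%C *: \sum_i inner (u i) w *: u i.

Lemma opform_mixop u (v w : H) : opform (mixop u) v w =
  (#|I|%:R^-1 : R)%:C%C * \sum_i inner v (u i) * inner (u i) w.
Proof.
rewrite /opform /mixop (psdZr ips) (psd_sumr ips); congr (_ * _).
by apply: eq_bigr => i _; rewrite (psdZr ips) mulrC.
Qed.

Lemma qf_mixop u (w : H) : qf (opform (mixop u)) w = #|I|%:R^-1 * \sum_i sqn (inner (u i) w).
Proof.
rewrite /qf opform_mixop ReMr Re_sum; congr (_ * _); apply: eq_bigr => i _.
by rewrite inner_conj conjM_sqn.
Qed.

Lemma nrm2_sum_le (J : finType) (F : J -> H) :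
  nrm2 (\sum_j F j) <= #|J|%:R * \sum_j nrm2 (F j).
Proof.
have h : Num.sqrt (nrm2 (\sum_j F j)) <= \sum_j Num.sqrt (nrm2 (F j)).
  elim/big_rec2: _ => [|j y v _ h]; first by rewrite nrm20 sqrtr0.
  rewrite -qf_inner; apply: (le_trans (psd_mink ips _ _)).
  by rewrite !qf_inner lerD2l.
rewrite -[leLHS]sqr_sqrtr ?nrm2_ge0//.
apply: (@le_trans _ _ ((\sum_j Num.sqrt (nrm2 (F j))) ^+ 2)).
  by rewrite ler_sqr ?nnegrE ?sqrtr_ge0// sumr_ge0// => j _; exact: sqrtr_ge0.
under eq_bigr do rewrite -[Num.sqrt _]mul1r.
apply: (le_trans (sum_CS _ _ _ _)).
under eq_bigr do rewrite expr1n.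
rewrite sumr_const; under [X in _ * X <= _]eq_bigr do rewrite sqr_sqrtr ?nrm2_ge0//.
by [].
Qed.

Hypothesis I0 : (0 < #|I|)%N.
Let n0 : 0 < #|I|%:R :> R. Proof. by rewrite ltr0n. Qed.

Lemma mixop_dens u : (forall i, nrm2 (u i) = 1) -> dens (mixop u).
Proof.
move=> u1; have lin : linear (mixop u).
  move=> a v w; rewrite /mixop scalerA [a * _]mulrC -scalerA -scalerDr [a *: bigop _ _
    _]scaler_sumr -big_split/=.
  congr (_ *: _); apply: eq_bigr => i _.
  by rewrite inner_linear scalerDl scalerA.
have tr1 : \esum_(x in [set: X]) (qf (opform (mixop u)) (delta R x))%:E = 1%:E.
  under eq_esum => x _ do rewrite qf_mixop EFinM -sumEFin.
  rewrite esumZl ?invr_ge0 ?(ltW n0)//; last first.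
    by move=> x; rewrite sume_ge0// => i _; rewrite lee_fin sqn_ge0.
  rewrite esum_sum; last by move=> x i _ _; rewrite lee_fin sqn_ge0.
  rewrite (eq_bigr (fun=> 1%E)); last first.
    move=> i _; rewrite -[in RHS](u1 i) nrm2E; apply: eq_esum => x _.
    by rewrite inner_deltar sqn_conj.
  by rewrite sumEFin sumr_const -EFinM mulVf// gt_eqF.
split => //; split => //.
- exists (#|I|%:R^-1 ^+ 2 * (#|I|%:R * #|I|%:R)) => w.
  rewrite /mixop nrm2Z sqn_real -[leRHS]mulrA ler_wpM2l ?sqr_ge0//.
  apply: (le_trans (nrm2_sum_le _)); rewrite -[leRHS]mulrA ler_wpM2l ?(ltW n0)//.
  rewrite mulr_natl -sumr_const; apply: ler_sum => i _.
  by rewrite nrm2Z u1 mulr1 (le_trans (inner_CS _ _))// u1 mul1r.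
- move=> w; rewrite -/(opform (mixop u) w w) opform_mixop.
  rewrite (eq_bigr (fun i => (sqn (inner (u i) w))%:C%C)); last first.
    by move=> i _; rewrite [inner w _]inner_conj conjM_sqn.
  rewrite -real_complex_sum -rmorphM ler0c mulr_ge0 ?invr_ge0 ?(ltW n0)//.
  by apply: sumr_ge0 => i _; exact: sqn_ge0.
- exists 1 => F; rewrite -lee_fin -tr1; exact: sum_le_esum.
Qed.

(* Collision entropy bounds the von Neumann entropy from below; the purity of
   [mixop u] is read off the Gram matrix of [u]. *)
Lemma entropy_mixop_ge u (tau : R) : (forall i, nrm2 (u i) = 1) -> 0 < tau <= 1 ->
  #|I|%:R^-1 ^+ 2 * \sum_i \sum_j sqn (inner (u i) (u j)) <= tau ->
  ((- ln tau)%:E <= entropy (mixop u))%E.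
Proof.
move=> u1 /andP[t0 t1] htau; have hT := mixop_dens u1.
have [al [e sd]] := spectral_theorem hT.1.
rewrite (entropyE hT sd).
have al0 := sd_ge0 sd.
have lt0 : 0 <= - ln tau by rewrite oppr_ge0 ln_le0.
(* Writing [al k ^+ 2] as [al k] times the form at [e k] and exchanging sums gives the mean over [i]
   of the form at [u i], which is the normalized Gram sum. *)
have sq : (\esum_(k in [set: nat]) (al k ^+ 2)%:E <= tau%:E)%E.
  rewrite (eq_esum (b := fun k => (#|I|%:R^-1%:E * \sum_i (al k * sqn (inner (e k) (u
    i)))%:E)%E)); last first.
    move=> k _; rewrite sumEFin -EFinM -mulr_sumr mulrCA expr2 -{2}(sd_qf_eigvec sd).
    rewrite qf_mixop; congr (_ * (_ * _))%:E; apply: eq_bigr => i _.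
    by rewrite inner_conj sqn_conj.
  rewrite esumZl ?invr_ge0 ?(ltW n0)//; last first.
    by move=> k; rewrite sume_ge0// => i _; rewrite lee_fin mulr_ge0 ?sqn_ge0.
  rewrite esum_sum; last by move=> k i _ _; rewrite lee_fin mulr_ge0 ?sqn_ge0.
  under eq_bigr => i _ do rewrite -(sd_qf sd) qf_mixop.
  rewrite sumEFin -EFinM lee_fin; apply: le_trans htau.
  rewrite -mulr_sumr mulrA -expr2 exchange_big/= le_eqVlt; apply/orP; left; apply/eqP.
  by [].
rewrite -(@leeD2rE _ 1%E)//.
apply: (@le_trans _ _ (\esum_(k in [set: nat]) ((- ln tau)%:E * (al k)%:E + (al k)%:E))%E).
  rewrite esumD; last 2 first.
  - by move=> k _; rewrite -EFinM lee_fin mulr_ge0.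
  - by move=> k _; rewrite lee_fin.
  by rewrite esumZl// (sd_sum hT sd) mule1.
(* The tangent inequality at the point [al k], evaluated at [tau] and multiplied by [al k / tau].
   After summation the term [tau^-1 * sum al^2] is at most 1 and cancels the added 1. *)
apply: (@le_trans _ _ (\esum_(k in [set: nat]) ((eta (al k))%:E + tau^-1%:E * (al k ^+ 2)%:E))%E).
  apply: le_esum => k _; rewrite -!EFinM -!EFinD lee_fin.
  have [->|alk] := eqVneq (al k) 0; first by rewrite eta0 expr0n /= !mulr0 addr0.
  have akp : 0 < al k by rewrite lt_def alk al0.
  have := eta_tangent (ltW t0) akp.
  rewrite /eta => h.
  have : al k / tau * (- (tau * ln tau) + tau) <= al k / tau * (tau * - ln (al k) + al k).
    by rewrite ler_wpM2l// divr_ge0 ?(ltW t0)// ltW.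
  rewrite (_ : al k / tau * (- (tau * ln tau) + tau) = - ln tau * al k + al k); last by field;
    rewrite gt_eqF.
  rewrite (_ : al k / tau * (tau * - ln (al k) + al k) = - (al k * ln (al k)) + tau^-1 * al k ^+
    2)//.
  by field; rewrite gt_eqF.
rewrite esumD; last 2 first.
- by move=> k _; rewrite lee_fin (sd_eta_ge0 hT sd).
- by move=> k _; rewrite -EFinM lee_fin mulr_ge0 ?invr_ge0 ?sqr_ge0// ltW.
rewrite leeD2l// esumZl; last 2 first.
- by rewrite invr_ge0 ltW.
- by move=> k; rewrite lee_fin sqr_ge0.
apply: (@le_trans _ _ (tau^-1%:E * tau%:E)%E).
  by rewrite lee_wpmul2l// lee_fin invr_ge0 ltW.
by rewrite -EFinM mulVf ?gt_eqF.
Qed.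

End Mixture.

(** * Mixtures of permutation unitaries *)

Record bijection (X : Type) := Bij {
  bij_fun :> X -> X ; bij_inv : X -> X ;
  bij_funK : cancel bij_fun bij_inv ; bij_invK : cancel bij_inv bij_fun }.

Definition binv X (s : bijection X) : bijection X := Bij (bij_invK s) (bij_funK s).

Section Unitary.
Variables (R : realType) (X : choiceType).
Local Notation C := (R[i]).
Local Notation H := (ell2 R X).
Let ips := @inner_psd R X.

Definition shift (s : bijection X) (u : H) : H := Ell2 (ell2_comp_subproof u (can_inj (bij_funK
  s))).

Lemma shift_linear s : linear (shift s).
Proof. by move=> a u v; exact: ell2_eq. Qed.

Lemma bij_set_bij (s : bijection X) : set_bij [set: X] [set: X] s.
Proof.
split=> // [x y _ _ h|y _]; first exact: (can_inj (bij_funK s)).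
by exists (bij_inv s y); rewrite ?bij_invK.
Qed.

Lemma nrm2_shift s u : nrm2 (shift s u) = nrm2 u.
Proof.
apply/EFin_inj; rewrite !nrm2E [RHS](@reindex_esum _ _ _ _ _ _ _ (bij_set_bij s)).
exact: eq_esum.
Qed.

Lemma inner_polar (u v : H) : inner u v =
  Complex ((nrm2 (u + v) - nrm2 u - nrm2 v) / 2)
          (- ((nrm2 (u + 'i%C *: v) - nrm2 u - nrm2 ('i%C *: v)) / 2)).
Proof.
rewrite !nrm2D (psdZr ips); case: (inner u v) => a b /=.
by congr Complex; field.
Qed.

Lemma inner_shift s u v : inner (shift s u) (shift s v) = inner u v.
Proof.
have D (a b : H) : shift s a + shift s b = shift s (a + b) by rewrite (linear_funD (shift_linear
  s)).
have Z a (b : H) : a *: shift s b = shift s (a *: b) by rewrite (linear_funZ (shift_linear s)).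
by rewrite [LHS]inner_polar [RHS]inner_polar !Z !D !nrm2_shift.
Qed.

Lemma shift_invK s u : shift s (shift (binv s) u) = u.
Proof. by apply: ell2_eq => x /=; rewrite bij_funK. Qed.

Lemma inner_shiftl s u v : inner (shift s u) v = inner u (shift (binv s) v).
Proof. by rewrite -{1}(shift_invK s v) inner_shift. Qed.

Lemma shift_delta s x : shift (binv s) (delta R x) = delta R (s x).
Proof.
apply: ell2_eq => y /=; congr (nat_of_bool _)%:R.
by apply/eqP/eqP => [<-|->]; rewrite ?bij_invK ?bij_funK.
Qed.

Lemma adjoint_unique (T T' : H -> H) : is_adjoint T T' -> adjoint T = T'.
Proof.
move=> h; have h' : is_adjoint T (adjoint T) by apply: xgetPex; exists T'.
apply: boolp.funext => v; apply: inner_nondeg => w.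
by rewrite -(h w v) -(h' w v).
Qed.

Lemma adjoint_shift s : adjoint (shift s) = shift (binv s).
Proof. by apply: adjoint_unique => u v; exact: inner_shiftl. Qed.

Lemma Ad_shift s xi : Ad (shift s) xi = shift s \o xi \o shift (binv s).
Proof. by rewrite /Ad adjoint_shift. Qed.

End Unitary.

Section Channel.
Variables (R : realType) (X : choiceType) (I : finType) (s : I -> bijection X).
Local Notation C := (R[i]).
Local Notation H := (ell2 R X).
Let ips := @inner_psd R X.

Definition chan (xi : H -> H) : H -> H :=
  (#|I|%:R : C)^-1 *: \sum_i Ad (@shift R X (s i)) xi.

Lemma chanE xi w : chan xi w =
  (#|I|%:R^-1 : R)%:C%C *: \sum_i shift (s i) (xi (shift (binv (s i)) w)).
Proof.
rewrite /chan (_ : (#|I|%:R)^-1 = (#|I|%:R^-1 : R)%:C%C); last by rewrite fmorphV rmorph_nat.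
rewrite [LHS](_ : _ = (#|I|%:R^-1 : R)%:C%C *: (\sum_i Ad (@shift R X (s i)) xi) w)//.
rewrite fct_sumE; congr (_ *: _); apply: eq_bigr => i _.
by rewrite Ad_shift.
Qed.

Lemma opform_chan xi v w : opform (chan xi) v w =
  (#|I|%:R^-1 : R)%:C%C * \sum_i opform xi (shift (binv (s i)) v) (shift (binv (s i)) w).
Proof.
rewrite /opform chanE (psdZr ips) (psd_sumr ips); congr (_ * _); apply: eq_bigr => i _.
by rewrite [LHS]inner_conj inner_shiftl -inner_conj.
Qed.

Lemma qf_chan xi w : qf (opform (chan xi)) w =
  #|I|%:R^-1 * \sum_i qf (opform xi) (shift (binv (s i)) w).
Proof. by rewrite /qf opform_chan ReMr Re_sum. Qed.

Hypothesis I0 : (0 < #|I|)%N.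
Let n0 : 0 < #|I|%:R :> R. Proof. by rewrite ltr0n. Qed.

Lemma chan_linear xi : linear xi -> linear (chan xi).
Proof.
move=> xl a v w; rewrite !chanE scalerA [a * _]mulrC -scalerA -scalerDr.
rewrite [a *: bigop _ _ _]scaler_sumr -big_split/=; congr (_ *: _); apply: eq_bigr => i _.
by rewrite shift_linear xl shift_linear.
Qed.

Lemma chan_bnd xi : (exists K : R, forall v, nrm2 (xi v) <= K * nrm2 v) ->
  exists K : R, forall v, nrm2 (chan xi v) <= K * nrm2 v.
Proof.
move=> [K hK]; exists K => w.
rewrite chanE nrm2Z sqn_real.
apply: (@le_trans _ _ (#|I|%:R^-1 ^+ 2 * (#|I|%:R * (#|I|%:R * (K * nrm2 w))))); last first.
  rewrite le_eqVlt; apply/orP; left; apply/eqP; by field; rewrite gt_eqF ?n0.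
rewrite ler_wpM2l ?sqr_ge0// (le_trans (nrm2_sum_le _))// ler_wpM2l ?(ltW n0)//.
rewrite mulr_natl -sumr_const; apply: ler_sum => i _.
by rewrite nrm2_shift (le_trans (hK _))// nrm2_shift.
Qed.

Lemma chan_trace xi : pos_op xi ->
  \esum_(x in [set: X]) (qf (opform (chan xi)) (delta R x))%:E =
  \esum_(x in [set: X]) (qf (opform xi) (delta R x))%:E.
Proof.
move=> hx; have hs := pos_op_psd hx.
under eq_esum => x _ do rewrite qf_chan EFinM -sumEFin.
rewrite esumZl ?invr_ge0 ?(ltW n0)//; last first.
  by move=> x; rewrite sume_ge0// => i _; rewrite lee_fin qf_ge0.
rewrite esum_sum; last by move=> x i _ _; rewrite lee_fin qf_ge0.
rewrite (eq_bigr (fun=> \esum_(x in [set: X]) (qf (opform xi) (delta R x))%:E)); last first.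
  move=> i _; rewrite [RHS](@reindex_esum _ _ _ _ _ _ _ (bij_set_bij (s i))).
  by apply: eq_esum => x _; rewrite shift_delta.
rewrite -[esum _ _]fineK ?ge0_fin_numE ?pos_op_trE//; last first.
  by apply: esum_ge0 => x _; rewrite lee_fin qf_ge0.
rewrite sumEFin sumr_const -EFinM; congr EFin.
by rewrite -[X in _ * X]mulr_natr mulrCA mulVf ?mulr1// gt_eqF.
Qed.

Lemma chan_pos_op xi : pos_op xi -> pos_op (chan xi).
Proof.
move=> hx; have hs := pos_op_psd hx; split.
- exact: chan_linear (pos_op_lin hx).
- exact: chan_bnd (pos_op_bnd hx).
- move=> w; rewrite -/(opform (chan xi) w w) opform_chan.
  apply: mulr_ge0; first by rewrite ler0c invr_ge0 ltW.
  by apply: sumr_ge0 => i _; exact: (psd_ge0 hs).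
- have := pos_op_trE hx; rewrite -chan_trace// => h.
  exists (fine (\esum_(x in [set: X]) (qf (opform (chan xi)) (delta R x))%:E)) => F.
  rewrite -lee_fin fineK; first exact: sum_le_esum.
  rewrite ge0_fin_numE// esum_ge0// => x _; rewrite lee_fin qf_chan mulr_ge0 ?invr_ge0 ?(ltW n0)//.
  by apply: sumr_ge0 => i _; exact: qf_ge0.
Qed.

Lemma chan_dens xi : dens xi -> dens (chan xi).
Proof. by move=> [h1 h2]; split; [exact: chan_pos_op|rewrite chan_trace]. Qed.

Definition pure (v : H) : H -> H := fun w => inner v w *: v.

Lemma pure_dens v : nrm2 v = 1 -> dens (pure v).
Proof.
move=> v1; have -> : pure v = mixop (fun _ : unit => v).
  apply: boolp.funext => w; rewrite /mixop card_unit invr1 scale1r.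
  by rewrite big_const card_unit /= addr0.
by apply: mixop_dens => //; rewrite card_unit.
Qed.

Lemma chan_pure v : chan (pure v) = mixop (fun i => shift (s i) v).
Proof.
apply: boolp.funext => w; rewrite chanE /mixop; congr (_ *: _); apply: eq_bigr => i _.
by rewrite /pure (linear_funZ (shift_linear _)) inner_shiftl.
Qed.

(* The entropy is concave and [xi] is a mixture of its eigenprojections. *)
Lemma entropy_chan_ge (m : R) xi : dens xi -> 0 <= m ->
  (forall v, nrm2 v = 1 -> (m%:E <= entropy (chan (pure v)))%E) ->
  (m%:E <= entropy (chan xi))%E.
Proof.
move=> hx m0 hm; have hr := chan_dens hx.
have [be [v sdx]] := spectral_theorem hx.1.
have [al [e sdr]] := spectral_theorem hr.1.
have be0 := sd_ge0 sdx.
pose q i j := qf (opform (chan (pure (v i)))) (e j).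
have qE i w : qf (opform (chan (pure (v i)))) w = #|I|%:R^-1 * \sum_l sqn (inner (shift (s l) (v
  i)) w).
  by rewrite chan_pure qf_mixop.
have q0 i j : 0 <= q i j.
  by rewrite /q qE mulr_ge0 ?invr_ge0 ?(ltW n0)// sumr_ge0// => l _; exact: sqn_ge0.
have vdens i : be i != 0 -> nrm2 (v i) = 1.
  by case: (sd_nrm sdx i) => -[h1 h2]; [rewrite h2|rewrite h1 eqxx].
have eo := sd_porth sdr.
have qz i j : be i = 0 -> q i j = 0.
  move=> b0; have v0 : v i = 0 by case: (sd_nrm sdx i) => -[h1 h2] //; rewrite b0 ltxx in h1.
  rewrite /q qE big1 ?mulr0// => l _.
  by rewrite v0 (linear_fun0 (shift_linear _)) (psd0l ips) sqn0.
have q1 i : (\esum_(j in [set: nat]) (q i j)%:E <= 1)%E.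
  have [b0|b0] := eqVneq (be i) 0; first by rewrite esum1// => j _; rewrite qz.
  have [h1 h2] := chan_dens (pure_dens (vdens i b0)).
  by rewrite -h2; exact: pos_op_bessel.
have q1' i j : q i j <= 1.
  by rewrite -lee_fin; apply: le_trans (q1 i); exact: (term_le_esum (q i)).
pose Q i := fine (\esum_(j in [set: nat]) (q i j)%:E).
have QE i : \esum_(j in [set: nat]) (q i j)%:E = (Q i)%:E.
  rewrite fineK// ge0_fin_numE; first by apply: le_lt_trans (q1 i) _; exact: ltry.
  by apply: esum_ge0 => j _; rewrite lee_fin.
have Q0 i : 0 <= Q i by rewrite -lee_fin -QE esum_ge0// => j _; rewrite lee_fin.
(* Each output eigenvalue is an average, with the input eigenvalues as weights, of the diagonals of
   the pure outputs; this is where Jensen applies. *)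
have mix j : \esum_(i in [set: nat]) (be i * q i j)%:E = (al j)%:E.
  rewrite -(sd_qf_eigvec sdr) qf_chan EFinM -sumEFin.
  under [in RHS]eq_bigr => l _ do rewrite (sd_qf sdx).
  rewrite -esum_sum; last by move=> i l _ _; rewrite lee_fin mulr_ge0 ?sqn_ge0.
  rewrite -esumZl ?invr_ge0 ?(ltW n0)//; last first.
    by move=> i; rewrite sume_ge0// => l _; rewrite lee_fin mulr_ge0 ?sqn_ge0.
  apply: eq_esum => i _; rewrite sumEFin -EFinM /q qE mulrCA mulr_sumr; congr (_ * _)%:E.
  by apply: eq_bigr => l _; rewrite inner_shiftl.
(* Both sides have total 1: the pure output of every [v i] of positive weight has its whole trace
   along the eigenvectors [e]. *)
have beQ : forall i, be i * Q i = be i.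
  apply: (esum_le_eq (K := 1)) => [i|i||]; first by rewrite mulr_ge0.
  - by rewrite ler_piMr// -lee_fin -QE.
  - rewrite -(sd_sum hr sdr); under [in RHS]eq_esum => j _ do rewrite -mix.
    rewrite esum_swap; last by move=> j i; rewrite lee_fin mulr_ge0.
    apply: eq_esum => i _; under eq_esum => j _ do rewrite EFinM.
    by rewrite esumZl// => [|j]; [rewrite QE -EFinM|rewrite lee_fin].
  - exact: sd_sum hx sdx.
have eq0 i j : 0 <= eta (q i j) by rewrite eta_ge0.
rewrite (entropyE hr sdr).
apply: (@le_trans _ _ (\esum_(j in [set: nat]) \esum_(i in [set: nat]) (be i * eta (q i j))%:E));
  last first.
  apply: le_esum => j _; apply: eta_jensen => //.
  - by move=> i; rewrite q0 q1'.
  - by rewrite (sd_sum hx sdx).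
  - exact: sd_le1 hr sdr _.
rewrite esum_swap; last by move=> j i; rewrite lee_fin mulr_ge0.
apply: (@le_trans _ _ (\esum_(i in [set: nat]) (m * be i)%:E)).
  under eq_esum => i _ do rewrite EFinM.
  by rewrite esumZl// (sd_sum hx sdx) mule1.
apply: le_esum => i _; under eq_esum => j _ do rewrite EFinM.
rewrite esumZl//; last by move=> j; rewrite lee_fin.
rewrite mulrC EFinM.
have [->|b0] := eqVneq (be i) 0; first by rewrite !mul0e.
rewrite lee_wpmul2l ?lee_fin//.
(* The pure output is compared with its diagonal in the eigenvectors of the mixed output, not in its
   own. *)
apply: (le_trans (hm _ (vdens i b0))); apply: entropy_schur => //.
  exact: chan_dens (pure_dens (vdens i b0)).
rewrite QE; congr EFin; apply: (mulfI b0); by rewrite beQ mulr1.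
Qed.

End Channel.

(** * Tensor powers of channels *)

Section TraceNorm.
Variables (R : realType) (X : choiceType).
Local Notation C := (R[i]).
Local Notation H := (ell2 R X).
Let ips := @inner_psd R X.

Lemma op_eq_delta (S T : H -> H) : bounded_op S -> bounded_op T ->
  (forall x, S (delta R x) = T (delta R x)) -> S = T.
Proof.
move=> /bounded_opP[Sl [K hK]] /bounded_opP[Tl [L hL]] h; apply: boolp.funext => v.
have fin F : S (trunc F v) = T (trunc F v).
  rewrite /trunc; elim: (enum_fset F) => [|x r IH].
    by rewrite big_nil (linear_fun0 Sl) (linear_fun0 Tl).
  by rewrite big_cons Sl Tl IH h.
apply/eqP; rewrite -subr_eq0; apply/eqP; apply: nrm2_eq0; apply/eqP.
rewrite eq_le nrm2_ge0 andbT; apply/ler_addgt0Pr => e e0; rewrite add0r.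
pose M := 2 * `|K| + 2 * `|L| + 1.
have M0 : 0 < M by rewrite /M; have := normr_ge0 K; have := normr_ge0 L; lra.
have [F hF] := trunc_approx v (divr_gt0 e0 M0); have {hF} := hF _ (fsubset_refl F).
set w := v - trunc F v => hw.
have vE : v = trunc F v + w by rewrite addrC subrK.
have -> : S v - T v = S w - T w.
  by rewrite vE (linear_funD Sl) (linear_funD Tl) fin opprD addrACA subrr add0r.
apply: (le_trans (nrm2_add_le _ _)).
rewrite -[nrm2 (- _)]qf_inner (qfN ips) qf_inner.
apply: (@le_trans _ _ (M * nrm2 w)); last by rewrite mulrC -ler_pdivlMr// ltW.
have := hK w; have := hL w; have w0 := nrm2_ge0 w => h1 h2.
have := ler_wpM2r w0 (ler_norm K); have := ler_wpM2r w0 (ler_norm L).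
by rewrite /M; lra.
Qed.

Lemma trace_norm_ge0 (T : H -> H) : (0 <= trace_norm T)%E.
Proof.
have z (g : 'I_0 -> H) : orthonormal_sys g by move=> [].
apply: ereal_sup_ubound; exists 0%N, (fun=> 0), (fun=> 0).
by rewrite big_ord0; split; [exact: z|exact: z|].
Qed.

Lemma trace_norm_coef (T : H -> H) x y :
  ((Normc.normc (inner (delta R x) (T (delta R y))))%:E <= trace_norm T)%E.
Proof.
apply: ereal_sup_ubound; exists 1%N, (fun=> delta R y), (fun=> delta R x).
by rewrite big_ord1; split=> // i j; rewrite inner_delta/= eqxx !ord1.
Qed.

Lemma trace_norm_lin (c : C) (S T : H -> H) :
  (trace_norm (c *: S + T)%R <= (Normc.normc c)%:E * trace_norm S + trace_norm T)%E.
Proof.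
apply: ge_ereal_sup => _ [m [e [f [he hf ->]]]].
have hb (A : H -> H) : ((\sum_(i < m) Normc.normc (inner (f i) (A (e i))))%:E <= trace_norm A)%E.
  by apply: ereal_sup_ubound; exists m, e, f.
apply: (@le_trans _ _ ((Normc.normc c)%:E * (\sum_(i < m) Normc.normc (inner (f i) (S (e i))))%:E
   + (\sum_(i < m) Normc.normc (inner (f i) (T (e i))))%:E)%E).
  rewrite -EFinM -EFinD lee_fin mulr_sumr -big_split; apply: ler_sum => i _ /=.
  rewrite -Normc.normcM.
  rewrite [inner _ _](_ : _ = c * inner (f i) (S (e i)) + inner (f i) (T (e i))); first exact:
    le_normcD.
  exact: (inner_linear (f i) c (S (e i)) (T (e i))).
by apply: leeD => //; apply: lee_wpmul2l => //; rewrite lee_fin normc_ge0.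
Qed.

Lemma trace_class_lin (c : C) (S T : H -> H) : trace_class S -> trace_class T ->
  trace_class (c *: S + T).
Proof.
move=> [/bounded_opP[Sl [K hK]] St] [/bounded_opP[Tl [L hL]] Tt]; split.
  apply/bounded_opP; split.
    move=> a u v; rewrite [LHS](_ : _ = c *: S (a *: u + v) + T (a *: u + v))//.
    rewrite [RHS](_ : _ = a *: (c *: S u + T u) + (c *: S v + T v))//.
    by rewrite Sl Tl !scalerDr !scalerA [c * a]mulrC addrACA.
  exists (2 * (sqn c * K) + 2 * L) => v.
  rewrite [X in nrm2 X](_ : _ = c *: S v + T v)//.
  apply: (le_trans (nrm2_add_le _ _)); rewrite nrm2Z.
  have := ler_wpM2l (sqn_ge0 c) (hK v); have := hL v; lra.
apply: (le_lt_trans (trace_norm_lin c S T)).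
have [s0 t0] := (trace_norm_ge0 S, trace_norm_ge0 T).
rewrite lte_add_pinfty// lte_mul_pinfty// lee_fin normc_ge0//.
Qed.

(** The matrix unit [|x><y|]. *)
Definition munit (x y : X) : H -> H := fun w => w y *: delta R x.

Lemma munit_trace_class x y : trace_class (munit x y).
Proof.
split.
  apply/bounded_opP; split.
    by move=> a u v; rewrite /munit ell2DE ell2ZE scalerDl scalerA.
  exists 1 => v; rewrite mul1r /munit nrm2Z nrm2_delta mulr1.
  by have := fset_le_nrm2 v [fset y]%fset; rewrite big_seq_fset1.
apply: (@le_lt_trans _ _ 1%E); last exact: ltry.
apply: ge_ereal_sup => _ [m [e [f [he hf ->]]]].
rewrite lee_fin.
have bes z (g : 'I_m -> H) : orthonormal_sys g -> \sum_i Normc.normc (inner (g i) (delta R z)) ^+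
  2 <= 1.
  move=> hg; rewrite -(nrm2_delta R z).
  exact: (bessel_seq _ (orthonormal_porth hg) (index_enum_uniq _)).
have S0 : 0 <= \sum_(i < m) Normc.normc (inner (f i) (munit x y (e i))).
  by apply: sumr_ge0 => i _; exact: normc_ge0.
suff : (\sum_(i < m) Normc.normc (inner (f i) (munit x y (e i)))) ^+ 2 <= 1 ^+ 2.
  by rewrite ler_sqr ?nnegrE.
rewrite expr1n.
rewrite (eq_bigr (fun i => Normc.normc (inner (f i) (delta R x)) * Normc.normc (inner (e i)
  (delta R y)))).
  rewrite -[leRHS]mulr1; apply: (le_trans (sum_CS _ _ _ _)); apply: ler_pM.
  - by apply: sumr_ge0 => i _; exact: sqr_ge0.
  - by apply: sumr_ge0 => i _; exact: sqr_ge0.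
  - exact: bes.
  - exact: bes.
move=> i _; rewrite /munit (psdZr ips) Normc.normcM mulrC; congr (_ * _).
by rewrite -!sqrt_sqn inner_deltar sqn_conj.
Qed.

Lemma inner_trunc_sym F (u v : H) : inner (trunc F u) v = inner u (trunc F v).
Proof.
rewrite inner_trunc [RHS]inner_conj inner_trunc rmorph_sum/=; apply: eq_bigr => x _.
by rewrite conjcM conjCK mulrC.
Qed.

(** [A] stands both for the coordinate projection onto a finite set and for its complement. *)
Lemma compress_pos_op (T A : H -> H) : pos_op T -> linear A ->
  (forall u v, inner (A u) v = inner u (A v)) -> (forall u, nrm2 (A u) <= nrm2 u) ->
  (forall x, A (delta R x) = delta R x \/ A (delta R x) = 0) ->
  pos_op (A \o T \o A) /\ forall w, qf (opform (A \o T \o A)) w = qf (opform T) (A w).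
Proof.
move=> hT Al Asym Ac Ad; have hs := pos_op_psd hT; have Tl := pos_op_lin hT.
have E u v : opform (A \o T \o A) u v = opform T (A u) (A v) by rewrite /opform /= Asym.
split; last by move=> w; rewrite /qf E.
split.
- by move=> a u v; rewrite /= Al Tl Al.
- have [K hK] := pos_op_bnd hT; exists `|K| => v /=.
  apply: (le_trans (Ac _)); apply: (le_trans (hK _)).
  apply: (@le_trans _ _ (`|K| * nrm2 (A v))); first by rewrite ler_wpM2r ?nrm2_ge0 ?ler_norm.
  by rewrite ler_wpM2l.
- by move=> v; have := psd_ge0 hs (A v); rewrite -E.
- have [K hK] := pos_op_tr hT; exists K => F; apply: le_trans (hK F); apply: ler_sum => x _.
  rewrite -/(opform (A \o T \o A) _ _) E.
  by case: (Ad x) => ->; rewrite -/(opform T _ _) // (psd0r hs); exact: qf_ge0.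
Qed.

(** With [P] the truncation and [Q = 1 - P], [T - P T P = Q T + P T Q]. In each term Cauchy-Schwarz
    pairs a factor of trace at most 1 with the small trace of [Q T Q]. *)
Lemma trunc_trace_norm (T : H -> H) (e : R) : dens T -> 0 < e ->
  exists F : {fset X}, (trace_norm (T - (trunc F \o T \o trunc F))%R <= e%:E)%E.
Proof.
move=> [hT t1] e0; have hs := pos_op_psd hT; have Tl := pos_op_lin hT.
(* Squared because Cauchy-Schwarz takes the root of the tail; halved because there are two terms. *)
have tau0 : 0 < (e / 2) ^+ 2 by rewrite exprn_gt0// divr_gt0.
have [F hF] := diag_tail hT tau0; exists F.
pose P := trunc F : H -> H; pose Q u := u - P u.
have Pl : linear P := @trunc_is_linear _ _ F.
have Ql : linear Q by move=> a u v; rewrite /Q Pl scalerBr opprD addrACA.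
have Psym u v : inner (P u) v = inner u (P v) by exact: inner_trunc_sym.
have Qsym u v : inner (Q u) v = inner u (Q v) by rewrite /Q (psdBl ips) (psdBr ips) Psym.
have Pc u : nrm2 (P u) <= nrm2 u by exact: nrm2_trunc_le.
have Qc u : nrm2 (Q u) <= nrm2 u.
  by rewrite /Q /P nrm2_cotrunc gerBl sumr_ge0// => x _; exact: sqn_ge0.
have Pd x : P (delta R x) = if x \in F then delta R x else 0.
  apply: ell2_eq => y; rewrite /P truncE; case: ifPn => yF; case: ifPn => xF //=.
    by case: eqP yF xF => // -> ->.
  by case: eqP yF xF => // -> /negbTE ->.
have [hP qP] : pos_op (P \o T \o P) /\ forall w, qf (opform (P \o T \o P)) w = qf (opform T) (P w).
  by apply: compress_pos_op => // x; rewrite Pd; case: ifP; [left|right].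
have [hQ qQ] : pos_op (Q \o T \o Q) /\ forall w, qf (opform (Q \o T \o Q)) w = qf (opform T) (Q w).
  by apply: compress_pos_op => // x; rewrite /Q Pd; case: ifP; rewrite ?subrr ?subr0; [right|left].
apply: ge_ereal_sup => _ [m [g [f [hg hf ->]]]].
have b1 (h : 'I_m -> H) : orthonormal_sys h -> \sum_i qf (opform T) (h i) <= 1.
  move=> hh; rewrite -lee_fin -t1; apply: le_trans (pos_op_bessel hT (orthonormal_porth hh)).
  exact: sum_le_esum (index_enum_uniq _).
have bP (h : 'I_m -> H) : orthonormal_sys h -> \sum_i qf (opform T) (P (h i)) <= 1.
  move=> hh; under eq_bigr do rewrite -qP.
  rewrite -lee_fin; apply: le_trans (sum_le_esum _ (index_enum_uniq _)) _.
  apply: (le_trans (pos_op_bessel hP (orthonormal_porth hh))); rewrite -t1.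
  apply: le_esum => x _; rewrite lee_fin qP Pd; case: ifP => // _.
  by rewrite (qf0 hs) qf_ge0.
have bQ (h : 'I_m -> H) : orthonormal_sys h -> \sum_i qf (opform T) (Q (h i)) <= (e / 2) ^+ 2.
  move=> hh; under eq_bigr do rewrite -qQ.
  rewrite -lee_fin; apply: le_trans (sum_le_esum _ (index_enum_uniq _)) _.
  apply: (le_trans (pos_op_bessel hQ (orthonormal_porth hh))).
  apply: esum_le_fset => G; rewrite lee_fin; apply: le_trans (hF (G `\` F)%fset _); last first.
    by apply/fdisjointP => x xF; rewrite inE xF.
  rewrite (big_fsetID _ (mem F))/= big1_fset ?add0r; last first.
    by move=> x; rewrite !inE => /andP[_ xF] _; rewrite qQ /Q Pd xF subrr (qf0 hs).
  rewrite le_eqVlt; apply/orP; left; apply/eqP; rewrite big_seq [RHS]big_seq.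
  apply: congr_big => //; first by congr enum_fset; apply/fsetP => x; rewrite !inE andbC.
    by move=> x; rewrite !inE andbC.
  by move=> x; rewrite !inE => /andP[_ /negbTE xF]; rewrite qQ /Q Pd xF subr0.
have half (a b : 'I_m -> H) (A B : R) : 0 <= A -> 0 <= B -> \sum_i qf (opform T) (a i) <= A ^+ 2 ->
    \sum_i qf (opform T) (b i) <= B ^+ 2 ->
    \sum_i Normc.normc (opform T (a i) (b i)) <= A * B.
  move=> A0 B0 hA hB.
  apply: (@le_trans _ _ (\sum_i Num.sqrt (qf (opform T) (a i)) * Num.sqrt (qf (opform T) (b i)))).
    by apply: ler_sum => i _; exact: (normc_psd_le hs).
  rewrite -ler_sqr ?nnegrE ?mulr_ge0//; last by apply: sumr_ge0 => i _; rewrite mulr_ge0 ?sqrtr_ge0.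
  apply: (le_trans (sum_CS _ _ _ _)); rewrite exprMn.
  under eq_bigr do rewrite sqr_sqrtr ?(qf_ge0 hs)//.
  under [X in _ * X <= _]eq_bigr do rewrite sqr_sqrtr ?(qf_ge0 hs)//.
  by apply: ler_pM => //; apply: sumr_ge0 => i _; exact: qf_ge0.
rewrite lee_fin.
apply: (@le_trans _ _ (\sum_i Normc.normc (opform T (Q (f i)) (g i)) +
                       \sum_i Normc.normc (opform T (P (f i)) (Q (g i))))).
  rewrite -big_split/=; apply: ler_sum => i _.
  have E0 : (T - (trunc F \o T \o trunc F)) (g i) = T (g i) - P (T (P (g i))) by exact: erefl.
  have -> : inner (f i) ((T - (trunc F \o T \o trunc F)) (g i)) =
      opform T (Q (f i)) (g i) + opform T (P (f i)) (Q (g i)).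
    rewrite E0 (psdBr ips) -Psym -/(opform T (f i) (g i)) -/(opform T (P (f i)) (P (g i))).
    by rewrite /Q (psdBl hs) (psdBr hs) addrA subrK.
  exact: le_normcD.
have e20 : 0 <= e / 2 by rewrite divr_ge0// ltW.
have b1' (h : 'I_m -> H) : orthonormal_sys h -> \sum_i qf (opform T) (h i) <= 1 ^+ 2.
  by rewrite expr1n; exact: b1.
have bP' (h : 'I_m -> H) : orthonormal_sys h -> \sum_i qf (opform T) (P (h i)) <= 1 ^+ 2.
  by rewrite expr1n; exact: bP.
have h1 := half (fun i => Q (f i)) g _ _ e20 ler01 (bQ _ hf) (b1' _ hg).
have h2 := half (fun i => P (f i)) (fun i => Q (g i)) _ _ ler01 e20 (bP' _ hf) (bQ _ hg).
apply: (le_trans (lerD h1 h2)); rewrite mulr1 mul1r le_eqVlt; apply/orP; left; apply/eqP.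
by field.
Qed.

End TraceNorm.

Section ChanTraceNorm.
Variables (R : realType) (X : choiceType) (I : finType) (s : I -> bijection X).
Local Notation C := (R[i]).
Local Notation H := (ell2 R X).
Hypothesis I0 : (0 < #|I|)%N.
Let n0 : 0 < #|I|%:R :> R. Proof. by rewrite ltr0n. Qed.

Lemma chan_bounded_op (xi : H -> H) : bounded_op xi -> bounded_op (chan s xi).
Proof.
move=> /bounded_opP[xl xb]; apply/bounded_opP; split; first exact: chan_linear.
exact: chan_bnd.
Qed.

Lemma chan_trace_norm (xi : H -> H) : (trace_norm (chan s xi) <= trace_norm xi)%E.
Proof.
apply: ge_ereal_sup => _ [m [e [f [he hf ->]]]].
have hb i : ((\sum_(l < m) Normc.normc (opform xi (shift (binv (s i)) (f l)) (shift (binv (s i))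
  (e l))))%:E
    <= trace_norm xi)%E.
  apply: ereal_sup_ubound; exists m, (fun l => shift (binv (s i)) (e l)), (fun l => shift (binv
    (s i)) (f l)).
  by split=> // k l; rewrite inner_shift.
have := trace_norm_ge0 xi; move: hb; case: (trace_norm xi) => [r||] // hb r0; last exact: leey.
rewrite lee_fin.
apply: (@le_trans _ _ (#|I|%:R^-1 * \sum_i \sum_(l < m) Normc.normc (opform xi (shift (binv (s
  i)) (f l)) (shift (binv (s i)) (e l))))).
  rewrite exchange_big mulr_sumr; apply: ler_sum => l _ /=.
  rewrite -/(opform (chan s xi) (f l) (e l)) opform_chan Normc.normcM.
  rewrite -[Normc.normc _%:C%C]sqrt_sqn sqn_real sqrtr_sqr ger0_norm ?invr_ge0 ?(ltW n0)//.
  rewrite ler_wpM2l ?invr_ge0 ?(ltW n0)//.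
  elim/big_rec2: _ => [|i y z _ h]; first by rewrite Normc.normc0.
  by apply: (le_trans (le_normcD _ _)); rewrite lerD2l.
rewrite ler_pdivrMl// mulr_natl -sumr_const; apply: ler_sum => i _.
by rewrite -lee_fin.
Qed.

Lemma chan_trace_class (xi : H -> H) : trace_class xi -> trace_class (chan s xi).
Proof.
move=> [xb xt]; split; first exact: chan_bounded_op.
exact: le_lt_trans (chan_trace_norm xi) xt.
Qed.

Lemma chan_lin (c : C) (xi et : H -> H) : chan s (c *: xi + et) = c *: chan s xi + chan s et.
Proof.
apply: boolp.funext => w; rewrite chanE.
rewrite [RHS](_ : _ = c *: chan s xi w + chan s et w)// !chanE.
rewrite scalerA [c * _]mulrC -scalerA -scalerDr; congr (_ *: _).
rewrite [c *: bigop _ _ _]scaler_sumr -big_split/=; apply: eq_bigr => i _.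
rewrite -shift_linear; congr shift; exact: erefl.
Qed.

End ChanTraceNorm.

Section TensorChannel.
Variables (R : realType) (X : choiceType) (I : finType) (s : I -> bijection X) (k : nat).
Local Notation C := (R[i]).
Local Notation H := (ell2 R X).
Local Notation Xk := {ffun 'I_k -> X}.
Local Notation Ik := {ffun 'I_k -> I}.
Local Notation Hk := (ell2 R Xk).
Hypothesis I0 : (0 < #|I|)%N.

Lemma tens_funK (J : Ik) :
  cancel (fun x : Xk => [ffun i => s (J i) (x i)]) (fun x : Xk => [ffun i => bij_inv (s (J i)) (x
    i)]).
Proof. by move=> x; apply/ffunP => i; rewrite !ffunE bij_funK. Qed.

Lemma tens_invK (J : Ik) :
  cancel (fun x : Xk => [ffun i => bij_inv (s (J i)) (x i)]) (fun x : Xk => [ffun i => s (J i) (x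
    i)]).
Proof. by move=> x; apply/ffunP => i; rewrite !ffunE bij_invK. Qed.

Definition btens (J : Ik) : bijection Xk := Bij (@tens_funK J) (@tens_invK J).

Lemma card_Ik_gt0 : (0 < #|Ik|)%N.
Proof. by rewrite card_ffun expn_gt0 I0. Qed.

Lemma shift_btensV (J : Ik) (v : 'I_k -> H) :
  shift (binv (btens J)) (tensor_vec v) = tensor_vec (fun i => shift (binv (s (J i))) (v i)).
Proof. by apply: ell2_eq => x /=; apply: eq_bigr => i _; rewrite ffunE. Qed.

Lemma chan_btens_tensor (xi : 'I_k -> (H -> H)) Xi : is_tensor_op xi Xi ->
  is_tensor_op (fun i => chan s (xi i)) (chan btens Xi).
Proof.
move=> [Xb XE]; split; first exact: chan_bounded_op card_Ik_gt0 _ Xb.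
move=> v; rewrite chanE; apply: ell2_eq => x.
rewrite ell2ZE ell2_sumE card_ffun card_ord.
transitivity (\prod_(i < k) ((#|I|%:R^-1 : R)%:C%C * \sum_l shift (s l) (xi i (shift (binv (s l))
  (v i))) (x i))).
  rewrite big_split/= prodr_const card_ord -rmorphXn natrX exprVn; congr (_ * _).
  (* A product over the factors of sums over [I] is a sum over the index functions [J]. *)
  rewrite bigA_distr_bigA; apply: eq_bigr => J _.
  by rewrite shift_btensV XE /=; apply: eq_bigr => i _; rewrite ffunE.
apply: eq_bigr => i _; rewrite chanE ell2ZE ell2_sumE//.
Qed.

Lemma is_tensor_power_chan : is_tensor_power (k := k) (@chan R X I s) (@chan R _ _ btens).
Proof.
split.
- by move=> xi; apply: chan_trace_class; exact: card_Ik_gt0.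
- by move=> c xi et _ _; exact: chan_lin.
- by exists 1 => xi _; rewrite mul1e; apply: chan_trace_norm; exact: card_Ik_gt0.
- by move=> xi Xi _; exact: chan_btens_tensor.
Qed.

Lemma delta_tensor (x : Xk) : delta R x = tensor_vec (fun i => delta R (x i)).
Proof.
apply: ell2_eq => y /=; have [->|xy] := eqVneq y x; first by rewrite big1// => i _; rewrite eqxx.
have [i xi] : exists i, y i != x i.
  by apply/existsP; rewrite -negb_forall; apply: contra xy => /forallP h; apply/eqP/ffunP => i;
    apply/eqP.
by rewrite (bigD1 i)//= (negbTE xi) mul0r.
Qed.

Lemma tensor_op_unique xi (S T : Hk -> Hk) : is_tensor_op xi S -> is_tensor_op xi T -> S = T.
Proof.
move=> [Sb SE] [Tb TE]; apply: op_eq_delta => // x.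
by rewrite delta_tensor SE TE.
Qed.

Lemma munit_tensor (x y : Xk) :
  is_tensor_op (fun i => @munit R X (x i) (y i)) (munit x y).
Proof.
split; first by case: (munit_trace_class R x y).
move=> v; apply: ell2_eq => z; rewrite /munit ell2ZE delta_tensor /= -big_split.
by apply: eq_bigr => i _.
Qed.

(** Matrix units are elementary tensors, so the defining property fixes [Psi] on them and by
    linearity on truncated operators; trace-norm continuity and [trunc_trace_norm] extend the
    agreement to states. *)
Lemma tensor_power_unique (Psi : (Hk -> Hk) -> (Hk -> Hk)) (xi : Hk -> Hk) :
  is_tensor_power (k := k) (@chan R X I s) Psi -> dens xi -> Psi xi = chan btens xi.
Proof.
move=> [Pt Pl [K hK] Pten] hx.
have tcx : trace_class xi by case/is_stateP: hx.
have Pmu x y : Psi (munit x y) = chan btens (munit x y).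
  apply: (@tensor_op_unique (fun i => chan s (@munit R X (x i) (y i)))).
    by apply: Pten (munit_tensor x y) => i; exact: munit_trace_class.
  exact: chan_btens_tensor (munit_tensor x y).
have tc0 : trace_class (0 : Hk -> Hk).
  split.
    apply/bounded_opP; split; first by move=> a u v; rewrite /= scaler0 addr0.
    by exists 0 => v; rewrite nrm20 mul0r.
  apply: (@le_lt_trans _ _ 0%E) => //; apply: ge_ereal_sup => _ [m [e [f [he hf ->]]]].
  by rewrite lee_fin big1// => i _; rewrite (psd0r (inner_psd _ _)) Normc.normc0.
have P0 : Psi 0 = 0.
  have := Pl 1 0 0 tc0 tc0; rewrite !scale1r addr0 => /eqP.
  by rewrite -subr_eq0 opprD addrA subrr sub0r oppr_eq0 => /eqP.
have C0 : chan btens (0 : Hk -> Hk) = 0.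
  have := chan_lin btens 1 (0 : Hk -> Hk) 0; rewrite !scale1r addr0 => /eqP.
  by rewrite -subr_eq0 opprD addrA subrr sub0r oppr_eq0 => /eqP.
have Psum (r : seq (Xk * Xk)) (c : Xk * Xk -> C) :
    trace_class (\sum_(p <- r) c p *: (munit p.1 p.2 : Hk -> Hk)) /\
    Psi (\sum_(p <- r) c p *: (munit p.1 p.2 : Hk -> Hk)) =
    chan btens (\sum_(p <- r) c p *: (munit p.1 p.2 : Hk -> Hk)).
  elim: r => [|p r [IH1 IH2]]; first by rewrite big_nil P0 C0.
  have tm := munit_trace_class R p.1 p.2.
  rewrite big_cons; split; first exact: trace_class_lin.
  by rewrite Pl// chan_lin IH2 Pmu.
have xl := pos_op_lin hx.1.
have truncS F : trunc F \o xi \o trunc F =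
    \sum_(p <- [seq (x, y) | x <- enum_fset F, y <- enum_fset F]) (xi (delta R p.2)) p.1 *:
      (munit p.1 p.2 : Hk -> Hk).
  apply: boolp.funext => w; apply: ell2_eq => z.
  rewrite fct_sumE ell2_sumE big_allpairs_dep/=.
  have xiT : xi (trunc F w) = \sum_(y <- F) w y *: xi (delta R y).
    rewrite /trunc; elim: (enum_fset F) => [|y r IH]; first by rewrite !big_nil (linear_fun0 xl).
    by rewrite !big_cons xl IH.
  rewrite {1}/trunc ell2_sumE; apply: eq_bigr => x _.
  rewrite [LHS](_ : _ = (xi (trunc F w)) x * delta R x z)// xiT ell2_sumE mulr_suml ell2_sumE.
  apply: eq_bigr => y _.
  rewrite [LHS](_ : _ = w y * (xi (delta R y)) x * delta R x z)//.
  rewrite [RHS](_ : _ = (xi (delta R y)) x * (w y * delta R x z))//.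
  by rewrite mulrCA mulrA.
have bP : bounded_op (Psi xi) by case: (Pt _ tcx).
have bC : bounded_op (chan btens xi) by apply: chan_bounded_op card_Ik_gt0 _ _; case: tcx.
apply: op_eq_delta => // y; apply: ell2_eq => x; rewrite -!(inner_delta x).
apply/eqP; rewrite -subr_eq0; apply/eqP/Normc.eq0_normc/eqP.
rewrite eq_le normc_ge0 andbT; apply/ler_addgt0Pr => e e0; rewrite add0r.
(* The error is weighted by [|K|] through [Psi] and by 1 through the explicit channel. *)
pose M := `|K| + 1.
have M0 : 0 < M by rewrite /M; have := normr_ge0 K; lra.
have [F hF] := trunc_trace_norm hx (divr_gt0 e0 M0).
set D := xi - _ in hF.
have tD : trace_class D.
  rewrite /D -scaleN1r addrC; apply: trace_class_lin => //.
  by rewrite truncS; case: (Psum [seq (x, y) | x <- enum_fset F, y <- enum_fset F] (fun p => xi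
    (delta R p.2) p.1)).
have xiE : xi = 1 *: D + (trunc F \o xi \o trunc F) by rewrite scale1r /D subrK.
have := Psum [seq (x, y) | x <- enum_fset F, y <- enum_fset F] (fun p => xi (delta R p.2) p.1).
rewrite -truncS => -[tT eT].
have -> : inner (delta R x) (Psi xi (delta R y)) - inner (delta R x) (chan btens xi (delta R y)) =
    inner (delta R x) (Psi D (delta R y)) - inner (delta R x) (chan btens D (delta R y)).
  rewrite {1 2}xiE Pl// chan_lin eT !scale1r.
  rewrite [inner _ ((_ + _) _)](psdDr (inner_psd _ _)) [X in _ - X](psdDr (inner_psd _ _)).
  by rewrite opprD addrACA subrr addr0.
apply: (le_trans (le_normcD _ _)); rewrite normcN.
have h1 : Normc.normc (inner (delta R x) (Psi D (delta R y))) <= `|K| * (e / M).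
  rewrite -lee_fin; apply: (le_trans (trace_norm_coef _ _ _)); apply: (le_trans (hK _ tD)).
  apply: (@le_trans _ _ (`|K|%:E * trace_norm D)%E).
    by rewrite lee_wpmul2r ?trace_norm_ge0// lee_fin ler_norm.
  by rewrite EFinM lee_wpmul2l.
have h2 : Normc.normc (inner (delta R x) (chan btens D (delta R y))) <= e / M.
  rewrite -lee_fin; apply: (le_trans (trace_norm_coef _ _ _)).
  exact: le_trans (chan_trace_norm btens card_Ik_gt0 D) hF.
apply: (le_trans (lerD h1 h2)); rewrite le_eqVlt; apply/orP; left; apply/eqP.
by rewrite /M; field; rewrite gt_eqF.
Qed.

Lemma Hmin_tensor_power :
  Hmin (tensor_power (k := k) (@chan R X I s)) = Hmin (@chan R _ _ btens).
Proof.
have h : is_tensor_power (k := k) (@chan R X I s) (tensor_power (k := k) (@chan R X I s)).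
  by apply: xgetPex; exists (@chan R _ _ btens); exact: is_tensor_power_chan.
rewrite /Hmin; congr ereal_inf; apply/seteqP; split => _ [xi hx <-]; exists xi => //;
  by rewrite (tensor_power_unique h)//; exact/is_stateP.
Qed.

End TensorChannel.

(* An identification of [Z] with [X * Y]; it spares transporting [ell2] along
   [X ^ (k + l) = X ^ k * X ^ l]. *)
Record prod_view (Z X Y : Type) := ProdView {
  pv1 : Z -> X ; pv2 : Z -> Y ; pvj : X -> Y -> Z ;
  pvj1 : forall x y, pv1 (pvj x y) = x ;
  pvj2 : forall x y, pv2 (pvj x y) = y ;
  pvjK : forall z, pvj (pv1 z) (pv2 z) = z }.

(** * Product identifications and subadditivity of the output entropy *)

Section ProdViews.
Variables (X : Type) (k l : nat).

Definition ffcat (x : {ffun 'I_k -> X}) (y : {ffun 'I_l -> X}) : {ffun 'I_(k + l) -> X} :=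
  [ffun i => match fintype.split i with inl a => x a | inr b => y b end].

Definition ffleft (z : {ffun 'I_(k + l) -> X}) : {ffun 'I_k -> X} := [ffun i => z (lshift l i)].

Definition ffright (z : {ffun 'I_(k + l) -> X}) : {ffun 'I_l -> X} := [ffun i => z (rshift k i)].

Lemma ffcatl x y : ffleft (ffcat x y) = x.
Proof.
apply/ffunP => i; rewrite !ffunE; case: split_ordP => j /eqP; rewrite ?eq_shift//.
by move=> /eqP ->.
Qed.

Lemma ffcatr x y : ffright (ffcat x y) = y.
Proof.
apply/ffunP => i; rewrite !ffunE; case: split_ordP => j /eqP; rewrite ?eq_shift//.
by move=> /eqP ->.
Qed.

Lemma ffcatK z : ffcat (ffleft z) (ffright z) = z.
Proof. by apply/ffunP => i; rewrite ffunE; case: split_ordP => j ->; rewrite ffunE. Qed.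

Definition split_view := ProdView ffcatl ffcatr ffcatK.

Definition ffcons (x : X) (y : {ffun 'I_k -> X}) : {ffun 'I_k.+1 -> X} :=
  [ffun i => if unlift ord0 i is Some j then y j else x].

Definition ffhead (z : {ffun 'I_k.+1 -> X}) : X := z ord0.

Definition ffbehead (z : {ffun 'I_k.+1 -> X}) : {ffun 'I_k -> X} := [ffun j => z (lift ord0 j)].

Lemma ffcons_head x y : ffhead (ffcons x y) = x.
Proof. by rewrite /ffhead ffunE unlift_none. Qed.

Lemma ffcons_behead x y : ffbehead (ffcons x y) = y.
Proof. by apply/ffunP => j; rewrite !ffunE liftK. Qed.

Lemma ffconsK z : ffcons (ffhead z) (ffbehead z) = z.
Proof. by apply/ffunP => i; rewrite ffunE; case: unliftP => [j ->|-> //]; rewrite ffunE. Qed.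

Definition cons_view := ProdView ffcons_head ffcons_behead ffconsK.

End ProdViews.

Lemma pv_set_bij (Z X Y : Type) (pv : prod_view Z X Y) :
  set_bij [set: X * Y] [set: Z] (fun a => pvj pv a.1 a.2).
Proof.
split=> // [[a b] [c d] _ _ /= h|z _].
  by have := congr1 (pv1 pv) h; have := congr1 (pv2 pv) h; rewrite !pvj1 !pvj2 => -> ->.
by exists (pv1 pv z, pv2 pv z) => //=; rewrite pvjK.
Qed.

Lemma esum_prod (R : realType) (Z X Y : choiceType) (pv : prod_view Z X Y) (f : X -> R) (g : Y ->
  R) (A B : R) :
  (forall x, 0 <= f x) -> (forall y, 0 <= g y) ->
  \esum_(x in [set: X]) (f x)%:E = A%:E -> \esum_(y in [set: Y]) (g y)%:E = B%:E ->
  \esum_(z in [set: Z]) (f (pv1 pv z) * g (pv2 pv z))%:E = (A * B)%:E.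
Proof.
move=> f0 g0 fA gB; rewrite (@reindex_esum _ _ _ _ _ _ _ (pv_set_bij pv)).
transitivity (\esum_(x in [set: X]) \esum_(y in [set: Y]) (f x * g y)%:E).
  rewrite esum_esum; last by move=> x y _ _; rewrite lee_fin mulr_ge0.
  rewrite (_ : _ `*`` _ = setT); last by apply/seteqP; split.
  by apply: eq_esum => a _; rewrite pvj1 pvj2.
have B0 : 0 <= B by rewrite -lee_fin -gB esum_ge0// => y _; rewrite lee_fin.
rewrite (eq_esum (b := fun x => (B%:E * (f x)%:E)%E)); last first.
  move=> x _; under eq_esum => y _ do rewrite EFinM.
  by rewrite esumZl// gB muleC.
by rewrite esumZl// fA -EFinM mulrC.
Qed.

Lemma sum_prod_view (R : realType) (L I J : finType) (pv : prod_view L I J) (f : I -> R) (g : J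
  -> R) :
  \sum_l f (pv1 pv l) * g (pv2 pv l) = (\sum_i f i) * (\sum_j g j).
Proof.
rewrite big_distrlr pair_big/=.
rewrite (reindex (fun a : I * J => pvj pv a.1 a.2)) /=.
  by apply: eq_bigr => a _; rewrite pvj1 pvj2.
exists (fun l => (pv1 pv l, pv2 pv l)) => [[a b] _|l _] /=; by rewrite ?pvjK ?pvj1 ?pvj2.
Qed.

Lemma card_prod_view (L I J : finType) (pv : prod_view L I J) : #|L| = (#|I| * #|J|)%N.
Proof.
rewrite -card_prod; apply: (bij_eq_card (f := fun l => (pv1 pv l, pv2 pv l))).
exists (fun a => pvj pv a.1 a.2) => [l|[a b]] /=; by rewrite ?pvjK ?pvj1 ?pvj2.
Qed.

(** Complex polarization: the diagonal values at [u + v] and [i u + v] determine the form. *)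
Lemma sesqui_polar (R : realType) (V : lmodType R[i]) (B B' : V -> V -> R[i]) :
  (forall u a v w, B u (a *: v + w) = a * B u v + B u w) ->
  (forall u a v w, B (a *: v + w) u = a^* * B v u + B w u) ->
  (forall u a v w, B' u (a *: v + w) = a * B' u v + B' u w) ->
  (forall u a v w, B' (a *: v + w) u = a^* * B' v u + B' w u) ->
  (forall v, B v v = B' v v) -> forall u v, B u v = B' u v.
Proof.
move=> Br Bl Br' Bl' h u v.
have h1 := h (1 *: u + v); have h2 := h ('i%C *: u + v).
move: h1 h2; rewrite !Br !Bl !Br' !Bl' !h conjC1 !mul1r.
move: (B u v) (B v u) (B' u v) (B' v u) (B' u u) (B' v v) => [a1 a2] [b1 b2] [c1 c2] [d1 d2] [p1
  p2] [q1 q2].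
move=> /eqP; rewrite eq_complex/= => /andP[/eqP h1 /eqP h2].
move=> /eqP; rewrite eq_complex/= => /andP[/eqP h3 /eqP h4].
by apply/eqP; rewrite eq_complex/=; apply/andP; split; apply/eqP; lra.
Qed.

Section TensorPair.
Variables (R : realType) (Z X Y : choiceType) (pv : prod_view Z X Y).
Local Notation C := (R[i]).

Lemma tens_subproof (u : ell2 R X) (v : ell2 R Y) :
  (fun z => u (pv1 pv z) * v (pv2 pv z) : C^o) \in @ell2_pred R Z.
Proof.
apply/asboolP.
rewrite (eq_esum (b := fun z => (sqn (u (pv1 pv z)) * sqn (v (pv2 pv z)))%:E)); last first.
  by move=> z _; rewrite -/(sqn _) sqnM.
rewrite (@esum_prod R Z X Y pv (fun x => sqn (u x)) (fun y => sqn (v y)) (nrm2 u) (nrm2 v)) ?ltry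
  ?nrm2E//.
- by move=> x; exact: sqn_ge0.
- by move=> y; exact: sqn_ge0.
Qed.

Definition tens u v : ell2 R Z := Ell2 (tens_subproof u v).

Lemma nrm2_tens u v : nrm2 (tens u v) = nrm2 u * nrm2 v.
Proof.
apply: EFin_inj; rewrite nrm2E.
rewrite (eq_esum (b := fun z => (sqn (u (pv1 pv z)) * sqn (v (pv2 pv z)))%:E)); last first.
  by move=> z _; rewrite /= sqnM.
apply: (@esum_prod R Z X Y pv (fun x => sqn (u x)) (fun y => sqn (v y))); rewrite ?nrm2E// => x;
  exact: sqn_ge0.
Qed.

Lemma tens_linl v : linear (fun u => tens u v).
Proof. by move=> a u u'; apply: ell2_eq => z; rewrite /= mulrDl -mulrA. Qed.

Lemma tens_linr u : linear (fun v => tens u v).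
Proof. by move=> a v v'; apply: ell2_eq => z; rewrite /= mulrDr mulrCA. Qed.

Lemma inner_tens u u' v v' : inner (tens u v) (tens u' v') = inner u u' * inner v v'.
Proof.
have psdl (T : choiceType) : forall (w : ell2 R T) a x y, inner (a *: x + y) w = a^* * inner x w
  + inner y w.
  by move=> w a x y; rewrite (psdDl (@inner_psd R T)) (psdZl (@inner_psd R T)).
have step1 (w : ell2 R Y) : inner (tens u w) (tens u' w) = inner u u' * (nrm2 w)%:C%C.
  apply: (@sesqui_polar _ _ (fun u u' => inner (tens u w) (tens u' w)) (fun u u' => inner u u' *
    (nrm2 w)%:C%C)).
  - by move=> x a y z; rewrite tens_linl inner_linear.
  - by move=> x a y z; rewrite tens_linl psdl.
  - by move=> x a y z; rewrite inner_linear mulrDl mulrA.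
  - by move=> x a y z; rewrite psdl mulrDl mulrA.
  - by move=> x; rewrite !innerE_nrm2 nrm2_tens rmorphM.
apply: (@sesqui_polar _ _ (fun v v' => inner (tens u v) (tens u' v')) (fun v v' => inner u u' *
  inner v v')).
- by move=> x a y z; rewrite tens_linr inner_linear.
- by move=> x a y z; rewrite tens_linr psdl.
- by move=> x a y z; rewrite inner_linear mulrDr mulrCA.
- by move=> x a y z; rewrite psdl mulrDr mulrCA.
- by move=> x; rewrite step1 innerE_nrm2.
Qed.

End TensorPair.

Lemma etaM (R : realType) (a b : R) : 0 <= a -> 0 <= b -> eta (a * b) = eta a * b + a * eta b.
Proof.
rewrite le_eqVlt => /orP[/eqP <-|a0]; first by rewrite !mul0r !eta0 mul0r addr0.
rewrite le_eqVlt => /orP[/eqP <-|b0]; first by rewrite !mulr0 !eta0 mulr0 addr0.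
by rewrite /eta lnM ?posrE//; ring.
Qed.

Section Subadditive.
Variables (R : realType) (Z X Y : choiceType) (pv : prod_view Z X Y).
Variables (L I J : finType) (pl : prod_view L I J).
Variables (s : I -> bijection X) (t : J -> bijection Y) (k : L -> bijection Z).
Hypothesis k1 : forall l z, pv1 pv (k l z) = s (pv1 pl l) (pv1 pv z).
Hypothesis k2 : forall l z, pv2 pv (k l z) = t (pv2 pl l) (pv2 pv z).
Hypothesis I0 : (0 < #|I|)%N.
Hypothesis J0 : (0 < #|J|)%N.
Local Notation C := (R[i]).

Let L0 : (0 < #|L|)%N. Proof. by rewrite (card_prod_view pl) muln_gt0 I0. Qed.

Lemma shift_tens l (u : ell2 R X) (v : ell2 R Y) :
  shift (k l) (tens pv u v) = tens pv (shift (s (pv1 pl l)) u) (shift (t (pv2 pl l)) v).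
Proof. by apply: ell2_eq => z /=; rewrite k1 k2. Qed.

(** Products of eigenvectors of the two outputs form an orthonormal system with diagonal
    [al i * be j], of total 1; [entropy_schur] and the product rule for [eta] finish. *)
Lemma entropy_tens (u : ell2 R X) (v : ell2 R Y) : nrm2 u = 1 -> nrm2 v = 1 ->
  (entropy (chan k (pure (tens pv u v))) <=
   entropy (chan s (pure u)) + entropy (chan t (pure v)))%E.
Proof.
move=> u1 v1.
have hs := chan_dens s I0 (pure_dens u1).
have ht := chan_dens t J0 (pure_dens v1).
have w1 : nrm2 (tens pv u v) = 1 by rewrite nrm2_tens u1 v1 mulr1.
have hk := chan_dens k L0 (pure_dens w1).
have [al [e sds]] := spectral_theorem hs.1.
have [be [f sdt]] := spectral_theorem ht.1.
pose ep (a : nat * nat) : ell2 R Z := tens pv (e a.1) (f a.2).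
have [eo1 eo2] := sd_porth sds; have [fo1 fo2] := sd_porth sdt.
have epo : porth ep.
  split=> [[i j] [i' j'] ij|[i j]]; rewrite /ep /=.
    rewrite inner_tens; have [ii|ii] := eqVneq i i'; last by rewrite eo1// mul0r.
    have [jj|jj] := eqVneq j j'; last by rewrite (fo1 _ _ jj) mulr0.
    by rewrite ii jj eqxx in ij.
  case: (eo2 i) => [n1|->]; last by right; rewrite (linear_fun0 (@tens_linl _ _ _ _ pv _)).
  case: (fo2 j) => [n2|->]; last by right; rewrite (linear_fun0 (@tens_linr _ _ _ _ pv _)).
  by left; rewrite nrm2_tens n1 n2 mulr1.
have qE a : qf (opform (chan k (pure (tens pv u v)))) (ep a) = al a.1 * be a.2.
  rewrite -(sd_qf_eigvec sds) -(sd_qf_eigvec sdt) !chan_pure !qf_mixop.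
  rewrite (card_prod_view pl) natrM invfM mulrACA -(sum_prod_view pl); congr (_ * _).
  by apply: eq_bigr => l _; rewrite shift_tens inner_tens sqnM.
have a0 := sd_ge0 sds; have b0 := sd_ge0 sdt.
pose pn := @ProdView (nat * nat)%type nat nat fst snd pair (fun _ _ => erefl) (fun _ _ => erefl)
  (fun z => let: (a, b) := z in erefl).
have s1 := sd_sum hs sds; have t1 := sd_sum ht sdt.
have := entropy_schur hk epo; under eq_esum => a _ do rewrite qE.
rewrite (esum_prod pn a0 b0 s1 t1) mulr1 => /(_ erefl) h; apply: (le_trans h).
under eq_esum => a _ do rewrite qE etaM// EFinD.
have ea := sd_eta_ge0 hs sds; have eb := sd_eta_ge0 ht sdt.
rewrite esumD; last 2 first.
- by move=> a _; rewrite lee_fin mulr_ge0.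
- by move=> a _; rewrite lee_fin mulr_ge0.
have S0 := entropy_ge0 hs; have T0 := entropy_ge0 ht.
move: (entropyE hs sds) (entropyE ht sdt) S0 T0.
case: (entropy (chan s (pure u))) => [sr||] //; last first.
  by case: (entropy (chan t (pure v))) => [tr||] // _ _ _ _; rewrite leey.
case: (entropy (chan t (pure v))) => [tr||] //; last by move=> _ _ _ _; rewrite leey.
move=> /esym es /esym et _ _.
by rewrite (esum_prod pn ea b0 es t1) (esum_prod pn a0 eb s1 et) mulr1 mul1r.
Qed.

End Subadditive.

(** * Minimum output entropy and its regularization *)

Section HminChannel.
Variables (R : realType) (X : choiceType) (I : finType) (s : I -> bijection X).
Local Notation C := (R[i]).
Hypothesis I0 : (0 < #|I|)%N.
Let n0 : 0 < #|I|%:R :> R. Proof. by rewrite ltr0n. Qed.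
Local Notation HM := (Hmin (@chan R X I s)).

Lemma Hmin_chan_ge (m : R) : 0 <= m ->
  (forall v : ell2 R X, nrm2 v = 1 -> (m%:E <= entropy (chan s (pure v)))%E) -> (m%:E <= HM)%E.
Proof.
move=> m0 hm; apply: le_ereal_inf_tmp => _ [xi /is_stateP hx <-].
exact: entropy_chan_ge.
Qed.

Lemma Hmin_ge0 : (0 <= HM)%E.
Proof. by apply: Hmin_chan_ge => // v v1; exact: entropy_ge0 (chan_dens s I0 (pure_dens v1)). Qed.

Lemma Hmin_le_pure v : nrm2 v = 1 -> (HM <= entropy (chan s (pure v)))%E.
Proof.
move=> v1; apply: ereal_inf_lbound; exists (pure v) => //.
exact/is_stateP/pure_dens.
Qed.

(** Near-minimizers can be taken pure: the contrapositive of [Hmin_chan_ge]. *)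
Lemma Hmin_lt_pure (r : R) : (HM < r%:E)%E ->
  exists2 v, nrm2 v = 1 & (entropy (chan s (pure v)) < r%:E)%E.
Proof.
move=> h; apply: contrapT => /forall2NP hn.
suff : (r%:E <= HM)%E by rewrite leNgt h.
apply: Hmin_chan_ge.
  by rewrite -lee_fin; exact: le_trans Hmin_ge0 (ltW h).
by move=> v v1; case: (hn v) => // /negP; rewrite -leNgt.
Qed.

(* The output on [delta x] is diagonal, with weight [#{j | s_j^-1 x = y} / #|I|] at [y]. *)
Lemma Hmin_le_delta (x : X) :
  (HM <= (#|I|%:R^-1 * \sum_i - ln (#|I|%:R^-1 *
     #|[pred j | bij_inv (s j) x == bij_inv (s i) x]|%:R))%:E)%E.
Proof.
apply: (le_trans (Hmin_le_pure (nrm2_delta R x))).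
have hk := chan_dens s I0 (pure_dens (nrm2_delta R x)).
apply: (le_trans (entropy_schur hk (@delta_porth R X) hk.2)).
pose d y : R := #|I|%:R^-1 * #|[pred j | bij_inv (s j) x == y]|%:R.
have qd y : qf (opform (chan s (pure (delta R x)))) (delta R y) = d y.
  rewrite chan_pure qf_mixop /d; congr (_ * _).
  rewrite -sum1_card natr_sum [RHS]big_mkcond /=; apply: eq_bigr => i _.
  rewrite inner_deltar sqn_conj /=.
  have -> : (s i y == x) = (bij_inv (s i) x == y).
    by apply/eqP/eqP => [<-|<-]; rewrite ?bij_funK ?bij_invK.
  by rewrite unfold_in /=; case: (_ == y); rewrite ?sqn1 ?sqn0.
under eq_esum => y _ do rewrite qd.
apply: esum_le_fset => F; rewrite lee_fin.
have d0 y : 0 <= d y by rewrite mulr_ge0// invr_ge0 ltW.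
have d1 y : d y <= 1 by rewrite -qd; exact: dens_qf_le1 (@delta_porth R X).
(* The weight [d y] is spread over the indices that hit [y], so that the sum over points becomes a
   sum in which each index occurs at most once. *)
have E y : eta (d y) = #|I|%:R^-1 * \sum_(i in [pred j | bij_inv (s j) x == y]) - ln (d (bij_inv
  (s i) x)).
  rewrite (eq_bigr (fun=> - ln (d y))); last by move=> i /eqP ->.
  by rewrite sumr_const -[- ln _ *+ _]mulr_natl /eta -mulrN {1}/d -mulrA.
under eq_bigr do rewrite E.
rewrite -mulr_sumr ler_wpM2l ?invr_ge0 ?(ltW n0)//.
rewrite (exchange_big_dep xpredT)//=; apply: ler_sum => i _.
rewrite big_mkcond /= (eq_bigr (fun y => if bij_inv (s i) x == y then - ln (d (bij_inv (s i) x))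
  else 0))//.
have l0 : 0 <= - ln (d (bij_inv (s i) x)) by rewrite oppr_ge0 ln_le0.
have [iF|iF] := boolP (bij_inv (s i) x \in F); last first.
  by rewrite big_seq big1// => y yF; case: eqP iF => // ->; rewrite yF.
rewrite (big_fsetD1 _ iF)/= eqxx big_seq big1 ?addr0// => y.
by rewrite !inE => /andP[yi _]; rewrite eq_sym (negbTE yi).
Qed.

End HminChannel.

Lemma Hmin_fin (R : realType) (X : choiceType) (I : finType) (s : I -> bijection X) (x : X) :
  (0 < #|I|)%N -> (Hmin (@chan R X I s)) \is a fin_num.
Proof.
move=> I0; rewrite ge0_fin_numE ?Hmin_ge0//.
by apply: le_lt_trans (Hmin_le_delta R s I0 x) _; exact: ltry.
Qed.

Section HminSub.
Variables (R : realType) (Z X Y : choiceType) (pv : prod_view Z X Y).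
Variables (L I J : finType) (pl : prod_view L I J).
Variables (s : I -> bijection X) (t : J -> bijection Y) (k : L -> bijection Z).
Hypothesis k1 : forall l z, pv1 pv (k l z) = s (pv1 pl l) (pv1 pv z).
Hypothesis k2 : forall l z, pv2 pv (k l z) = t (pv2 pl l) (pv2 pv z).
Hypothesis I0 : (0 < #|I|)%N.
Hypothesis J0 : (0 < #|J|)%N.

Lemma Hmin_sub (x : X) (y : Y) :
  (Hmin (@chan R Z L k) <= Hmin (@chan R X I s) + Hmin (@chan R Y J t))%E.
Proof.
have L0 : (0 < #|L|)%N by rewrite (card_prod_view pl) muln_gt0 I0.
have := Hmin_fin R s x I0; have := Hmin_fin R t y J0.
move=> /fineK <- /fineK <-; apply/lee_addgt0Pr => e e0.
have lt (a : R) : (a%:E < (a + e / 2)%:E)%E by rewrite lte_fin ltrDl divr_gt0.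
have [u u1 hu] : exists2 u, nrm2 u = 1 & (entropy (chan s (pure u)) < (fine (Hmin (@chan R X I
  s)) + e / 2)%:E)%E.
  by apply: Hmin_lt_pure => //; rewrite -[ltLHS](fineK (Hmin_fin R s x I0)); exact: lt.
have [v v1 hv] : exists2 v, nrm2 v = 1 & (entropy (chan t (pure v)) < (fine (Hmin (@chan R Y J
  t)) + e / 2)%:E)%E.
  by apply: Hmin_lt_pure => //; rewrite -[ltLHS](fineK (Hmin_fin R t y J0)); exact: lt.
have w1 : nrm2 (tens pv u v) = 1 by rewrite nrm2_tens u1 v1 mulr1.
apply: (le_trans (Hmin_le_pure k w1)).
apply: (le_trans (entropy_tens k1 k2 I0 J0 u1 v1)).
apply: (le_trans (leeD (ltW hu) (ltW hv))).
by rewrite -!EFinD lee_fin; lra.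
Qed.

End HminSub.

(** * Fekete's lemma and the regularized entropy *)

Section Fekete.
Variables (R : realType) (a : nat -> R).
Hypothesis a0 : forall k, 0 <= a k.
Hypothesis aD : forall k l, a (k + l)%N <= a k + a l.

Lemma fekete : exists L, [/\ (fun k => k%:R^-1 * a k) @ \oo --> L,
  (forall k, (0 < k)%N -> L <= k%:R^-1 * a k) &
  (forall c, (forall k, (0 < k)%N -> c <= k%:R^-1 * a k) -> c <= L)].
Proof.
pose S := [set k%:R^-1 * a k | k in [set k | (0 < k)%N]].
have S0 : S !=set0 by exists (1%N%:R^-1 * a 1%N), 1%N.
have Slb : has_lbound S by exists 0 => _ [k k0 <-]; rewrite mulr_ge0 ?invr_ge0.
have hl k : (0 < k)%N -> inf S <= k%:R^-1 * a k by move=> k0; apply: ge_inf => //; exists k.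
exists (inf S); split=> //; last by move=> c hc; apply: lb_le_inf => // _ [k k0 <-]; exact: hc.
apply/cvgrPdist_lt => e e0.
have e20 : 0 < e / 2 by rewrite divr_gt0.
have [_ [m m0 <-] hm] := inf_adherent e20 (conj S0 Slb).
have aq q : a (q * m)%N <= q%:R * a m + a 0%N.
  elim: q => [|q IH]; first by rewrite mul0n mul0r add0r.
  by rewrite mulSn (le_trans (aD _ _))// -natr1 mulrDl mul1r; lra.
(* Bounds every remainder of division by [m] at once; [a 0] enters as the base of the induction on
   the quotient. *)
pose B := a 0%N + \sum_(r < m) a r.
have B0 : 0 <= B by rewrite addr_ge0// sumr_ge0.
have ak k : a k <= (k %/ m)%:R * a m + B.
  rewrite {1}(divn_eq k m) (le_trans (aD _ _))// /B addrA; apply: lerD; first exact: aq.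
  by rewrite (bigD1 (Ordinal (ltn_pmod k m0)))//= lerDl sumr_ge0.
have mp : 0 < m%:R :> R by rewrite ltr0n.
near=> k.
have k0 : (0 < k)%N by near: k; exists 1%N.
have kp : 0 < k%:R :> R by rewrite ltr0n.
rewrite distrC ger0_norm ?subr_ge0 ?hl//.
have hB : B < k%:R * (e / 2).
  rewrite -ltr_pdivrMr//.
  by near: k; exact: nbhs_infty_gtr.
have : k%:R^-1 * a k <= m%:R^-1 * a m + k%:R^-1 * B.
  rewrite -(ler_pM2l kp) mulrA mulfV ?gt_eqF// mul1r (le_trans (ak k))// mulrDr.
  rewrite [X in _ <= _ + X]mulrA mulfV ?gt_eqF// mul1r lerD2r mulrA ler_wpM2r//.
  rewrite ler_pdivlMr// -natrM ler_nat leq_trunc_div//.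
have : k%:R^-1 * B < e / 2 by rewrite ltr_pdivrMl.
by lra.
Unshelve. all: by end_near.
Qed.

End Fekete.

Section HminReg.
Variables (R : realType) (X : choiceType) (x0 : X) (I : finType) (s : I -> bijection X).
Hypothesis I0 : (0 < #|I|)%N.

Definition hreg k : R := fine (Hmin (@chan R _ _ (@btens X I s k))).

Lemma hregE k : Hmin (@chan R _ _ (@btens X I s k)) = (hreg k)%:E.
Proof.
rewrite fineK//; apply: (Hmin_fin R _ [ffun=> x0]).
exact: card_Ik_gt0.
Qed.

Lemma hreg_ge0 k : 0 <= hreg k.
Proof. by rewrite -lee_fin -hregE Hmin_ge0// card_Ik_gt0. Qed.

Lemma hreg_sub k l : hreg (k + l) <= hreg k + hreg l.
Proof.
rewrite -lee_fin EFinD -!hregE.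
apply: (@Hmin_sub R _ _ _ (split_view X k l) _ _ _ (split_view I k l)).
- by move=> J z; apply/ffunP => i; rewrite !ffunE.
- by move=> J z; apply/ffunP => i; rewrite !ffunE.
- exact: card_Ik_gt0.
- exact: card_Ik_gt0.
- exact: [ffun=> x0].
- exact: [ffun=> x0].
Qed.

Lemma hreg_le k : hreg k <= k%:R * fine (Hmin (@chan R X I s)).
Proof.
elim: k => [|k IH].
  (* The zeroth power acts on a one-point space, where the bound at the basis vector is 0. *)
  rewrite mul0r -lee_fin -hregE.
  apply: (le_trans (Hmin_le_delta R _ (card_Ik_gt0 0 I0) [ffun=> x0])).
  rewrite lee_fin card_ffun card_ord expn0 invr1 mul1r big1// => J _.
  rewrite mul1r (eq_card (B := predT)); last first.
    by move=> J'; rewrite !inE; apply/eqP/ffunP => -[].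
  by rewrite card_ffun card_ord expn0 ln1 oppr0.
rewrite -natr1 mulrDl mul1r addrC; apply: (@le_trans _ _ (fine (Hmin (@chan R X I s)) + hreg k));
  last by rewrite lerD2l.
rewrite -lee_fin EFinD -!hregE (fineK (Hmin_fin R s x0 I0)).
apply: (@Hmin_sub R _ _ _ (cons_view X k) _ _ _ (cons_view I k)) => //.
- by move=> J z; rewrite /= /ffhead ffunE.
- by move=> J z; apply/ffunP => i; rewrite !ffunE.
- exact: card_Ik_gt0.
- exact: [ffun=> x0].
Qed.

(** The two bounds are the forms used at the end: from above by one copy, from below by any linear
    bound valid for all powers. *)
Lemma Hmin_reg_chan : exists L : R, [/\ Hmin_reg (@chan R X I s) = L%:E,
  (L%:E <= Hmin (@chan R X I s))%E &
  forall c : R, (forall k, (k%:R * c)%:E <= Hmin (@chan R _ _ (@btens X I s k)))%E -> c <= L].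
Proof.
have [L [cL leL geL]] := fekete hreg_ge0 hreg_sub.
exists L; split.
- apply: cvg_lim => //.
  have -> : (fun k => ((k%:R^-1)%:E * Hmin (tensor_power (k := k) (@chan R X I s)))%E) =
     (fun k => (k%:R^-1 * hreg k)%:E).
    by apply: boolp.funext => k; rewrite Hmin_tensor_power// hregE EFinM.
  by apply: cvg_EFin; [exact: nearW|exact: cL].
(* The first power lives on functions from a one-element type rather than on [X]; [hreg_le] at 1
   bridges the two. *)
- rewrite -(fineK (Hmin_fin R s x0 I0)) lee_fin.
  by have := leL 1%N isT; have := hreg_le 1; rewrite invr1 !mul1r; lra.
- move=> c hc; apply: geL => k k0; rewrite ler_pdivlMl ?ltr0n//.
  by rewrite -lee_fin -hregE.
Qed.

End HminReg.

(** * A tensorizing inequality and the entropy bound it gives *)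

Section FormBound.
Variable R : realType.

(* A Haagerup-type inequality. Nonnegative functions suffice because only the moduli of the
   overlaps of the shifted vectors matter, and nonnegativity makes the bound multiplicative. *)
Definition form_bound (X : choiceType) (I : finType) (s : I -> X -> X) (K : R) : Prop :=
  forall (a : I -> I -> R) (u v : X -> R) (A U V : R),
  (forall i j, 0 <= a i j) -> (forall x, 0 <= u x) -> (forall x, 0 <= v x) ->
  0 <= A -> 0 <= U -> 0 <= V ->
  \sum_i \sum_j a i j ^+ 2 <= A ^+ 2 ->
  (\esum_(x in [set: X]) (u x ^+ 2)%:E <= (U ^+ 2)%:E)%E ->
  (\esum_(x in [set: X]) (v x ^+ 2)%:E <= (V ^+ 2)%:E)%E ->
  forall F : {fset X},
  \sum_(x <- F) \sum_i \sum_j a i j * (u (s i x) * v (s j x)) <= K * (A * (U * V)).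

Lemma form_bound_conj (X : choiceType) (I : finType) (s s' : I -> X -> X) (K : R) (phi :
  bijection X) :
  (forall i x, s' i (phi x) = phi (s i x)) -> form_bound s K -> form_bound s' K.
Proof.
move=> h fb a u v A U V a0 u0 v0 A0 U0 V0 ha hu hv F.
have re (w : X -> R) : \esum_(x in [set: X]) (w (phi x) ^+ 2)%:E = \esum_(x in [set: X]) (w x ^+
  2)%:E.
  by rewrite [RHS](@reindex_esum _ _ _ _ _ _ _ (bij_set_bij phi)).
have := fb a (u \o phi) (v \o phi) A U V a0 _ _ A0 U0 V0 ha _ _ [fset bij_inv phi x | x in F]%fset.
rewrite !re => /(_ (fun=> u0 _) (fun=> v0 _) hu hv).
rewrite big_imfset/=; last by move=> x y _ _ /(can_inj (bij_invK phi)).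
rewrite (eq_bigr (fun x => \sum_i \sum_j a i j * (u (s' i x) * v (s' j x))))// => x _.
by apply: eq_bigr => i _; apply: eq_bigr => j _; rewrite -!h bij_invK.
Qed.

Lemma fset_sum_prod_le (Z X Y : choiceType) (pv : prod_view Z X Y) (F : {fset Z}) (g : Z -> R) :
  (forall z, 0 <= g z) ->
  \sum_(z <- F) g z <=
  \sum_(x <- [fset pv1 pv z | z in F]%fset) \sum_(y <- [fset pv2 pv z | z in F]%fset) g (pvj pv x
    y).
Proof.
move=> g0; set FX := [fset pv1 pv z | z in F]%fset; set FY := [fset pv2 pv z | z in F]%fset.
rewrite -big_allpairs_dep /=.
apply: (@le_trans _ _ (\sum_(z <- [fset z in [seq pvj pv x y | x <- FX, y <- FY]]%fset) g z)).
  apply: sum_fset_le => //; apply/fsubsetP => z zF; rewrite inE; apply/allpairsP.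
  exists (pv1 pv z, pv2 pv z); rewrite /= pvjK; split=> //; apply/imfsetP; by exists z.
rewrite le_eqVlt; apply/orP; left; apply/eqP; apply: perm_big; apply: uniq_perm => [||x] //.
  apply: allpairs_uniq => //; try exact: fset_uniq.
  move=> [a b] [c d] _ _ /= h.
  by have := congr1 (pv1 pv) h; have := congr1 (pv2 pv) h; rewrite !pvj1 !pvj2 => -> ->.
by rewrite inE.
Qed.

Lemma reindex_view (L I J : finType) (pl : prod_view L I J) (f : L -> R) :
  \sum_l f l = \sum_i \sum_j f (pvj pl i j).
Proof.
rewrite pair_big/= (reindex (fun a : I * J => pvj pl a.1 a.2)) //=.
by exists (fun l => (pv1 pl l, pv2 pl l)) => [[a b] _|l _] /=; rewrite ?pvjK ?pvj1 ?pvj2.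
Qed.

(* With nonnegative entries, the bound for the factor [Y] can be applied fibrewise. *)
Lemma form_bound_prod (Z X Y : choiceType) (pv : prod_view Z X Y) (L I J : finType)
  (pl : prod_view L I J) (s : I -> X -> X) (t : J -> Y -> Y) (k : L -> Z -> Z) (K1 K2 : R) :
  (forall l z, pv1 pv (k l z) = s (pv1 pl l) (pv1 pv z)) ->
  (forall l z, pv2 pv (k l z) = t (pv2 pl l) (pv2 pv z)) ->
  0 <= K2 -> form_bound s K1 -> form_bound t K2 -> form_bound k (K2 * K1).
Proof.
move=> k1 k2 K20 fs ft a u v A U V a0 u0 v0 A0 U0 V0 ha hu hv F.
have kE i j x y : k (pvj pl i j) (pvj pv x y) = pvj pv (s i x) (t j y).
  by rewrite -[LHS](pvjK pv) k1 k2 !pvj1 !pvj2.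
apply: le_trans (fset_sum_prod_le pv _ _) _.
  by move=> z; apply: sumr_ge0 => l _; apply: sumr_ge0 => l' _; rewrite !mulr_ge0.
set FX := [fset pv1 pv z | z in F]%fset; set FY := [fset pv2 pv z | z in F]%fset.
(* The second factor is collapsed: [a1] takes the l^2 norm of each block of coefficients and [w1]
   that of each fibre of a function. Total l^2 norms are preserved, so the bound for [s] applies to
   the collapsed data. *)
pose a1 i i' := Num.sqrt (\sum_j \sum_j' a (pvj pl i j) (pvj pl i' j') ^+ 2).
have esumE (w : Z -> R) (W : R) : (\esum_(x in [set: Z]) (w x ^+ 2)%:E <= (W ^+ 2)%:E)%E ->
    (\esum_(x in [set: X]) \esum_(y in [set: Y]) (w (pvj pv x y) ^+ 2)%:E <= (W ^+ 2)%:E)%E.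
  rewrite (@reindex_esum _ _ _ _ _ _ _ (pv_set_bij pv)) esum_esum; last first.
    by move=> x y _ _; rewrite lee_fin sqr_ge0.
  by rewrite (_ : _ `*`` _ = setT)//; apply/seteqP; split.
pose w1 (w : Z -> R) x := Num.sqrt (fine (\esum_(y in [set: Y]) (w (pvj pv x y) ^+ 2)%:E)).
have w1E (w : Z -> R) (W : R) x : (\esum_(x in [set: Z]) (w x ^+ 2)%:E <= (W ^+ 2)%:E)%E ->
    ((w1 w x) ^+ 2)%:E = \esum_(y in [set: Y]) (w (pvj pv x y) ^+ 2)%:E.
  move=> hw; have e0 : (0 <= \esum_(y in [set: Y]) (w (pvj pv x y) ^+ 2)%:E)%E.
    by apply: esum_ge0 => y _; rewrite lee_fin sqr_ge0.
  rewrite sqr_sqrtr ?fine_ge0// fineK// ge0_fin_numE//.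
  apply: le_lt_trans (ltry (W ^+ 2)); apply: le_trans (esumE _ _ hw).
  apply: ereal_sup_ubound; exists [set x]; last by rewrite fsbig_set1.
  by split; [exact: finite_set1|exact: subsetT].
have w1b (w : Z -> R) (W : R) : (\esum_(x in [set: Z]) (w x ^+ 2)%:E <= (W ^+ 2)%:E)%E ->
    (\esum_(x in [set: X]) (w1 w x ^+ 2)%:E <= (W ^+ 2)%:E)%E.
  move=> hw; apply: le_trans (esumE _ _ hw); apply: le_esum => x _.
  by rewrite (w1E _ _ _ hw).
have := fs a1 (w1 u) (w1 v) A U V _ _ _ A0 U0 V0 _ (w1b _ _ hu) (w1b _ _ hv) FX.
move=> /(_ (fun _ _ => sqrtr_ge0 _) (fun=> sqrtr_ge0 _) (fun=> sqrtr_ge0 _)) fs1.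
have {}fs1 : \sum_(x <- FX) \sum_i \sum_j a1 i j * (w1 u (s i x) * w1 v (s j x)) <= K1 * (A * (U
  * V)).
  apply: fs1; apply: le_trans ha; rewrite (reindex_view pl) le_eqVlt; apply/orP; left; apply/eqP.
  apply: eq_bigr => i _; rewrite exchange_big /= (reindex_view pl); apply: eq_bigr => i' _.
  rewrite sqr_sqrtr; last by apply: sumr_ge0 => j _; apply: sumr_ge0 => j' _; exact: sqr_ge0.
  by rewrite exchange_big.
rewrite -mulrA; apply: le_trans (ler_wpM2l K20 fs1).
rewrite mulr_sumr; apply: ler_sum => x _.
rewrite mulr_sumr (eq_bigr (fun y => \sum_i \sum_i' \sum_j \sum_j' a (pvj pl i j) (pvj pl i' j') *
    (u (pvj pv (s i x) (t j y)) * v (pvj pv (s i' x) (t j' y))))); last first.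
  move=> y _; rewrite (reindex_view pl); apply: eq_bigr => i _.
  rewrite exchange_big (reindex_view pl); apply: eq_bigr => i' _; rewrite exchange_big.
  by apply: eq_bigr => j _; apply: eq_bigr => j' _; rewrite !kE.
rewrite exchange_big; apply: ler_sum => i _; rewrite mulr_sumr exchange_big; apply: ler_sum => i'
  _ /=.
(* For fixed [x], [i], [i'] the sum over the second factor is one instance of the bound for [t],
   with exactly the collapsed norms on the right. *)
apply: (ft (fun j j' => a (pvj pl i j) (pvj pl i' j')) (fun y => u (pvj pv (s i x) y))
  (fun y => v (pvj pv (s i' x) y)) (a1 i i')) => //; try exact: sqrtr_ge0.
- by rewrite sqr_sqrtr// sumr_ge0// => j _; apply: sumr_ge0 => j' _; exact: sqr_ge0.
- by rewrite (w1E _ _ _ hu).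
- by rewrite (w1E _ _ _ hv).
Qed.

Lemma form_bound_btens (X : choiceType) (I : finType) (s : I -> bijection X) (K : R) (k : nat) :
  0 <= K -> form_bound s K -> form_bound (@btens X I s k) (K ^+ k).
Proof.
move=> K0 fb; elim: k => [|k IH]; last first.
  rewrite exprSr.
  apply: (@form_bound_prod _ _ _ (cons_view X k) _ _ _ (cons_view I k) _ _ _ _ _ _ _ _ fb IH).
  - by move=> J z; rewrite /= /ffhead ffunE.
  - by move=> J z; apply/ffunP => i; rewrite !ffunE.
  - by rewrite exprn_ge0.
move=> a u v A U V a0 u0 v0 A0 U0 V0 ha hu hv F.
have sub (T : Type) (x y : {ffun 'I_0 -> T}) : x = y by apply/ffunP => -[].
rewrite expr0 mul1r.
case: (fset_0Vmem F) => [->|[x xF]].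
  by rewrite big_seq_fset0 !mulr_ge0.
have -> : F = [fset x]%fset by apply/fsetP => y; rewrite inE (sub _ y x) xF eqxx.
rewrite big_seq_fset1.
pose J : {ffun 'I_0 -> I} := ffun0 (card_ord 0).
have P1 : (xpredT : pred {ffun 'I_0 -> I}) =1 pred1 J by move=> J'; rewrite /= (sub _ J' J) eqxx.
have sqle (p q : R) : 0 <= p -> 0 <= q -> p ^+ 2 <= q ^+ 2 -> p <= q.
  by move=> p0 q0; rewrite ler_sqr ?nnegrE.
have aA : a J J <= A by apply: sqle => //; move: ha; rewrite !(big_pred1 J).
rewrite !(big_pred1 J) // (sub _ (btens s J x) x).
have uU : u x <= U.
  by apply: sqle => //; rewrite -lee_fin; apply: le_trans hu; exact: (term_le_esum (fun x => u x
    ^+ 2)).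
have vV : v x <= V.
  by apply: sqle => //; rewrite -lee_fin; apply: le_trans hv; exact: (term_le_esum (fun x => v x
    ^+ 2)).
by apply: ler_pM => //; [rewrite mulr_ge0|apply: ler_pM].
Qed.

Lemma normc_inner_le (X : choiceType) (u v : ell2 R X) :
  ((Normc.normc (inner u v))%:E <= \esum_(x in [set: X]) (Normc.normc (u x) * Normc.normc (v
    x))%:E)%E.
Proof.
apply/lee_addgt0Pr => e e0.
pose d := (e / (Num.sqrt (nrm2 v) + 1)) ^+ 2.
have s0 := sqrtr_ge0 (nrm2 v).
have d0 : 0 < d by rewrite exprn_gt0// divr_gt0//; lra.
have [F hF] := trunc_approx u d0; have {hF} := hF _ (fsubset_refl F).
set w := u - trunc F u => hw.
have -> : inner u v = inner (trunc F u) v + inner w v.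
  by rewrite -(psdDl (inner_psd R X)) addrC subrK.
apply: (@le_trans _ _ ((\sum_(x <- F) Normc.normc (u x) * Normc.normc (v x))%:E + e%:E)%E); last
  first.
  by apply: leeD => //; exact: (sum_le_esum (fun x => Normc.normc (u x) * Normc.normc (v x))).
rewrite -EFinD lee_fin; apply: (le_trans (le_normcD _ _)); apply: lerD.
  rewrite inner_trunc; elim: (enum_fset F) => [|x r IH]; first by rewrite !big_nil Normc.normc0.
  rewrite !big_cons; apply: (le_trans (le_normcD _ _)); apply: lerD => //.
  by rewrite Normc.normcM -[Normc.normc (u x)^*]sqrt_sqn sqn_conj sqrt_sqn.
apply: (le_trans (normc_psd_le (inner_psd R X) _ _)); rewrite !qf_inner.
have : Num.sqrt (nrm2 w) <= e / (Num.sqrt (nrm2 v) + 1).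
  rewrite -[leRHS]ger0_norm; last by rewrite divr_ge0 ?(ltW e0)//; lra.
  by rewrite -sqrtr_sqr ler_wsqrtr// ltW.
rewrite ler_pdivlMr; last lra.
by have := sqrtr_ge0 (nrm2 w); nra.
Qed.

(** The coefficients are chosen to be the moduli of the overlaps themselves: their square sum [S]
    then satisfies [S <= K sqrt S]. *)
Lemma form_bound_gram (X : choiceType) (I : finType) (s : I -> bijection X) (K : R) (u : ell2 R X) :
  0 <= K -> form_bound s K -> nrm2 u = 1 ->
  \sum_i \sum_j sqn (inner (shift (s i) u) (shift (s j) u)) <= K ^+ 2.
Proof.
move=> K0 fb u1; pose b i j := Normc.normc (inner (shift (s i) u) (shift (s j) u)).
pose S := \sum_i \sum_j b i j ^+ 2.
have S0 : 0 <= S by apply: sumr_ge0 => i _; apply: sumr_ge0 => j _; exact: sqr_ge0.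
rewrite -/S.
have nu : (\esum_(x in [set: X]) (Normc.normc (u x) ^+ 2)%:E <= (1 ^+ 2)%:E)%E.
  by rewrite -(nrm2E u) u1 expr1n.
have b0 i j : 0 <= b i j by exact: normc_ge0.
have key := fb b (fun x => Normc.normc (u x)) (fun x => Normc.normc (u x)) (Num.sqrt S) 1 1
  b0 (fun=> normc_ge0 _) (fun=> normc_ge0 _) (sqrtr_ge0 _) ler01 ler01 _ nu nu.
have SS : S <= Num.sqrt S ^+ 2 by rewrite sqr_sqrtr.
have : S <= K * Num.sqrt S.
  rewrite -lee_fin.
  have hE : (\esum_(x in [set: X]) (\sum_i \sum_j b i j * (Normc.normc (u (s i x)) * Normc.normc
    (u (s j x))))%:E <=
      (K * Num.sqrt S)%:E)%E.
    by apply: esum_le_fset => F; have := key SS F; rewrite lee_fin !mulr1.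
  apply: le_trans hE.
  rewrite (eq_esum (b := fun x => (\sum_i \sum_j (b i j * (Normc.normc (u (s i x)) * Normc.normc
    (u (s j x))))%:E)%E)); last first.
    by move=> x _; rewrite -sumEFin; apply: eq_bigr => i _; rewrite sumEFin.
  have nn i j x : (0 <= (b i j * (Normc.normc (u (s i x)) * Normc.normc (u (s j x))))%:E)%E.
    by rewrite lee_fin mulr_ge0// mulr_ge0 ?normc_ge0.
  rewrite esum_sum; last by move=> x i _ _; apply: sume_ge0.
  rewrite /S -sumEFin; apply: lee_sum => i _.
  rewrite esum_sum; last by move=> x j _ _.
  rewrite -sumEFin; apply: lee_sum => j _.
  under eq_esum => x _ do rewrite EFinM.
  rewrite esumZl//; last by move=> x; rewrite lee_fin mulr_ge0 ?normc_ge0.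
  by rewrite expr2 EFinM lee_wpmul2l ?lee_fin//; exact: normc_inner_le.
rewrite -{1}[S]sqr_sqrtr// expr2 => h.
have [z|z] := eqVneq (Num.sqrt S) 0.
  by rewrite -[S]sqr_sqrtr// z expr0n/= sqr_ge0.
have zp : 0 < Num.sqrt S by rewrite lt_def z sqrtr_ge0.
by rewrite -[S]sqr_sqrtr// ler_sqr ?nnegrE ?(ltW zp)// -(ler_pM2r zp).
Qed.

(** The Gram sum of the power is at most [K^(2k)] out of [|I|^(2k)]; [K <= |I|] keeps this ratio at
    most 1, as the collision bound requires. *)
Lemma Hmin_btens_ge (X : choiceType) (I : finType) (s : I -> bijection X) (K : R) (k : nat) :
  0 < K -> K <= #|I|%:R -> form_bound s K ->
  ((k%:R * - ln ((K / #|I|%:R) ^+ 2))%:E <= Hmin (@chan R _ _ (@btens X I s k)))%E.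
Proof.
move=> K0 Kn fb.
have np : 0 < #|I|%:R :> R by exact: lt_le_trans Kn.
have I0 : (0 < #|I|)%N by rewrite -(ltr0n R).
have r0 : 0 < (K / #|I|%:R) ^+ 2 by rewrite exprn_gt0// divr_gt0.
have r1 : (K / #|I|%:R) ^+ 2 <= 1.
  by rewrite -[leRHS](expr1n _ 2) ler_sqr ?nnegrE ?divr_ge0 ?(ltW K0) ?(ltW np)// ler_pdivrMr//
    mul1r.
have Ik0 := card_Ik_gt0 k I0.
apply: Hmin_chan_ge => //; first by rewrite mulr_ge0// oppr_ge0 ln_le0.
move=> v v1; rewrite chan_pure.
have -> : k%:R * - ln ((K / #|I|%:R) ^+ 2) = - ln (((K / #|I|%:R) ^+ 2) ^+ k).
  by rewrite [in RHS](lnXn _ r0) mulrN mulr_natl.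
apply: entropy_mixop_ge => //.
- by move=> J; rewrite nrm2_shift.
- by rewrite exprn_gt0//= exprn_ile1// ltW.
have := form_bound_gram (exprn_ge0 k (ltW K0)) (form_bound_btens (k := k) (ltW K0) fb) v1.
move=> h; apply: (le_trans (ler_wpM2l (sqr_ge0 _) h)).
by rewrite card_ffun card_ord natrX -exprVn -!exprMn mulrC exprAC.
Qed.

End FormBound.

(** * Free products *)

Lemma bij_eq (X : Type) (s t : bijection X) : (forall x, s x = t x) -> s = t.
Proof.
case: s t => f f' fK f'K [g g' gK g'K] /= h.
have {h} e : f = g by exact: boolp.funext.
subst g; have e : f' = g'.
  by apply: boolp.funext => x; rewrite -{1}(g'K x) fK.
by subst g'; congr Bij; exact: boolp.Prop_irrelevance.
Qed.

Section BijGroup.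
Variable X : Type.

HB.instance Definition _ := gen_eqMixin (bijection X).
HB.instance Definition _ := gen_choiceMixin (bijection X).

Definition bij_id : bijection X := @Bij X id id (fun x => erefl) (fun x => erefl).

Definition bij_comp (s t : bijection X) : bijection X :=
  Bij (can_comp (bij_funK s) (bij_funK t)) (can_comp (bij_invK t) (bij_invK s)).

Lemma bij_compA : associative bij_comp. Proof. by move=> s t u; exact: bij_eq. Qed.
Lemma bij_comp1s : left_id bij_id bij_comp. Proof. by move=> s; exact: bij_eq. Qed.
Lemma bij_comps1 : right_id bij_id bij_comp. Proof. by move=> s; exact: bij_eq. Qed.
Lemma bij_compVs : left_inverse bij_id (@binv X) bij_comp.
Proof. by move=> s; apply: bij_eq => x /=; rewrite bij_funK. Qed.
Lemma bij_compsV : right_inverse bij_id (@binv X) bij_comp.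
Proof. by move=> s; apply: bij_eq => x /=; rewrite bij_invK. Qed.

HB.instance Definition _ := isGroup.Build (bijection X)
  bij_compA bij_comp1s bij_comps1 bij_compVs bij_compsV.

End BijGroup.

Section ReducedWords.
Variables (I : eqType) (G : I -> groupType).
Local Notation letter := {i : I & G i}.

Definition starts (i : I) (w : seq letter) : bool := if w is t :: _ then tag t == i else false.

Fixpoint reduced (w : seq letter) : bool :=
  if w is t :: w' then [&& tagged t != 1%g, ~~ starts (tag t) w' & reduced w'] else true.

Definition whead i (w : seq letter) : G i :=
  if w is t :: _ then tagged_as (Tagged G (1%g : G i)) t else 1%g.

Definition wtail i (w : seq letter) : seq letter := if starts i w then behead w else w.

Definition wcons i (x : G i) (w : seq letter) : seq letter :=
  if x == 1%g then w else Tagged G x :: w.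

(** Van der Waerden's action. A word is split into its [G i] part, taken to be 1 when the first
    letter has another tag, and a tail not starting in [G i]; multiplication touches the first part
    only, so cancellation needs no case analysis. *)
Definition wact i (x : G i) (w : seq letter) : seq letter := wcons (x * whead i w)%g (wtail i w).

Lemma reduced_wtail i w : reduced w -> reduced (wtail i w).
Proof. by rewrite /wtail; case: ifP => //; case: w => //= t w _ /and3P[]. Qed.

Lemma starts_wtail i w : reduced w -> ~~ starts i (wtail i w).
Proof.
rewrite /wtail; case: ifPn => //; case: w => //= t w /eqP <-.
by case/and3P.
Qed.

Lemma reduced_wcons i (x : G i) w : reduced w -> ~~ starts i w -> reduced (wcons x w).
Proof. by rewrite /wcons; case: ifPn => // x1 rw sw /=; rewrite x1 sw. Qed.

Lemma whead_starts i w : ~~ starts i w -> whead i w = 1%g.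
Proof.
case: w => //= -[j y] w /= ij; rewrite /tagged_as /=.
by case: eqP => // e; rewrite e eqxx in ij.
Qed.

Lemma whead_wcons i (x : G i) w : ~~ starts i w -> whead i (wcons x w) = x.
Proof.
rewrite /wcons; case: eqP => [-> /whead_starts //|_ _].
by rewrite /whead /tagged_as /=; case: eqP => // e; rewrite [e]eq_axiomK.
Qed.

Lemma wtail_wcons i (x : G i) w : ~~ starts i w -> wtail i (wcons x w) = w.
Proof. by rewrite /wcons /wtail; case: (x == 1%g) => /= /negbTE h; rewrite ?h ?eqxx. Qed.

Lemma wcons_whead i w : reduced w -> wcons (whead i w) (wtail i w) = w.
Proof.
move=> rw; have [|h] := boolP (starts i w); last first.
  by rewrite whead_starts// /wcons eqxx /wtail (negbTE h).
case: w rw => // -[j y] w /and3P[/= y1 _ _] /eqP /= ij; subst j.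
have hy : whead i (existT (fun i => G i) i y :: w) = y.
  by rewrite /whead /tagged_as /=; case: eqP => // e; rewrite [e]eq_axiomK.
move: hy; rewrite /whead => ->; by rewrite /wcons (negbTE y1) /wtail /= eqxx.
Qed.

Lemma reduced_wact i (x : G i) w : reduced w -> reduced (wact x w).
Proof. by move=> rw; apply: reduced_wcons; [exact: reduced_wtail|exact: starts_wtail]. Qed.

Lemma wactM i (x y : G i) w : reduced w -> wact (x * y)%g w = wact x (wact y w).
Proof.
move=> rw; have h := starts_wtail i rw.
by rewrite /wact whead_wcons// wtail_wcons// mulgA.
Qed.

Lemma wact1 i w : reduced w -> wact (1%g : G i) w = w.
Proof. by move=> rw; rewrite /wact mul1g wcons_whead. Qed.

Definition rword := {w : seq letter | reduced w}.

Definition ract i (x : G i) (w : rword) : rword := exist _ (wact x (sval w)) (reduced_wact x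
  (svalP w)).

Lemma rword_eq (v w : rword) : sval v = sval w -> v = w.
Proof. by case: v w => v hv [w hw] /= e; subst w; congr exist; exact: boolp.Prop_irrelevance. Qed.

Lemma rwordP (w : rword) : reduced (sval w). Proof. by case: w. Qed.

Lemma ractK i (x : G i) : cancel (ract x) (ract x^-1%g).
Proof. by move=> w; apply: rword_eq => /=; rewrite -(wactM _ _ (rwordP w)) mulVg (wact1 _ (rwordP
  w)). Qed.

Lemma ractVK i (x : G i) : cancel (ract x^-1%g) (ract x).
Proof. by move=> w; apply: rword_eq => /=; rewrite -(wactM _ _ (rwordP w)) mulgV (wact1 _ (rwordP
  w)). Qed.

Definition bact i (x : G i) : bijection rword := Bij (ractK x) (ractVK x).

Lemma bactM i : {morph @bact i : x y / (x * y)%g >-> (x * y)%g}.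
Proof. by move=> x y; apply: bij_eq => w; apply: rword_eq => /=; rewrite (wactM _ _ (rwordP w)).
  Qed.

HB.instance Definition _ i := isMultiplicative.Build (G i) (bijection rword) (@bact i) (@bactM i).

End ReducedWords.

(* Ping-pong: [L i y] says that the reduced word of [y] begins with a letter of [G i]. *)
Lemma free_product_pingpong (I : eqType) (G : I -> groupType) (P : groupType)
    (iota : forall i, {multiplicative G i -> P}) : is_free_product iota ->
  exists L : I -> P -> bool,
  [/\ forall i j y, L i y -> L j y -> i = j,
      forall i (x : G i) y, x != 1%g -> ~~ L i y -> L i (iota i x * y)%g &
      forall i, ~~ L i 1%g].
Proof.
(* The universal property extends the actions on reduced words to [P]; applying [h y] to the empty
   word gives the reduced word of [y]. *)
move=> hP; have [h [hE _]] := hP _ (fun i => @bact I G i : {multiplicative G i -> bijection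
  (rword G)}).
pose nilw : rword G := exist _ [::] isT.
exists (fun i y => starts i (sval (h y nilw))); split.
- by move=> i j y; case: (sval (h y nilw)) => //= t w /eqP <- /eqP.
- move=> i x y x1 sy; rewrite gmulfM hE /=.
  by rewrite /wact whead_starts// mulg1 /wtail (negbTE sy) /wcons (negbTE x1) /= eqxx.
- move=> i; have -> : h 1%g = 1%g; last by [].
  by apply: (@mulgI _ (h 1%g)); rewrite -gmulfM !mulg1.
Qed.

(** * Ping-pong estimate *)

Section CauchySchwarz.
Variables (R : realType) (T : finType) (Y : Type).
Implicit Types (F : seq Y) (al be : T -> Y -> R).

Lemma le_of_sqr (p q : R) : 0 <= q -> p ^+ 2 <= q ^+ 2 -> p <= q.
Proof.
move=> q0 h; have [p0|/ltW p0] := leP 0 p; last exact: le_trans p0 q0.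
by rewrite -ler_sqr ?nnegrE.
Qed.

Lemma sum_CS_le (J : Type) (r : seq J) (P : pred J) (x y : J -> R) (p q : R) : 0 <= p -> 0 <= q ->
  \sum_(i <- r | P i) x i ^+ 2 <= p ^+ 2 -> \sum_(i <- r | P i) y i ^+ 2 <= q ^+ 2 ->
  \sum_(i <- r | P i) x i * y i <= p * q.
Proof.
move=> p0 q0 hx hy; apply: le_of_sqr; first exact: mulr_ge0.
rewrite exprMn; apply: (le_trans (sum_CS _ _ _ _)).
by apply: ler_pM => //; apply: sumr_ge0 => i _; exact: sqr_ge0.
Qed.

(** Cauchy-Schwarz over the pairs [(t, t')], then over [y] for each pair. *)
Lemma CS_matrix F (a : T -> T -> R) al be (B p q : R) : 0 <= B -> 0 <= p -> 0 <= q ->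
  \sum_t \sum_t' a t t' ^+ 2 <= B ^+ 2 ->
  \sum_(y <- F) \sum_t al t y ^+ 2 <= p ^+ 2 ->
  \sum_(y <- F) \sum_t be t y ^+ 2 <= q ^+ 2 ->
  \sum_(y <- F) \sum_t \sum_t' a t t' * (al t y * be t' y) <= B * (p * q).
Proof.
move=> B0 p0 q0 hB hp hq.
have -> : \sum_(y <- F) \sum_t \sum_t' a t t' * (al t y * be t' y) =
    \sum_(w : T * T) a w.1 w.2 * (\sum_(y <- F) al w.1 y * be w.2 y).
  rewrite exchange_big (eq_bigr (fun t => \sum_t' a t t' * \sum_(y <- F) al t y * be t' y)).
    by rewrite pair_big.
  move=> t _; rewrite exchange_big; apply: eq_bigr => t' _.
  by rewrite mulr_sumr.
apply: sum_CS_le => //; [exact: mulr_ge0|by rewrite -(pair_big predT predT (fun t t' => a t t' ^+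
  2))|].
apply: (@le_trans _ _ (\sum_(w : T * T) (\sum_(y <- F) al w.1 y ^+ 2) * (\sum_(y <- F) be w.2 y
  ^+ 2))).
  by apply: ler_sum => w _; exact: sum_CS.
rewrite -(pair_big predT predT (fun t t' => (\sum_(y <- F) al t y ^+ 2) * (\sum_(y <- F) be t' y
  ^+ 2)))/=.
under eq_bigr do rewrite -mulr_sumr.
rewrite -mulr_suml exprMn [X in X * _]exchange_big [X in _ * X]exchange_big /=.
by apply: ler_pM => //; apply: sumr_ge0 => y _; apply: sumr_ge0 => t _; exact: sqr_ge0.
Qed.

(** Block version: [al] is controlled only uniformly in each block, while the coefficients and [be]
    are square summable across blocks. *)
Lemma CS_blocks (I : finType) F (a : I -> T -> T -> R) (al be : I -> T -> Y -> R) (B p q : R) :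
  0 <= B -> 0 <= p -> 0 <= q ->
  \sum_i \sum_t \sum_t' a i t t' ^+ 2 <= B ^+ 2 ->
  (forall i, \sum_(y <- F) \sum_t al i t y ^+ 2 <= p ^+ 2) ->
  \sum_i \sum_(y <- F) \sum_t be i t y ^+ 2 <= q ^+ 2 ->
  \sum_i \sum_(y <- F) \sum_t \sum_t' a i t t' * (al i t y * be i t' y) <= B * (p * q).
Proof.
move=> B0 p0 q0 hB hp hq.
have s0 (f : T -> T -> R) : 0 <= \sum_t \sum_t' f t t' ^+ 2.
  by apply: sumr_ge0 => t _; apply: sumr_ge0 => t' _; exact: sqr_ge0.
have s1 (f : T -> Y -> R) : 0 <= \sum_(y <- F) \sum_t f t y ^+ 2.
  by apply: sumr_ge0 => t _; apply: sumr_ge0 => t' _; exact: sqr_ge0.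
apply: (@le_trans _ _ (\sum_i (Num.sqrt (\sum_t \sum_t' a i t t' ^+ 2) * p) *
    Num.sqrt (\sum_(y <- F) \sum_t be i t y ^+ 2))).
  apply: ler_sum => i _; rewrite -mulrA; apply: CS_matrix => //; try exact: sqrtr_ge0.
  - by rewrite sqr_sqrtr.
  - by rewrite sqr_sqrtr.
rewrite mulrA; apply: sum_CS_le => //; first exact: mulr_ge0.
  under eq_bigr do rewrite exprMn sqr_sqrtr//.
  by rewrite -mulr_suml exprMn ler_wpM2r// sqr_ge0.
by under eq_bigr do rewrite sqr_sqrtr//.
Qed.

End CauchySchwarz.

Lemma natrb_sqr (R : pzRingType) (b : bool) : (b%:R : R) ^+ 2 = b%:R.
Proof. by case: b; rewrite ?expr1n ?expr0n. Qed.

Lemma CS_pair (R : realType) (x z p q : R) :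
  (x * p + z * q) ^+ 2 <= (x ^+ 2 + z ^+ 2) * (p ^+ 2 + q ^+ 2).
Proof.
rewrite -subr_ge0 (_ : _ - _ = (x * q - z * p) ^+ 2) ?sqr_ge0//.
by ring.
Qed.

Section PingPongForm.
Variables (R : realType) (P : groupType) (T I : finType) (g : T -> P) (c : T -> I).
Variables (L : I -> P -> bool) (M : nat).
Let s t (y : P) : P := ((g t)^-1 * y)%g.
Hypothesis Ldisj : forall i j y, L i y -> L j y -> i = j.
Hypothesis Lgen : forall t y, ~~ L (c t) y -> L (c t) (s t y).
Hypothesis Lgen2 : forall t t' y, t != t' -> c t = c t' -> ~~ L (c t) y ->
  L (c t) (g t' * (g t)^-1 * y)%g.
Hypothesis Lgen3 : forall t t' y, t != t' -> c t = c t' -> ~~ L (c t) y ->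
  L (c t) ((g t)^-1 * g t' * y)%g.
Hypothesis cM : forall i, (#|[pred t | c t == i]| <= M)%N.

Let bnd (f : P -> R) (C : R) := forall r : seq P, uniq r -> \sum_(z <- r) f z <= C.

Lemma s_inj t : injective (s t). Proof. exact: mulgI. Qed.

Lemma bnd_shift (f : P -> R) C t (F : seq P) : bnd f C -> uniq F -> \sum_(y <- F) f (s t y) <= C.
Proof.
move=> h uF; rewrite -(big_map (s t) predT f); apply: h.
by rewrite map_inj_uniq//; exact: s_inj.
Qed.

Lemma sum_fibre (f : T -> R) (C : R) i : 0 <= C -> (forall t, f t <= C) ->
  \sum_t (c t == i)%:R * f t <= M%:R * C.
Proof.
move=> C0 h; apply: (@le_trans _ _ (\sum_(t in [pred t | c t == i]) C)).
  rewrite [leRHS]big_mkcond; apply: ler_sum => t _.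
  by rewrite inE; case: (c t == i); rewrite ?mul1r ?mul0r.
by rewrite sumr_const -[_ *+ #|_|]mulr_natl ler_wpM2r// ler_nat cM.
Qed.

(* Outside [L (c t)] the map [(t, y) |-> g_t^-1 y] prepends a letter without cancellation,
   hence is injective. *)
Lemma bnd_free (f : P -> R) C (F : seq P) : bnd f C -> uniq F ->
  \sum_(y <- F) \sum_t (~~ L (c t) y)%:R * f (s t y) <= C.
Proof.
move=> h uF.
pose r := [seq p <- [seq (y, t) | y <- F, t <- enum T] | ~~ L (c p.2) p.1].
have -> : \sum_(y <- F) \sum_t (~~ L (c t) y)%:R * f (s t y) = \sum_(z <- [seq s p.2 p.1 | p <-
  r]) f z.
  rewrite big_map big_filter.
  rewrite [RHS]big_mkcond /= big_allpairs_dep /=; apply: eq_bigr => y _; rewrite big_enum /=.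
  by apply: eq_bigr => t _; case: (L _ _); rewrite ?mul1r ?mul0r.
apply: h; rewrite map_inj_in_uniq; last first.
  move=> [y t] [y' t']; rewrite !mem_filter /= => /andP[Ly _] /andP[Ly' _] e.
  (* Equal images begin in the same factor. If the letters differed, [y'] would be
     [g t' (g t)^-1 y], which ping-pong puts in the set that [y'] must avoid. *)
  have cc : c t = c t' by apply: Ldisj (Lgen Ly) _; rewrite e; exact: Lgen.
  have [tt|tt] := eqVneq t t'; first by subst t'; rewrite (s_inj e).
  have y'E : y' = (g t' * (g t)^-1 * y)%g by rewrite -mulgA (e : ((g t)^-1 * y = (g t')^-1 *
    y')%g) mulgA mulgV mul1g.
  by move: Ly'; rewrite y'E -cc (Lgen2 tt cc Ly).
rewrite filter_uniq// allpairs_uniq//; first exact: enum_uniq.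
by move=> [y t] [y' t'].
Qed.

Section Pieces.
Variables (u v : P -> R) (U V B : R) (a : T -> T -> R) (F : seq P).
Hypothesis uF : uniq F.
Hypothesis U0 : 0 <= U.
Hypothesis V0 : 0 <= V.
Hypothesis B0 : 0 <= B.
Hypothesis hu : bnd (fun z => u z ^+ 2) (U ^+ 2).
Hypothesis hv : bnd (fun z => v z ^+ 2) (V ^+ 2).
Hypothesis ha : \sum_t \sum_t' a t t' ^+ 2 <= B ^+ 2.

(** No cancellation on either side, so [bnd_free] controls both functions and the constant is 1. *)
Lemma piece_NN : \sum_(y <- F) \sum_t \sum_t' a t t' *
  (((~~ L (c t) y)%:R * u (s t y)) * ((~~ L (c t') y)%:R * v (s t' y))) <= B * (U * V).
Proof.
apply: (CS_matrix (al := fun t y => (~~ L (c t) y)%:R * u (s t y))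
  (be := fun t y => (~~ L (c t) y)%:R * v (s t y))) => //.
- under eq_bigr do under eq_bigr do rewrite exprMn natrb_sqr.
  exact: bnd_free hu uF.
- under eq_bigr do under eq_bigr do rewrite exprMn natrb_sqr.
  exact: bnd_free hv uF.
Qed.

Lemma sum_blocks : \sum_i \sum_t \sum_t' ((c t == i)%:R * a t t') ^+ 2 <= B ^+ 2.
Proof.
rewrite exchange_big /=; apply: le_trans ha; apply: ler_sum => t _.
rewrite exchange_big /=; apply: ler_sum => t' _.
under eq_bigr do rewrite exprMn natrb_sqr.
by rewrite -mulr_suml (bigD1 (c t))//= eqxx big1 ?addr0 ?mul1r// => i /negbTE; rewrite eq_sym => ->.
Qed.

Lemma pick_block (f : I -> R) t : \sum_i (c t == i)%:R * f i = f (c t).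
Proof.
rewrite (bigD1 (c t))//= eqxx mul1r big1 ?addr0// => i /negbTE; rewrite eq_sym => ->.
by rewrite mul0r.
Qed.

(** Membership in [L (c t)] lets [y] determine the block of [t]. Its at most [M] letters cost
    [sqrt M] on [u]; the side of [v] is free and the sets [L i] are disjoint. *)
Lemma piece_EN : \sum_(y <- F) \sum_t \sum_t' a t t' *
  (((L (c t) y)%:R * u (s t y)) * ((~~ L (c t') y)%:R * v (s t' y))) <= Num.sqrt M%:R * (B * (U *
    V)).
Proof.
have -> : \sum_(y <- F) \sum_t \sum_t' a t t' *
    (((L (c t) y)%:R * u (s t y)) * ((~~ L (c t') y)%:R * v (s t' y))) =
  \sum_i \sum_(y <- F) \sum_t \sum_t' ((c t == i)%:R * a t t') *
    (((c t == i)%:R * u (s t y)) * ((L i y)%:R * ((~~ L (c t') y)%:R * v (s t' y)))).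
  rewrite [RHS]exchange_big; apply: eq_bigr => y _; rewrite [RHS]exchange_big; apply: eq_bigr =>
    t _.
  rewrite [RHS]exchange_big; apply: eq_bigr => t' _ /=.
  rewrite (eq_bigr (fun i => (c t == i)%:R * (a t t' * ((L i y)%:R * u (s t y) * ((~~ L (c t')
    y)%:R * v (s t' y)))))).
    by rewrite pick_block.
  by move=> i _; case: (c t == i); rewrite ?mul0r ?mul1r//; ring.
rewrite (_ : _ * (B * (U * V)) = B * (Num.sqrt M%:R * U * V)); last by ring.
apply: (CS_blocks (a := fun i t t' => (c t == i)%:R * a t t') (al := fun i t y => (c t == i)%:R *
  u (s t y))
  (be := fun i t' y => (L i y)%:R * ((~~ L (c t') y)%:R * v (s t' y)))) => //.
- by rewrite mulr_ge0// sqrtr_ge0.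
- exact: sum_blocks.
- move=> i; rewrite exprMn sqr_sqrtr ?ler0n// exchange_big /=.
  rewrite (eq_bigr (fun t => (c t == i)%:R * \sum_(y <- F) u (s t y) ^+ 2)).
    by apply: sum_fibre; [exact: sqr_ge0|move=> t; exact: (bnd_shift t hu uF)].
  by move=> t _; rewrite mulr_sumr; apply: eq_bigr => y _; rewrite exprMn natrb_sqr.
- apply: le_trans (bnd_free hv uF); rewrite exchange_big /=; apply: ler_sum => y _.
  rewrite exchange_big /=; apply: ler_sum => t _.
  under eq_bigr do rewrite !exprMn !natrb_sqr.
  rewrite -mulr_suml; apply: ler_piMl; first by apply: mulr_ge0; rewrite ?sqr_ge0 ?ler0n.
  have [[i Li]|/forallNP h] := pselect (exists i, L i y); last first.
    by rewrite big1 ?ler01// => i _; case: (boolP (L i y)) => // /h.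
  rewrite (bigD1 i)//= big1 ?addr0; first by case: (L i y).
  by move=> j ji; case: (boolP (L j y)) => // Lj; rewrite (Ldisj Li Lj) eqxx in ji.
Qed.

(** Both letters lie in one block, which costs [sqrt M] on each side. Summability over blocks comes
    from the image point [s t' y] lying in [L i], so that different blocks see disjoint parts of
    [v]. *)
Lemma piece_EE : \sum_(y <- F) \sum_t \sum_t' a t t' *
  (((c t == c t')%:R * u (s t y)) * ((L (c t') (s t' y))%:R * v (s t' y))) <= M%:R * (B * (U * V)).
Proof.
have -> : \sum_(y <- F) \sum_t \sum_t' a t t' *
    (((c t == c t')%:R * u (s t y)) * ((L (c t') (s t' y))%:R * v (s t' y))) =
  \sum_i \sum_(y <- F) \sum_t \sum_t' ((c t == i)%:R * a t t') *
    (((c t == i)%:R * u (s t y)) * ((c t' == i)%:R * ((L i (s t' y))%:R * v (s t' y)))).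
  rewrite [RHS]exchange_big; apply: eq_bigr => y _; rewrite [RHS]exchange_big; apply: eq_bigr =>
    t _.
  rewrite [RHS]exchange_big; apply: eq_bigr => t' _ /=.
  rewrite (eq_bigr (fun i => (c t == i)%:R * (a t t' * ((c t' == i)%:R * u (s t y) * ((L i (s t'
    y))%:R * v (s t' y)))))).
    by rewrite pick_block eq_sym; case: eqP => [->|_]; rewrite ?mul0r.
  by move=> i _; case: (c t == i); rewrite ?mul0r ?mul1r//; ring.
rewrite (_ : _ * (B * (U * V)) = B * (Num.sqrt M%:R * U * (Num.sqrt M%:R * V))); last first.
  by rewrite -{1}[M%:R]sqr_sqrtr ?ler0n//; ring.
apply: (CS_blocks (a := fun i t t' => (c t == i)%:R * a t t') (al := fun i t y => (c t == i)%:R *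
  u (s t y))
  (be := fun i t' y => (c t' == i)%:R * ((L i (s t' y))%:R * v (s t' y)))) => //.
- by rewrite mulr_ge0// sqrtr_ge0.
- by rewrite mulr_ge0// sqrtr_ge0.
- exact: sum_blocks.
- move=> i; rewrite exprMn sqr_sqrtr ?ler0n// exchange_big /=.
  rewrite (eq_bigr (fun t => (c t == i)%:R * \sum_(y <- F) u (s t y) ^+ 2)).
    by apply: sum_fibre; [exact: sqr_ge0|move=> t; exact: (bnd_shift t hu uF)].
  by move=> t _; rewrite mulr_sumr; apply: eq_bigr => y _; rewrite exprMn natrb_sqr.
pose Z := undup [seq s t y | t <- enum T, y <- F].
pose W i := \sum_(z <- Z) (L i z)%:R * v z ^+ 2.
have W0 i : 0 <= W i by apply: sumr_ge0 => z _; rewrite mulr_ge0 ?sqr_ge0.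
have WV : \sum_i W i <= V ^+ 2.
  apply: le_trans (hv (undup_uniq [seq s t y | t <- enum T, y <- F])).
  rewrite exchange_big; apply: ler_sum => z _ /=.
  rewrite -mulr_suml; apply: ler_piMl; first exact: sqr_ge0.
  have [[i Li]|/forallNP h] := pselect (exists i, L i z); last first.
    by rewrite big1 ?ler01// => i _; case: (boolP (L i z)) => // /h.
  rewrite (bigD1 i)//= big1 ?addr0; first by case: (L i z).
  by move=> j ji; case: (boolP (L j z)) => // Lj; rewrite (Ldisj Li Lj) eqxx in ji.
apply: (@le_trans _ _ (\sum_i M%:R * W i)); last first.
  by rewrite -mulr_sumr exprMn sqr_sqrtr ?ler0n// ler_wpM2l.
apply: ler_sum => i _; rewrite exchange_big /=.
rewrite (eq_bigr (fun t => (c t == i)%:R * \sum_(y <- F) (L i (s t y))%:R * v (s t y) ^+ 2)).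
  apply: sum_fibre => // t.
  rewrite -(big_map (s t) predT (fun z => (L i z)%:R * v z ^+ 2)).
  have sub : {subset [seq s t y | y <- F] <= Z}.
    move=> z /mapP[y yF ->]; rewrite mem_undup; apply/allpairsP; exists (t, y).
    by rewrite mem_enum.
  rewrite (perm_big [seq z <- Z | z \in [seq s t y | y <- F]]).
    rewrite big_filter /W [leLHS]big_mkcond; apply: ler_sum => z _.
    by case: ifP => // _; rewrite mulr_ge0// sqr_ge0.
  apply: uniq_perm; rewrite ?filter_uniq ?undup_uniq//.
    by rewrite map_inj_uniq//; exact: s_inj.
  by move=> z; rewrite mem_filter; case: (boolP (z \in [seq s t y | y <- F])) => // /sub ->.
by move=> t _; rewrite mulr_sumr; apply: eq_bigr => y _; rewrite !exprMn !natrb_sqr.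
Qed.

End Pieces.

(* According to whether [y] lies in the ping-pong sets of the letters [t] and [t'], the
   off-diagonal part splits into pieces bounded by [1], twice [sqrt M], and twice [M]; the
   diagonal part is bounded by [sqrt #|T|]. *)
Lemma pingpong_form_bound : form_bound s
  (Num.sqrt (#|T|%:R + (1 + 2 * Num.sqrt M%:R + 2 * M%:R) ^+ 2) : R).
Proof.
move=> a u v A U V a0 u0 v0 A0 U0 V0 ha hu hv F.
have uF : uniq F by exact: fset_uniq.
have tobnd (w : P -> R) W : (\esum_(x in [set: P]) (w x ^+ 2)%:E <= (W ^+ 2)%:E)%E ->
    bnd (fun z => w z ^+ 2) (W ^+ 2).
  by move=> h r ur; rewrite -lee_fin; apply: le_trans h; exact: (sum_le_esum (fun z => w z ^+ 2)).
have {}hu := tobnd _ _ hu; have {}hv := tobnd _ _ hv.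
(* The diagonal is split off because a letter may cancel completely against itself: ping-pong for
   quotients needs [t != t']. *)
pose a' t t' := (t != t')%:R * a t t'.
pose B := Num.sqrt (\sum_t \sum_t' a' t t' ^+ 2).
pose D := Num.sqrt (\sum_t a t t ^+ 2).
have B0 : 0 <= B by exact: sqrtr_ge0.
have D0 : 0 <= D by exact: sqrtr_ge0.
have hB : \sum_t \sum_t' a' t t' ^+ 2 <= B ^+ 2.
  by rewrite sqr_sqrtr// sumr_ge0// => t _; apply: sumr_ge0 => t' _; exact: sqr_ge0.
have hBt : \sum_t \sum_t' a' t' t ^+ 2 <= B ^+ 2 by rewrite exchange_big.
have hD : \sum_t a t t ^+ 2 <= D ^+ 2.
  by rewrite sqr_sqrtr// sumr_ge0// => t _; exact: sqr_ge0.
have DBA : D ^+ 2 + B ^+ 2 <= A ^+ 2.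
  rewrite !sqr_sqrtr; first last.
  - by apply: sumr_ge0 => t _; exact: sqr_ge0.
  - by apply: sumr_ge0 => t _; apply: sumr_ge0 => t' _; exact: sqr_ge0.
  apply: le_trans ha; rewrite -big_split; apply: ler_sum => t _ /=.
  rewrite [leRHS](bigD1 t)//= lerD2l (bigD1 t)//= /a' eqxx mul0r expr0n add0r.
  by apply: ler_sum => t' tt'; rewrite eq_sym tt' mul1r.
have NN := piece_NN uF U0 V0 B0 hu hv hB.
have EN := piece_EN uF U0 V0 B0 hu hv hB.
have NE := piece_EN uF V0 U0 B0 hv hu hBt.
have EE := piece_EE uF U0 V0 B0 hu hv hB.
have EE' := piece_EE uF V0 U0 B0 hv hu hBt.
have diag : \sum_(y <- F) \sum_t a t t * (u (s t y) * v (s t y)) <= Num.sqrt #|T|%:R * D * (U * V).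
  rewrite exchange_big; apply: (@le_trans _ _ (\sum_t a t t * (U * V))).
    apply: ler_sum => t _; rewrite -mulr_sumr ler_wpM2l//.
    by apply: sum_CS_le => //; [exact: (bnd_shift t hu uF)|exact: (bnd_shift t hv uF)].
  rewrite -mulr_suml ler_wpM2r ?mulr_ge0// mulrC.
  under eq_bigr do rewrite -[a _ _]mulr1.
  apply: sum_CS_le => //.
  under eq_bigr do rewrite expr1n.
  by rewrite sumr_const sqr_sqrtr ?ler0n.
have split y : \sum_t \sum_t' a t t' * (u (s t y) * v (s t' y)) <=
    \sum_t a t t * (u (s t y) * v (s t y)) +
   (\sum_t \sum_t' a' t t' * (((~~ L (c t) y)%:R * u (s t y)) * ((~~ L (c t') y)%:R * v (s t' y))) +
    \sum_t \sum_t' a' t t' * (((L (c t) y)%:R * u (s t y)) * ((~~ L (c t') y)%:R * v (s t' y))) +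
    \sum_t \sum_t' a' t' t * (((L (c t) y)%:R * v (s t y)) * ((~~ L (c t') y)%:R * u (s t' y))) +
    \sum_t \sum_t' a' t t' * (((c t == c t')%:R * u (s t y)) * ((L (c t') (s t' y))%:R * v (s t'
      y))) +
    \sum_t \sum_t' a' t' t * (((c t == c t')%:R * v (s t y)) * ((L (c t') (s t' y))%:R * u (s t'
      y)))).
  rewrite [X in _ + (_ + _ + X + _ + _)]exchange_big [X in _ + (_ + _ + _ + _ + X)]exchange_big /=.
  rewrite -!big_split /=; apply: ler_sum => t _; rewrite -!big_split /=.
  have nn t' : 0 <= a t t' * (u (s t y) * v (s t' y)) by rewrite !mulr_ge0.
  rewrite (bigD1 t)//= lerD2l [leRHS](bigD1 t)//=.
  rewrite {1 2 3 4 5}/a' eqxx /= !mul0r !addr0 add0r.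
  apply: ler_sum => t' tt'; rewrite /a' eq_sym tt' mul1r.
  have tt : t != t' by rewrite eq_sym.
  have := nn t'; set X := a t t' * _ => X0.
  rewrite (_ : _ + _ + _ + _ + _ = ((~~ L (c t) y)%:R * (~~ L (c t') y)%:R + (L (c t) y)%:R * (~~
    L (c t') y)%:R
    + (~~ L (c t) y)%:R * (L (c t') y)%:R + (c t == c t')%:R * (L (c t') (s t' y))%:R
    + (c t == c t')%:R * (L (c t) (s t y))%:R) * X); last first.
    by rewrite /X [c t' == _]eq_sym; ring.
  (* The five indicator coefficients must sum to at least 1. The critical case is [y] in both sets:
     the letters then share a factor, and [s t y = g_t^-1 g_t' (s t' y)] re-enters the set unless
     [s t' y] is already there. Hence the two pieces of the last kind. *)
  rewrite -[leLHS]mul1r ler_wpM2r//.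
  case: (boolP (L (c t) y)) => Lt; case: (boolP (L (c t') y)) => Lt' /=; last 3 first.
  - by rewrite !mul0r !mul1r add0r addr0 -addrA lerDl addr_ge0// mulr_ge0// ler0n.
  - by rewrite !mul0r !mul1r !add0r -addrA lerDl addr_ge0// mulr_ge0// ler0n.
  - by rewrite mulr1 mul0r mulr0 !addr0 -addrA lerDl addr_ge0// mulr_ge0// ler0n.
  have cc := Ldisj Lt Lt'; rewrite cc eqxx !mul1r !mulr0 mul0r !add0r -cc.
  case: (boolP (L (c t) (s t' y))) => L'; first by rewrite lerDl ler0n.
  suff -> : L (c t) (s t y) by rewrite add0r.
  have -> : s t y = ((g t)^-1 * g t' * s t' y)%g by rewrite /s -mulgA [(g t' * _)%g]mulgA mulgV
    mul1g.
  exact: Lgen3.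
apply: (@le_trans _ _ (Num.sqrt #|T|%:R * D * (U * V) + (B * (U * V) + Num.sqrt M%:R * (B * (U *
  V)) +
   Num.sqrt M%:R * (B * (V * U)) + M%:R * (B * (U * V)) + M%:R * (B * (V * U))))).
  apply: (le_trans (ler_sum _ (fun y _ => split y))).
  by rewrite !big_split /=; repeat apply: lerD.
set ka := 1 + _ + _.
have -> : Num.sqrt #|T|%:R * D * (U * V) + (B * (U * V) + Num.sqrt M%:R * (B * (U * V)) +
   Num.sqrt M%:R * (B * (V * U)) + M%:R * (B * (U * V)) + M%:R * (B * (V * U))) =
   (Num.sqrt #|T|%:R * D + ka * B) * (U * V) by rewrite /ka; ring.
rewrite mulrA ler_wpM2r ?mulr_ge0//; apply: le_of_sqr; first by rewrite mulr_ge0// sqrtr_ge0.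
have n0 : 0 <= #|T|%:R :> R by exact: ler0n.
rewrite exprMn sqr_sqrtr; last by rewrite addr_ge0// sqr_ge0.
(* The diagonal part [D] and the off-diagonal part [B] of the coefficients are orthogonal, so a
   planar Cauchy-Schwarz adds the squares of the two constants. *)
apply: (@le_trans _ _ ((#|T|%:R + ka ^+ 2) * (D ^+ 2 + B ^+ 2))); last first.
  by rewrite ler_wpM2l// addr_ge0// sqr_ge0.
rewrite -[X in X + ka ^+ 2](sqr_sqrtr n0).
exact: CS_pair.
Qed.

End PingPongForm.

(** * Convolution channels *)

(** [shift] is contravariant, whence the reversed order of the permutations. *)
Lemma chan_comp (R : realType) (X : choiceType) (I J : finType) (s : I -> bijection X) (t : J ->
  bijection X) :
  @chan R X I s \o @chan R X J t = @chan R X (I * J)%type (fun p => bij_comp (t p.2) (s p.1)).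
Proof.
apply: boolp.funext => xi; apply: boolp.funext => w; rewrite /= !chanE.
under eq_bigr => i _ do rewrite chanE (linear_funZ (shift_linear _)).
rewrite -scaler_sumr scalerA card_prod natrM invfM -rmorphM; congr (_ *: _).
rewrite -(pair_big predT predT (fun i j => shift (bij_comp (t j) (s i)) (xi (shift (binv
  (bij_comp (t j) (s i))) w)))) /=.
apply: eq_bigr => i _.
rewrite (big_morph _ (fun u v => linear_funD (shift_linear (s i)) u v) (linear_fun0 (shift_linear
  (s i)))).
apply: eq_bigr => j _; apply: ell2_eq => x /=; congr (ell2_fun (xi _) _).
exact: ell2_eq.
Qed.

Definition invbij (P : groupType) : bijection P :=
  @Bij P (fun x : P => x^-1%g) (fun x : P => x^-1%g) (@invgK P) (@invgK P).

Section GroupChannels.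
Variables (R : realType) (P : groupType) (T : {fset P}).

Definition lbij (g : P) : bijection P := @Bij P ( *%g g^-1)%g ( *%g g)%g (mulVKg g) (mulKg g).

Definition rbij (g : P) : bijection P := @Bij P ( *%g^~ g)%g ( *%g^~ g^-1)%g (mulgK g) (mulgVK g).

Lemma Phi_l_chan : @Phi_l R P T = @chan R P T (fun t => lbij (val t)).
Proof.
apply: boolp.funext => xi; rewrite /Phi_l /chan cardfE; congr (_ *: _).
rewrite (big_seq_fsetE _ _ predT (fun g => Ad (lambda g) xi)) /=; apply: eq_bigr => t _.
by congr Ad; apply: boolp.funext => u; exact: ell2_eq.
Qed.

Lemma Phi_r_chan : @Phi_r R P T = @chan R P T (fun t => rbij (val t)).
Proof.
apply: boolp.funext => xi; rewrite /Phi_r /chan cardfE; congr (_ *: _).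
rewrite (big_seq_fsetE _ _ predT (fun g => Ad (rho g) xi)) /=; apply: eq_bigr => t _.
by congr Ad; apply: boolp.funext => u; exact: ell2_eq.
Qed.

Definition lrbij (p : T * T) : bijection P := bij_comp (rbij (val p.2)) (lbij (val p.1)).

Lemma Phi_lr_chan : @Phi_l R P T \o @Phi_r R P T = @chan R P (T * T)%type lrbij.
Proof. by rewrite Phi_l_chan Phi_r_chan chan_comp. Qed.

(** The diagonal pairs save [ln n] each; being [n] out of [n^2], they lower the mean by
    [ln n / n]. *)
Lemma Hmin_lr_le : (0 < #|` T|)%N ->
  (Hmin (@chan R P (T * T)%type lrbij) <=
   (2 * ln #|` T|%:R - ln #|` T|%:R / #|` T|%:R)%:E)%E.
Proof.
rewrite cardfE => T0; have n0 : 0 < #|{: T}|%:R :> R by rewrite ltr0n.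
have TT0 : (0 < #|{: T * T}|)%N by rewrite card_prod muln_gt0 T0.
apply: (le_trans (Hmin_le_delta R lrbij TT0 1%g)); rewrite lee_fin.
set n : R := #|{: T}|%:R in n0 *.
have nn : #|{: T * T}|%:R = n * n :> R by rewrite card_prod natrM.
pose cnt (p : T * T) := #|[pred q : T * T | bij_inv (lrbij q) 1%g == bij_inv (lrbij p) 1%g]|.
have cnt1 p : (0 < cnt p)%N by apply/card_gt0P; exists p; rewrite inE.
have cntd t : (#|{: T}| <= cnt (t, t))%N.
  rewrite -(card_imset predT (f := fun x : T => (x, x))); last by move=> x y [].
  apply/subset_leq_card/fintype.subsetP => q /imsetP[x _ ->]; rewrite inE /=.
  by rewrite !mul1g !mulgV eqxx.
have ub p (m : R) : 0 < m -> m <= (cnt p)%:R -> - ln (#|{: T * T}|%:R^-1 * (cnt p)%:R) <= 2 * ln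
  n - ln m.
  move=> m0 hm; have c0 : 0 < (cnt p)%:R :> R by rewrite ltr0n.
  rewrite nn lnM ?posrE ?invr_gt0 ?mulr_gt0// lnV ?posrE ?mulr_gt0// lnM ?posrE//.
  by have := ler_ln; move=> /(_ R m (cnt p)%:R); rewrite !posrE => /(_ m0 c0); rewrite hm =>
    /esym; lra.
apply: (@le_trans _ _ (#|{: T * T}|%:R^-1 * \sum_(t : T) \sum_(t' : T) (2 * ln n - (t == t')%:R *
  ln n))).
  rewrite ler_wpM2l ?invr_ge0 ?ler0n//.
  rewrite (pair_big predT predT (fun t t' : T => 2 * ln n - (t == t')%:R * ln n)) /=.
  apply: ler_sum => -[t t'] _ /=.
  case: eqP => [<-|_].
    rewrite mul1r; apply: (ub (t, t) n n0).
    by rewrite ler_nat; exact: cntd.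
  rewrite mul0r -(@ln1 R); apply: (ub (t, t') 1 ltr01).
  by rewrite (ler_nat R 1); exact: cnt1.
rewrite nn; under eq_bigr do rewrite sumrB.
rewrite sumrB !sumr_const.
have -> : \sum_(t : T) \sum_(t' : T) (t == t')%:R * ln n = n * ln n.
  rewrite (eq_bigr (fun=> ln n)); first by rewrite sumr_const -[LHS]mulr_natl.
  move=> t _; rewrite (bigD1 t)//= eqxx mul1r big1 ?addr0// => t' /negbTE; rewrite eq_sym => ->.
  by rewrite mul0r.
rewrite -[_ *+ _ *+ _]mulr_natl -[_ *+ _]mulr_natl -/n le_eqVlt; apply/orP; left; apply/eqP.
by field; rewrite gt_eqF.
Qed.

End GroupChannels.

(** * Numerical constants and the strict inequality *)

Lemma multiplicative1 (G H : groupType) (f : {multiplicative G -> H}) : f 1%g = 1%g.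
Proof. by apply: (@mulgI _ (f 1%g)); rewrite -gmulfM !mulg1. Qed.

Lemma multiplicativeV (G H : groupType) (f : {multiplicative G -> H}) x : f x^-1%g = (f x)^-1%g.
Proof. by apply: (@mulgI _ (f x)); rewrite -gmulfM !mulgV multiplicative1. Qed.

Lemma kappa_bound (R : realType) (M : nat) (n : R) :
  expR (64 * (M ^ 2 + M + 1)%N%:R) <= n ->
  [/\ 0 < n, n + (1 + 2 * Num.sqrt M%:R + 2 * M%:R) ^+ 2 <= n ^+ 2 &
      2 * (1 + 2 * Num.sqrt M%:R + 2 * M%:R) ^+ 2 < ln n].
Proof.
move=> h; have n0 : 0 < n := lt_le_trans (expR_gt0 _) h.
have m0 : 0 <= M%:R :> R by exact: ler0n.
have hl : 64 * (M%:R ^+ 2 + M%:R + 1) <= ln n.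
  rewrite -(expRK (64 * (M%:R ^+ 2 + M%:R + 1))) ler_ln ?posrE ?expR_gt0//.
  by move: h; rewrite !natrD natrX.
have ln_n : ln n < n := ln_sublinear n0.
have s0 := sqrtr_ge0 (M%:R : R); have ss : Num.sqrt M%:R ^+ 2 = M%:R :> R by rewrite sqr_sqrtr.
move: (Num.sqrt M%:R) s0 ss => x x0 xx.
(* The square of a sum of three terms is at most three times the sum of their squares. Twice this
   bound is below [64 (M^2 + M + 1) <= ln n], and [ln n < n] gives the other inequality. *)
have hk : (1 + 2 * x + 2 * M%:R) ^+ 2 <= 12 * M%:R ^+ 2 + 12 * M%:R + 3.
  have := sqr_ge0 (1 - 2 * x); have := sqr_ge0 (1 - 2 * M%:R : R); have := sqr_ge0 (2 * x - 2 *
    M%:R).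
  by nra.
by split=> //; nra.
Qed.

Theorem theorem8 (R : realType) (M N : nat)
    (hM : (0 < M)%N) (hN : (0 < N)%N)
    (hMN : expR (64 * (M ^ 2 + M + 1)%N%:R) <= N%:R :> R)
    (G : 'I_N -> groupType)
    (hG : forall i, exists x : G i, x != 1%g)
    (r : 'I_N -> nat)
    (hr : forall i, has_rank (G i) (r i))
    (hrM : forall i, (r i <= M)%N)
    (S : forall i, {fset G i})
    (hSgen : forall i, generates (S i))
    (hScard : forall i, #|` S i| = r i)
    (hS : forall i,
        (forall g : G i, word_ball R (S i) 2 g -> ~ order_two g) \/
        (5%:R%:E <= girth R (S i))%E)
    (P : groupType)
    (iota : forall i, {multiplicative G i -> P})
    (hP : is_free_product iota) :
  let T : {fset P} := (\big[fsetU/fset0]_(i < N) [fset iota i g | g in S i])%fset in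
  (Hmin_reg (@Phi_l R P T \o @Phi_r R P T)
     < Hmin_reg (@Phi_l R P T) + Hmin_reg (@Phi_r R P T))%E.
Proof.
pose T : {fset P} := (\big[fsetU/fset0]_(i < N) [fset iota i g | g in S i])%fset.
suff : (Hmin_reg (@Phi_l R P T \o @Phi_r R P T)
    < Hmin_reg (@Phi_l R P T) + Hmin_reg (@Phi_r R P T))%E by [].
have [L [Ldisj Lpp L1]] := free_product_pingpong hP.
have S1 i x : x \in S i -> x != 1%g.
  by move=> xS; apply: contraTneq xS => ->; case: (hSgen i).
have TP t : t \in T -> exists i, exists x : G i, x \in S i /\ iota i x = t.
  by move=> /bigfcupP[i _ /imfsetP[x /= xS ->]]; exists i, x.
have TI i (x : G i) : x \in S i -> iota i x \in T.
  by move=> xS; apply/bigfcupP; exists i; rewrite ?mem_index_enum//; apply/imfsetP; exists x.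
have /boolp.choice[c hc] : forall t : T, exists i, exists x : G i, x \in S i /\ iota i x = val t.
  by move=> t; apply: TP; exact: valP.
have hc' (t : T) i : c t = i -> exists x : G i, x \in S i /\ iota i x = val t.
  by move=> <-; exact: hc.
have Lgen (t : T) y : ~~ L (c t) y -> L (c t) ((val t)^-1 * y)%g.
  have [x [xS <-]] := hc t; rewrite -multiplicativeV; apply: Lpp.
  by rewrite invg_eq1; exact: S1 xS.
have diff (t t' : T) : t != t' -> c t = c t' ->
    exists x y : G (c t), [/\ x != y, iota _ x = val t & iota _ y = val t'].
  move=> tt cc; have [x [_ xE]] := hc t; have [y [_ yE]] := hc' t' _ (esym cc).
  by exists x, y; split=> //; apply: contraNneq tt => xy; rewrite -val_eqE -xE -yE xy.
have Lgen2 (t t' : T) y : t != t' -> c t = c t' -> ~~ L (c t) y ->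
    L (c t) (val t' * (val t)^-1 * y)%g.
  move=> tt cc; have [x [z [xz <- <-]]] := diff _ _ tt cc.
  rewrite -multiplicativeV -gmulfM; apply: Lpp; apply: contra xz => /eqP h.
  by apply/eqP; rewrite -[z](mulgVK x) h mul1g.
have Lgen3 (t t' : T) y : t != t' -> c t = c t' -> ~~ L (c t) y ->
    L (c t) ((val t)^-1 * val t' * y)%g.
  move=> tt cc; have [x [z [xz <- <-]]] := diff _ _ tt cc.
  rewrite -multiplicativeV -gmulfM; apply: Lpp; apply: contra xz => /eqP h.
  by apply/eqP; rewrite -[z](mulVKg x) h mulg1.
have cM i : (#|[pred t : T | c t == i]| <= M)%N.
  apply: leq_trans (hrM i); rewrite -(hScard i) cardE -(size_map val) -(size_map (iota i)).
  apply: uniq_leq_size; first by rewrite map_inj_uniq ?enum_uniq//; exact: val_inj.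
  move=> _ /mapP[t + ->]; rewrite mem_enum inE => /eqP /hc'[x [xS xE]].
  by apply/mapP; exists x.
(* An empty generating set would make the trivial subgroup everything, against [hG]. *)
have ne i : exists x : G i, x \in S i.
  apply: contrapT => /forallNP h; have [y] := hG i.
  have [_ gen] := hSgen i.
  have e : [set 1%g : G i] = setT.
    by apply: gen => // [a b -> ->|a /h//]; rewrite /= invg1 mulg1.
  have : [set: G i] y by [].
  by rewrite -e => ->; rewrite eqxx.
pose z i := sval (boolp.cid (ne i)).
have zS i : z i \in S i by exact: svalP (boolp.cid (ne i)).
(* One letter is picked per factor; ping-pong at the neutral element places it in the set of its own
   factor, and disjointness keeps the letters distinct. *)
have Nn : (N <= #|` T|)%N.
  pose f (i : 'I_N) : T := [` TI i (z i) (zS i)]%fset.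
  rewrite cardfE -{1}(card_ord N); apply: (@leq_card _ _ f) => i j /(congr1 val) /= e.
  have h k : L k (iota k (z k)).
    by have := Lpp k (z k) 1%g (S1 _ _ (zS k)) (L1 k); rewrite mulg1.
  by apply: Ldisj (h i) _; rewrite e; exact: h.
pose n : R := #|` T|%:R.
have hn : expR (64 * (M ^ 2 + M + 1)%N%:R) <= n by apply: le_trans hMN _; rewrite ler_nat.
have [n0 kn kl] := kappa_bound hn.
have T0 : (0 < #|` T|)%N by rewrite -(ltr0n R).
have T0' : (0 < #|{: T}|)%N by rewrite -cardfE.
have nE : #|{: T}|%:R = n by rewrite /n cardfE.
set kappa := 1 + _ + _ in kn kl.
pose K : R := Num.sqrt (n + kappa ^+ 2).
have K2 : K ^+ 2 = n + kappa ^+ 2 by rewrite sqr_sqrtr// addr_ge0 ?sqr_ge0// ltW.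
have K0 : 0 < K by rewrite sqrtr_gt0 ltr_wpDr// sqr_ge0.
have Kn : K <= #|{: T}|%:R.
  by rewrite nE -[n]ger0_norm ?(ltW n0)// -sqrtr_sqr ler_wsqrtr.
have fl : form_bound (fun t : T => lbij (val t)) K.
  have := @pingpong_form_bound R P T 'I_N val c L M Ldisj Lgen Lgen2 Lgen3 cM.
  by rewrite nE.
(* Inversion conjugates [x |-> g^-1 x] into [x |-> x g]. *)
have fr : form_bound (fun t : T => rbij (val t)) K.
  apply: (form_bound_conj (s := fun t : T => lbij (val t)) (phi := invbij P) _ fl).
  by move=> t x; rewrite /= invgM invgK.
have lb (s : T -> bijection P) : form_bound s K ->
    exists2 l : R, Hmin_reg (@chan R P T s) = l%:E & ln n - kappa ^+ 2 / n <= l.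
  move=> fs; have [l [lE _ hl]] := @Hmin_reg_chan R P 1%g T s T0'.
  exists l => //; apply: le_trans (hl _ (fun k => Hmin_btens_ge k K0 Kn fs)).
  (* The bound is [- ln ((n + kappa^2) / n^2) = ln n - ln (1 + kappa^2 / n)], and
     [ln (1 + q) <= q]. *)
  rewrite nE expr_div_n K2 ln_div ?posrE ?exprn_gt0// ?ltr_wpDr ?sqr_ge0// lnXn//.
  have -> : n + kappa ^+ 2 = n * (1 + kappa ^+ 2 / n) by field; rewrite gt_eqF.
  have q0 : 0 <= kappa ^+ 2 / n by rewrite divr_ge0 ?sqr_ge0// ltW.
  rewrite lnM ?posrE//; last by lra.
  by have := @le_ln1Dx R (kappa ^+ 2 / n); rewrite mulr2n; lra.
have [ll llE hll] := lb _ fl; have [lr lrE hlr] := lb _ fr.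
rewrite Phi_lr_chan Phi_l_chan Phi_r_chan llE lrE.
have TT0 : (0 < #|{: T * T}|)%N by rewrite card_prod muln_gt0 T0'.
have [l [-> hl _]] := @Hmin_reg_chan R P 1%g _ (@lrbij P T) TT0.
have := le_trans hl (Hmin_lr_le R T0); rewrite -/n -EFinD lee_fin lte_fin => ub.
(* The defects of the two factors together stay below the saving of the composition. *)
have : kappa ^+ 2 / n + kappa ^+ 2 / n < ln n / n by rewrite -mulrDl ltr_pM2r ?invr_gt0//; lra.
by lra.
Qed.
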